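(* In the spiked model described in the context, with fixed rank $r\ge 1$, fixed signal singular values $t_1>\dots>t_r>0$ and $p/n\to\gamma$, the optimal singular value shrinkage estimator $\widehat{\mathbf X}^{\mathbf q^*}$ of $\mathbf X$ from $\mathbf Y$, i.e. the one whose vector of singular values $\mathbf q^*=(q_1^*,\dots,q_r^* )$ minimizes the asymptotic operator norm loss $\mathcal L_\infty(\mathbf q)$ over $\mathbf q\in\mathbb R^r$, has singular values $$q_k^*=\begin{cases} t_k\sqrt{\dfrac{t_k^2+\min\{1,\gamma\}}{t_k^2+\max\{1,\gamma\}}}, & \text{if } \sigma_k>1+\sqrt\gamma,\\[2mm] 0, & \text{otherwise,}\end{cases}\qquad 1\le k\le r.$$ (That is, this choice of $\mathbf q^*$ attains the minimum of $\mathcal L_\infty$.) Moreover, the loss $\|\widehat{\mathbf X}^{\mathbf q^*}-\mathbf X\|_{\mathrm{op}}$ converges almost surely to $$\mathcal L_\infty(\mathbf q^* )=\max_{1\le k\le r} t_k\sqrt{1-\min\{c_k^2,\tilde c_k^2\}}=t_1\sqrt{1-\min\{c_1^2,\tilde c_1^2\}}.$$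
   Context: Model. For each $n$, with $p=p(n)$, one observes the $p\times n$ matrix $\mathbf Y=\mathbf X+\mathbf G$, where $\mathbf G$ has iid $N(0,1/n)$ entries and $\mathbf X=\sum_{k=1}^r t_k\mathbf u_k\mathbf v_k^T$, with $\mathbf u_1,\dots,\mathbf u_r$ orthonormal in $\mathbb R^p$ and $\mathbf v_1,\dots,\mathbf v_r$ orthonormal in $\mathbb R^n$ (these vectors depend on $n$; the dependence is suppressed). The rank $r$ and the singular values $t_1>\dots>t_r>0$ are fixed, independent of $n$ and $p$. Both $n\to\infty$ and $p=p(n)\to\infty$, with $p(n)/n\to\gamma\in[0,\infty)$, the aspect ratio. Shrinkage. Let $\hat{\mathbf u}_1,\dots,\hat{\mathbf u}_r$ and $\hat{\mathbf v}_1,\dots,\hat{\mathbf v}_r$ be the left and right singular vectors of $\mathbf Y$ corresponding to its top $r$ singular values (in decreasing order). For $\mathbf q=(q_1,\dots,q_r)$ let $\widehat{\mathbf X}^{\mathbf q}=\sum_{k=1}^r q_k\hat{\mathbf u}_k\hat{\mathbf v}_k^T$. The asymptotic loss is the almost sure limit $\mathcal L_\infty(\mathbf q)=\lim_{n\to\infty}\|\widehat{\mathbf X}^{\mathbf q}-\mathbf X\|_{\mathrm{op}}$, which is well defined (deterministic) for each fixed $\mathbf q$; $\|\cdot\|_{\mathrm{op}}$ is the operator (spectral) norm. Limiting quantities. $\sigma_k\ge 0$ denotes the almost sure limit of the $k$-th largest singular value of $\mathbf Y$, given by $\sigma_k^2=(t_k^2+1)(1+\gamma/t_k^2)$ if $t_k>\gamma^{1/4}$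 and $\sigma_k^2=(1+\sqrt\gamma)^2$ if $t_k\le\gamma^{1/4}$. The numbers $c_k,\tilde c_k\ge0$ are defined by $$c_k^2=\frac{1-\gamma/t_k^4}{1+\gamma/t_k^2},\qquad \tilde c_k^2=\frac{1-\gamma/t_k^4}{1+1/t_k^2}\qquad\text{if } t_k>\gamma^{1/4},$$ and $c_k=\tilde c_k=0$ if $t_k\le\gamma^{1/4}$; they are the almost sure limits of $|\langle\hat{\mathbf u}_k,\mathbf u_k\rangle|$ and $|\langle\hat{\mathbf v}_k,\mathbf v_k\rangle|$. *)

(* Defs.v *)
From HB Require Import structures.
From mathcomp Require Import all_boot all_order all_algebra.
From mathcomp Require Import all_classical all_reals all_analysis.

Set Implicit Arguments.
Unset Strict Implicit.
Unset Printing Implicit Defensive.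

Import Order.TTheory GRing.Theory Num.Theory.
Import numFieldNormedType.Exports.

Local Open Scope classical_set_scope.
Local Open Scope ring_scope.

Definition l2norm (R : realType) (n : nat) (x : 'cV[R]_n) : R :=
  Num.sqrt (\sum_(i < n) x i 0 ^+ 2).

Definition opnorm (R : realType) (m n : nat) (A : 'M[R]_(m, n)) : R :=
  sup [set l2norm (A *m x) | x in [set x : 'cV[R]_n | l2norm x <= 1]].

Definition orthonormal_family (R : realType) (r n : nat) (x : 'I_r -> 'cV[R]_n) : Prop :=
  forall i j : 'I_r, (x i)^T *m x j = (i == j)%:R%:M.

(* Y = U S V^T, with S the m x n rectangular diagonal matrix of entries s 0,
   s 1, ..., of which only those of index < minn m n matter. *)
Definition is_svd (R : realType) (m n : nat) (Y : 'M[R]_(m, n))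
    (U : 'M[R]_m) (s : nat -> R) (V : 'M[R]_n) : Prop :=
  [/\ U^T *m U = 1%:M,
      V^T *m V = 1%:M,
      forall k, 0 <= s k,
      forall k l, (k <= l)%N -> s l <= s k
    & Y = U *m (\matrix_(i < m, j < n) (s i *+ (i == j :> nat))) *m V^T].

(* Indices are 0-based.  Singular vectors are determined only up to sign (up to
   rotation inside a repeated singular space), so this is a relation.  It leaves
   uh k and vh k free for k >= minn m n, where no k-th singular pair exists. *)
Definition top_singular_vectors (R : realType) (m n r : nat) (Y : 'M[R]_(m, n))
    (uh : 'I_r -> 'cV[R]_m) (vh : 'I_r -> 'cV[R]_n) : Prop :=
  exists (U : 'M[R]_m) (s : nat -> R) (V : 'M[R]_n),
    is_svd Y U s V /\
    forall (k : 'I_r) (i : 'I_m) (j : 'I_n),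
      i = k :> nat -> j = k :> nat -> uh k = col i U /\ vh k = col j V.

(* With q = t this is the signal; with q the shrunken singular values and x, y
   the empirical singular vectors it is the shrinkage estimator. *)
Definition low_rank (R : realType) (m n r : nat) (q : 'I_r -> R)
    (x : 'I_r -> 'cV[R]_m) (y : 'I_r -> 'cV[R]_n) : 'M[R]_(m, n) :=
  \sum_(k < r) q k *: (x k *m (y k)^T).

Definition mutually_independent (R : realType) (d : measure_display)
    (T : measurableType d) (P : probability T R) (I : finType)
    (X : I -> {RV P >-> R}) : Prop :=
  forall (J : {set I}) (A : I -> set R),
    (forall i, i \in J -> measurable (A i)) ->
    P (\bigcap_(i in [set` J]) (X i @^-1` A i)) =
    (\prod_(i in J) P (X i @^-1` A i))%E.

(* normal_prob takes the standard deviation, so the variance is 1/n. *)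
Definition gaussian_noise (R : realType) (d : measure_display)
    (T : measurableType d) (P : probability T R) (m n : nat)
    (G : 'I_m * 'I_n -> {RV P >-> R}) : Prop :=
  mutually_independent G /\
  forall (ij : 'I_m * 'I_n) (A : set R), measurable A ->
    distribution P (G ij) A = normal_prob 0 (Num.sqrt n%:R^-1) A.

Definition noise_mx (R : realType) (d : measure_display)
    (T : measurableType d) (P : probability T R) (m n : nat)
    (G : 'I_m * 'I_n -> {RV P >-> R}) (w : T) : 'M[R]_(m, n) :=
  \matrix_(i < m, j < n) G (i, j) w.

Definition sigma_lim (R : realType) (gamma t : R) : R :=
  Num.sqrt (if gamma `^ (1 / 4) < t
            then (t ^+ 2 + 1) * (1 + gamma / t ^+ 2)
            else (1 + Num.sqrt gamma) ^+ 2).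

Definition c_left (R : realType) (gamma t : R) : R :=
  if gamma `^ (1 / 4) < t
  then Num.sqrt ((1 - gamma / t ^+ 4) / (1 + gamma / t ^+ 2)) else 0.

Definition c_right (R : realType) (gamma t : R) : R :=
  if gamma `^ (1 / 4) < t
  then Num.sqrt ((1 - gamma / t ^+ 4) / (1 + 1 / t ^+ 2)) else 0.

Definition qstar (R : realType) (r : nat) (gamma : R) (t : 'I_r -> R)
    (k : 'I_r) : R :=
  if 1 + Num.sqrt gamma < sigma_lim gamma (t k)
  then t k * Num.sqrt ((t k ^+ 2 + Num.min 1 gamma) / (t k ^+ 2 + Num.max 1 gamma))
  else 0.

Definition component_loss (R : realType) (gamma t : R) : R :=
  t * Num.sqrt (1 - Num.min (c_left gamma t ^+ 2) (c_right gamma t ^+ 2)).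

(* Main.v *)
(* Gaussian noise is invariant under rotations, so Givens rotations, each a function
   of the row or column that it reduces, bring Y to band form in orthonormal bases
   that start with u_1, ..., u_r and v_1, ..., v_r.  The reduced matrix has the spikes
   t_k on the diagonal, chi variables over sqrt n on the two diagonals at distance r,
   and small entries in between; by chi-square tail bounds and Borel-Cantelli, its
   top left corner converges almost surely to a deterministic matrix that splits into
   r chains.  On the k-th chain, geometric trial vectors and a Schur test with the same
   geometric weights locate the k-th singular value; above the threshold gamma^(1/4)
   a spectral gap makes the singular vectors close to the trial vectors, and below it
   the recurrence at the bulk edge has a double root, so they spread along the chain.
   This gives the limits c_k and c~_k of the overlaps, with all other overlaps tending
   to 0, and the loss tends to the operator norm of r blocks of size 2.  A vector
   orthogonal to the k-th empirical direction bounds the norm of the k-th block below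
   by t_k sqrt(1 - min(c_k^2, c~_k^2)) for every q, and at q* the rows or the columns
   of the block are orthogonal, which gives equality. *)
Require Import Defs.
From HB Require Import structures.
From mathcomp Require Import all_boot all_order all_algebra.
From mathcomp Require Import all_classical all_reals all_analysis measurable_realfun.
From mathcomp Require Import ring lra.

Set Implicit Arguments.
Unset Strict Implicit.
Unset Printing Implicit Defensive.

Import Order.TTheory GRing.Theory Num.Theory.
Import numFieldNormedType.Exports.

Local Open Scope classical_set_scope.
Local Open Scope ring_scope.


(** * Rotation invariance of the normal law *)

(** A reduction to bidiagonal form would rotate the signal directions into the noise. With bands at
    distance [r] every rotation acts from coordinate [r] on, so the first [r] basis vectors, and
    with them the signal, stay fixed; the price is that [r] chains are interleaved.

    Only a fixed corner of the reduced matrix has entries near constants, and a corner does not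
    control a norm. [band_near] therefore records two facts: closeness in the corner, which the
    trial vectors use, and the upper bounds [1 + eps] and [g + eps] in all rows and columns, which
    the Schur test uses.

    All that follows the almost sure band form is deterministic and uniform in the dimensions
    ([eventually_banded]). The larger singular values do not disturb the analysis of the k-th one,
    because its trial pair vanishes in the coordinates of the larger spikes. In that part [g] is
    sqrt gamma, so the threshold gamma^(1/4) appears as sqrt g. *)

Section density.
Local Open Scope ereal_scope.
Context d (T : measurableType d) (R : realType).
Variables (mu nu : {measure set T -> \bar R}) (g : T -> R).
Hypotheses (mg : measurable_fun setT g) (g0 : forall x, (0 <= g x)%R).
Hypothesis nuE : forall A, measurable A -> nu A = \int[mu]_(x in A) (g x)%:E.

Import HBNNSimple.

(** The two sides agree on simple functions by [nuE], and monotone convergence along [nnsfun_approx]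
    carries the identity to [f]. *)
Lemma ge0_integral_density (f : T -> \bar R) :
  measurable_fun setT f -> (forall x, 0 <= f x) ->
  \int[nu]_x f x = \int[mu]_x (f x * (g x)%:E).
Proof.
move=> mf f0; pose h := nnsfun_approx measurableT mf.
have mg' : measurable_fun setT (fun x => (g x)%:E) by exact/measurable_EFinP.
have cvgh x : (h n x)%:E @[n --> \oo] --> f x.
  by apply: cvg_nnsfun_approx => // y _.
have ndh x : {homo (fun n => h n x) : m n / (m <= n)%N >-> (m <= n)%R}.
  by move=> m n mn; exact/lefP/nd_nnsfun_approx.
transitivity (limn (fun n => \int[nu]_x (h n x)%:E)).
  rewrite -monotone_convergence//.
  - by apply: eq_integral => x _; apply/esym/cvg_lim => //; exact: cvgh.
  - by move=> n; exact/measurable_EFinP/measurable_funP.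
  - by move=> n x _; rewrite lee_fin.
  - by move=> x _ m n mn; rewrite lee_fin ndh.
have -> : (fun n => \int[nu]_x (h n x)%:E) =
    (fun n => \int[mu]_x ((h n x)%:E * (g x)%:E)).
  apply/funext => n.
  under eq_integral do rewrite fimfunE -fsumEFin//.
  rewrite ge0_integral_fsum//; last 2 first.
  - by move=> y; exact/measurable_EFinP/measurable_funM.
  - by move=> y x _; rewrite nnfun_muleindic_ge0.
  transitivity (\int[mu]_x (\sum_(y \in range (h n))
      ((y * \1_(h n @^-1` [set y]) x)%:E * (g x)%:E))).
    rewrite ge0_integral_fsum//; last 2 first.
    - move=> y; apply: emeasurable_funM => //.
      by apply/measurable_EFinP/measurable_funM.
    - move=> y x _; apply: mule_ge0; last by rewrite lee_fin.
      exact: nnfun_muleindic_ge0.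
    apply: eq_fsbigr => y /set_mem yr; have y0 : (0 <= y)%R.
      by case: yr => x _ <-.
    under eq_integral do rewrite EFinM.
    rewrite ge0_integralZl_EFin//; last first.
      exact/measurable_EFinP.
    rewrite integral_indic// setIT nuE//.
    under [in RHS]eq_integral do rewrite EFinM -muleA.
    rewrite ge0_integralZl_EFin//; first last.
    - by apply: emeasurable_funM => //; exact/measurable_EFinP.
    - by move=> x _; rewrite mule_ge0 ?lee_fin.
    congr (_ * _); rewrite integral_mkcond; apply: eq_integral => x _.
    rewrite patchE indicE; case: ifPn => _; by rewrite ?mul1e ?mul0e.
  apply: eq_integral => x _.
  rewrite [in RHS]fimfunE -fsumEFin// ge0_mule_fsuml// => y.
  by rewrite nnfun_muleindic_ge0.
rewrite -monotone_convergence//.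
- apply: eq_integral => x _; apply/cvg_lim => //.
  by apply: cvgeZr => //; exact: cvgh.
- move=> n; apply: emeasurable_funM => //.
  by apply/measurable_EFinP.
- by move=> n x _; rewrite mule_ge0 ?lee_fin.
- by move=> x _ m n mn; rewrite lee_wpmul2r ?lee_fin// ndh.
Qed.

End density.

Section lebesgue_affine.
Local Open Scope ereal_scope.
Context (R : realType).
Local Notation mu := (@lebesgue_measure R).

Lemma measurable_affine (a b : R) :
  measurable_fun setT (fun x : measurableTypeR R => (a * x + b)%R : measurableTypeR R).
Proof. by apply: measurable_funD => //; exact: measurable_funM. Qed.

(** Uniqueness of Lebesgue measure reduces this to intervals []x, y]]. For [a < 0] the preimage is
    closed at the other end, hence two cases. *)
Lemma lebesgue_measure_affine (a b : R) (A : set R) : a != 0%R -> measurable A ->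
  mu A = `|a|%:E * mu ((fun x => a * x + b)%R @^-1` A).
Proof.
move=> a0 mA.
have m_aff := measurable_affine a b.
suff /(_ m_aff _ mA) -> : forall A, measurable A -> mu A =
    mscale (NngNum (normr_ge0 a)) (pushforward mu
      (fun x : measurableTypeR R => (a * x + b)%R : measurableTypeR R)) A by [].
move=> {}m_aff; apply: lebesgue_measure_unique => //= _ [[x y]] _ <-.
rewrite /mscale /pushforward.
have [a1|a1|/eqP] := ltgtP a 0%R; last by rewrite (negbTE a0).
- rewrite [X in _ = _ * mu X](_ : _ =
     `[((y - b) / a)%R, ((x - b) / a)%R[%classic); last first.
    apply/seteqP; split => z /=; rewrite !in_itv/= => /andP[h1 h2];
      apply/andP; split.
    + by rewrite ler_ndivrMr// mulrC; lra.
    + by rewrite ltr_ndivlMr// mulrC; lra.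
    + by move: h2; rewrite ltr_ndivlMr// mulrC; lra.
    + by move: h1; rewrite ler_ndivrMr// mulrC; lra.
  rewrite !lebesgue_measure_itv/= !lte_fin ltr_nM2r ?invr_lt0// ltrD2r.
  case: ifPn => xy; last by rewrite mule0.
  by rewrite ltr0_norm//= -EFinM; congr EFin; field.
- rewrite [X in _ = _ * mu X](_ : _ =
     `]((x - b) / a)%R, ((y - b) / a)%R]%classic); last first.
    apply/seteqP; split => z /=; rewrite !in_itv/= => /andP[h1 h2];
      apply/andP; split.
    + by rewrite ltr_pdivrMr// mulrC; lra.
    + by rewrite ler_pdivlMr// mulrC; lra.
    + by move: h1; rewrite ltr_pdivrMr// mulrC; lra.
    + by move: h2; rewrite ler_pdivlMr// mulrC; lra.
  rewrite !lebesgue_measure_itv/= !lte_fin ltr_pM2r ?invr_gt0// ltrD2r.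
  case: ifPn => xy; last by rewrite mule0.
  by rewrite gtr0_norm//= -EFinM; congr EFin; field.
Qed.

Lemma ge0_integral_affine (a b : R) (f : R -> \bar R) : a != 0%R ->
  measurable_fun setT f -> (forall x, 0 <= f x) ->
  \int[mu]_x f x = `|a|%:E * \int[mu]_x f (a * x + b)%R.
Proof.
move=> a0 mf f0; have m_aff := measurable_affine a b.
pose aff := (fun x : measurableTypeR R => (a * x + b)%R : measurableTypeR R).
rewrite -[X in _ = _ * X]/(\int[mu]_(x in aff @^-1` setT) (f \o aff) x).
rewrite -ge0_integral_pushforward//.
rewrite -(ge0_integral_mscale _ measurableT (NngNum (normr_ge0 a)))//.
by apply: eq_measure_integral => A mA _; exact: lebesgue_measure_affine.
Qed.

End lebesgue_affine.

Section normal_rotation.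
Local Open Scope ereal_scope.
Context (R : realType) (s : R).
Local Notation mu := (@lebesgue_measure R).
Local Notation gam := (@normal_prob R 0 s).
Local Notation phi := (@normal_pdf R 0 s).

Lemma normal_probE (A : set R) : measurable A ->
  gam A = \int[mu]_x (\1_A x * phi x)%:E.
Proof.
move=> mA; rewrite /normal_prob integral_mkcond; apply: eq_integral => x _.
by rewrite patchE indicE; case: ifPn => _; rewrite ?mul1r ?mul0r.
Qed.

Lemma ge0_integral_normal (f : R -> \bar R) :
  measurable_fun setT f -> (forall x, 0 <= f x) ->
  \int[gam]_x f x = \int[mu]_x (f x * (phi x)%:E).
Proof.
move=> mf f0; apply: ge0_integral_density => //.
- exact: measurable_normal_pdf.
- by move=> x; exact: normal_pdf_ge0.
Qed.

Hypothesis s0 : s != 0%R.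

Lemma normal_pdf_rotation (x y u v : R) : (x ^+ 2 + y ^+ 2 = u ^+ 2 + v ^+ 2)%R ->
  (phi x * phi y = phi u * phi v)%R.
Proof.
move=> h; rewrite !normal_pdfE// /normal_fun !subr0 mulrACA [RHS]mulrACA.
by rewrite -!expRD -!mulrDl -!opprD h.
Qed.

Lemma normal_pdfN x : phi (- x) = phi x.
Proof. by rewrite !normal_pdfE// /normal_fun !subr0 sqrrN. Qed.

Lemma normal_prob_opp (A : set R) : measurable A ->
  gam ((fun x => - x)%R @^-1` A) = gam A.
Proof.
have mopp : measurable_fun setT (fun x : R => - x)%R by exact: measurableT_comp.
move=> mA; have mA' : measurable ((fun x => - x)%R @^-1` A).
  by rewrite -[X in measurable X]setTI; exact: (mopp measurableT).
rewrite [RHS]normal_probE// normal_probE//.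
rewrite [RHS](@ge0_integral_affine _ (-1)%R 0%R) ?oppr_eq0 ?oner_eq0//; first last.
- by move=> x; rewrite lee_fin mulr_ge0 ?normal_pdf_ge0.
- apply/measurable_EFinP/measurable_funM; first exact: measurable_indic.
  exact: measurable_normal_pdf.
rewrite normrN1 mul1e; apply: eq_integral => x _; congr EFin.
by rewrite !indicE /= mulN1r addr0 normal_pdfN.
Qed.

(** The rotation is split into two substitutions in one variable with a Tonelli swap between them: y
    = (u - c x) / n for fixed x, then x = c u - n v for fixed u. The factors 1/|n| and |n|
    cancel. *)
Lemma normal_prob_rotation (c n : R) (A B : set R) : (c ^+ 2 + n ^+ 2 = 1)%R ->
  measurable A -> measurable B ->
  (gam \x gam) [set z | A (c * z.1 + n * z.2)%R /\ B (- n * z.1 + c * z.2)%R] =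
  gam A * gam B.
Proof.
(* The substitution divides by [n]; for [n = 0] the rotation is plus or minus the identity. *)
move=> cn mA mB; have [n0|n0] := eqVneq n 0%R.
  have : (c = 1 \/ c = -1)%R.
    have /eqP : (c ^+ 2 = 1)%R by rewrite -cn n0 expr0n addr0.
    by rewrite sqrf_eq1 => /orP[] /eqP; [left|right].
  case=> ->; rewrite n0.
    rewrite (_ : mkset _ = A `*` B) ?product_measure1E//.
    by apply/seteqP; split => -[x y] /=; rewrite oppr0 !mul1r !mul0r addr0 add0r.
  have mopp : measurable_fun setT (fun x : R => - x)%R by exact: measurableT_comp.
  have mN C : measurable C -> measurable ((fun x : R => - x)%R @^-1` C).
    by move=> mC; rewrite -[X in measurable X]setTI; exact: (mopp measurableT).
  rewrite (_ : mkset _ = ((fun x => - x)%R @^-1` A) `*` ((fun x => - x)%R @^-1` B)).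
    rewrite product_measure1E; [|exact: mN|exact: mN].
    by congr (_ * _); exact: normal_prob_opp.
  by apply/seteqP; split => -[x y] /=; rewrite oppr0 !mulN1r !mul0r addr0 add0r.
set E := mkset _.
pose F (z : R * R) := (\1_A (c * z.1 + n * z.2) * \1_B (- n * z.1 + c * z.2) *
   (phi z.1 * phi z.2))%R.
have F0 z : (0 <= F z)%R by rewrite !mulr_ge0 ?normal_pdf_ge0.
have mlin (a b : R) : measurable_fun setT (fun z : R * R => a * z.1 + b * z.2)%R.
  apply: measurable_funD.
    exact: (measurable_funM (measurable_cst a) measurable_fst).
  exact: (measurable_funM (measurable_cst b) measurable_snd).
have mphi : measurable_fun setT phi by exact: measurable_normal_pdf.
have mind (C : set R) : measurable C -> measurable_fun setT (\1_C : R -> R).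
  by move=> mC; exact: measurable_indic.
have mF : measurable_fun setT F.
  apply: measurable_funM; apply: measurable_funM.
  - exact: (measurableT_comp (mind _ mA) (mlin c n)).
  - exact: (measurableT_comp (mind _ mB) (mlin (- n)%R c)).
  - exact: (measurableT_comp mphi measurable_fst).
  - exact: (measurableT_comp mphi measurable_snd).
have mE : measurable E.
  rewrite (_ : E = (fun z : R * R => c * z.1 + n * z.2)%R @^-1` A `&`
    (fun z : R * R => - n * z.1 + c * z.2)%R @^-1` B)//.
  by apply: measurableI; rewrite -[X in measurable X]setTI; exact: (mlin _ _ measurableT).
transitivity (\int[mu]_x \int[mu]_y (F (x, y))%:E).
  rewrite /product_measure1 ge0_integral_normal//; last exact: measurable_fun_xsection.
  apply: eq_integral => x _ /=; rewrite normal_probE; last exact: measurable_xsection.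
  rewrite -ge0_integralZr//=; first last.
  - by rewrite lee_fin normal_pdf_ge0.
  - by move=> y _; rewrite lee_fin mulr_ge0 ?normal_pdf_ge0.
  - apply/measurable_EFinP/measurable_funM => //; apply: measurable_indic.
    exact: measurable_xsection.
  apply: eq_integral => y _; rewrite -EFinM /F /=; congr EFin.
  rewrite -[LHS]mulrA [X in (_ * X)%R = _]mulrC; congr (_ * _)%R.
  rewrite !indicE -natrM mulnb; congr (_%:R)%R; congr nat_of_bool.
  rewrite mem_xsection; apply/idP/andP; rewrite !inE//=.
pose G (z : R * R) := F (z.1, (z.2 - c * z.1) / n)%R.
have mG : measurable_fun setT G.
  apply: measurableT_comp mF _; apply: measurable_fun_pair => //=.
  apply: measurable_funM => //; apply: measurable_funB => //.
  by apply: measurable_funM.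
transitivity (\int[mu]_x (`|n^-1|%:E * \int[mu]_u (G (x, u))%:E)).
  apply: eq_integral => x _.
  have mFx : measurable_fun setT (fun y => (F (x, y))%:E).
    by apply/measurable_EFinP; apply: measurableT_comp mF _; exact: measurable_pair1.
  have Fx0 y : 0 <= (F (x, y))%:E by rewrite lee_fin.
  have n1 : n^-1%R != 0%R by rewrite invr_eq0.
  rewrite (@ge0_integral_affine R n^-1%R (- (c * x) / n)%R _ n1 mFx Fx0).
  congr (_ * _); apply: eq_integral => u _.
  rewrite /G /= (_ : n^-1 * u + - (c * x) / n = (u - c * x) / n)%R//.
  by rewrite mulrC -mulrDl.
have mG' : measurable_fun setT (fun z => (G z)%:E) by exact/measurable_EFinP.
have G0' z : 0 <= (G z)%:E by rewrite lee_fin /G.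
rewrite ge0_integralZl//=; first last.
- by move=> x _; exact: integral_ge0.
- Timeout 20 exact: (@measurable_fun_fubini_tonelli_F _ _ _ _ _ mu (fun z => (G z)%:E) mG' G0').
Timeout 20 rewrite (@fubini_tonelli _ _ _ _ _ mu mu (fun z => (G z)%:E) mG' G0').
transitivity (`|n^-1|%:E * \int[mu]_u (`|n|%:E * \int[mu]_v
   ((\1_A u * phi u) * (\1_B v * phi v))%:E)).
  congr (_ * _); apply: eq_integral => u _.
  have mGu : measurable_fun setT (fun x => (G (x, u))%:E).
    by apply/measurable_EFinP; apply: measurableT_comp mG _; exact: measurable_pair2.
  have Gu0 x : 0 <= (G (x, u))%:E by exact: (G0' (x, u)).
  have n1 : (- n)%R != 0%R by rewrite oppr_eq0.
  rewrite (@ge0_integral_affine R (- n)%R (c * u)%R _ n1 mGu Gu0).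
  rewrite normrN; congr (_ * _); apply: eq_integral => v _.
  congr EFin; rewrite /G /F /=.
  have -> : ((u - c * (- n * v + c * u)) / n = n * u + c * v)%R.
    have -> : (u = (c ^+ 2 + n ^+ 2) * u)%R by rewrite cn mul1r.
    by rewrite cn mul1r -{1}[u]mul1r -cn; field.
  have -> : (c * (- n * v + c * u) + n * (n * u + c * v) = u)%R.
    by rewrite -[RHS]mul1r -cn; ring.
  have -> : (- n * (- n * v + c * u) + c * (n * u + c * v) = v)%R.
    by rewrite -[RHS]mul1r -cn; ring.
  rewrite (@normal_pdf_rotation _ _ u v); first by rewrite mulrACA.
  by rewrite -[RHS]mul1r -cn; ring.
have mI C : measurable C -> measurable_fun setT (fun v => (\1_C v * phi v)%R).
  by move=> mC; apply: measurable_funM => //; exact: measurable_indic.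
under eq_integral => u _.
  under eq_integral do rewrite EFinM.
  rewrite ge0_integralZl//=; first last.
  - by rewrite lee_fin mulr_ge0 ?normal_pdf_ge0.
  - by move=> v _; rewrite lee_fin mulr_ge0 ?normal_pdf_ge0.
  - by apply/measurable_EFinP; exact: mI.
  rewrite -normal_probE// muleA; over.
rewrite ge0_integralZr//=; first last.
- by move=> v _; rewrite mule_ge0 ?lee_fin// mulr_ge0 ?normal_pdf_ge0.
- by apply: emeasurable_funM => //; apply/measurable_EFinP; exact: mI.
rewrite ge0_integralZl//=; first last.
- by move=> v _; rewrite lee_fin mulr_ge0 ?normal_pdf_ge0.
- by apply/measurable_EFinP; exact: mI.
rewrite -normal_probE// !muleA -EFinM normrV ?unitfE//.
by rewrite mulVf ?mul1e// normr_eq0.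
Qed.

End normal_rotation.

(** * Rotations of independent normal families *)

Section restricted_law.
Local Open Scope ereal_scope.
Context d (T : measurableType d) (R : realType) (P : probability T R).
Context d1 (S1 : measurableType d1).

(** Left unnormalized, of total mass [P E], so that arguments restricted to [E] also cover events of
    probability 0. *)
Definition restr_law (E : set T) (mE : measurable E) (X : T -> S1)
    (mX : measurable_fun setT X) : set S1 -> \bar R :=
  fun A => P (E `&` X @^-1` A).

Variables (E : set T) (mE : measurable E) (X : T -> S1).
Variable mX : measurable_fun setT X.

Let law0 : restr_law mE mX set0 = 0.
Proof. by rewrite /restr_law preimage_set0 setI0 measure0. Qed.

Let law_ge0 A : 0 <= restr_law mE mX A.
Proof. exact: measure_ge0. Qed.

Let law_sigma_additive : semi_sigma_additive (restr_law mE mX).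
Proof.
have mXA A : measurable A -> measurable (E `&` X @^-1` A).
  by move=> mA; apply: measurableI => //; rewrite -[X in measurable X]setTI; exact: mX.
move=> F mF tF mUF; rewrite /restr_law preimage_bigcup setI_bigcupr.
apply: measure_semi_sigma_additive.
- by move=> n; exact: mXA.
- apply/trivIsetP => /= i j _ _ ij; rewrite setIACA -preimage_setI.
  by move/trivIsetP : tF => /(_ _ _ _ _ ij) ->//; rewrite preimage_set0 setI0.
- by rewrite -setI_bigcupr -preimage_bigcup; exact: mXA.
Qed.

HB.instance Definition _ := isMeasure.Build _ _ _ (restr_law mE mX)
  law0 law_ge0 law_sigma_additive.

Let law_fin : fin_num_fun (restr_law mE mX).
Proof.
move=> A mA; apply: fin_num_measure; apply: measurableI => //.
by rewrite -[X in measurable X]setTI; exact: mX.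
Qed.

HB.instance Definition _ := Measure_isFinite.Build _ _ _ (restr_law mE mX) law_fin.

End restricted_law.

Section joint_law.
Local Open Scope ereal_scope.
Context d (T : measurableType d) (R : realType) (P : probability T R).
Context d1 d2 (S1 : measurableType d1) (S2 : measurableType d2).

(** The factorization on rectangles identifies the joint law on [E] by uniqueness of the product
    measure; it then holds for every measurable [F], such as the event that a random rotation of a
    pair lands in a rectangle. *)
Lemma joint_lawE (E : set T) (mE : measurable E) (X : T -> S1) (Y : T -> S2)
    (mX : measurable_fun setT X) (mY : measurable_fun setT Y)
    (m2 : probability S2 R) :
  (forall A B, measurable A -> measurable B ->
     P (E `&` (X @^-1` A `&` Y @^-1` B)) = P (E `&` X @^-1` A) * m2 B) ->
  forall F, measurable F ->
  P (E `&` [set w | F (X w, Y w)]) =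
  \int[restr_law P mE mX]_x m2 (xsection F x).
Proof.
move=> XY F mF.
have mXY : measurable_fun setT (fun w => (X w, Y w)) by exact: measurable_fun_pair.
by rewrite -[LHS]/(restr_law P mE mXY F)
  -(@product_measure_unique _ _ S1 S2 R (restr_law P mE mX) m2).
Qed.

Lemma joint_lawE2 (E : set T) (mE : measurable E) (X : T -> S1) (Y : T -> S2)
    (mX : measurable_fun setT X) (mY : measurable_fun setT Y)
    (m1 : probability S1 R) (m2 : probability S2 R) :
  (forall A B, measurable A -> measurable B ->
     P (E `&` (X @^-1` A `&` Y @^-1` B)) = P E * m1 A * m2 B) ->
  forall F, measurable F ->
  P (E `&` [set w | F (X w, Y w)]) = P E * (m1 \x m2) F.
Proof.
move=> XY F mF.
have XE A : measurable A -> P (E `&` X @^-1` A) = P E * m1 A.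
  move=> mA; have := XY _ _ mA measurableT.
  by rewrite preimage_setT setIT probability_setT mule1.
rewrite (joint_lawE mE mX mY (m2 := m2))//; last first.
  by move=> A B mA mB; rewrite XY// XE.
have PEfin : P E = (fine (P E))%:E by rewrite fineK// fin_num_measure.
have PE0 : (0 <= fine (P E))%R by rewrite fine_ge0.
rewrite (@eq_measure_integral _ _ _ _ (mscale (NngNum PE0) m1)); last first.
  by move=> A mA _; transitivity (P E * m1 A); [exact: XE|rewrite {1}PEfin].
by rewrite [in RHS]PEfin ge0_integral_mscale//; exact: measurable_fun_xsection.
Qed.

End joint_law.

Section independence.
Local Open Scope ereal_scope.
Context d (T : measurableType d) (R : realType) (P : probability T R).
Variables (I : finType) (s : R).
Local Notation gam := (@normal_prob R 0 s).

(* The Z i, i in J, are iid N(0, s^2) and independent of the events in H. *)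
Definition iid_normal (H : set (set T)) (J : {set I}) (Z : I -> T -> R) : Prop :=
  forall (D : set T) (A : I -> set R), H D -> (forall i, measurable (A i)) ->
  P (D `&` \bigcap_(i in [set` J]) (Z i @^-1` A i)) =
  P D * \prod_(i in J) gam (A i).

Lemma bigcap_setU1 (Z : I -> T -> R) (A : I -> set R) (i : I) (J : {set I}) :
  \bigcap_(k in [set` (i |: J)%SET]) (Z k @^-1` A k) =
  (Z i @^-1` A i) `&` \bigcap_(k in [set` J]) (Z k @^-1` A k).
Proof.
apply/seteqP; split => w.
  move=> h; split; first by apply: h; rewrite /= !inE eqxx.
  by move=> k kJ; apply: h; rewrite /= inE; apply/orP; right.
by move=> [hi h] k /=; rewrite !inE => /orP[/eqP->|]// kJ; exact: h.
Qed.

Lemma measurable_bigcap_preimage (J : {set I}) (Z : I -> T -> R) (A : I -> set R) :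
  (forall i, measurable_fun setT (Z i)) -> (forall i, measurable (A i)) ->
  measurable (\bigcap_(k in [set` J]) (Z k @^-1` A k)).
Proof.
move=> mZ mA; apply: fin_bigcap_measurable => // k _.
by rewrite -[X in measurable X]setTI; exact: mZ.
Qed.

(** The angle is random but known to [H]. On [D] and the event [C] of the other coordinates, the
    pair [(Z i, Z j)] is independent of [(c, n)] with law [gam \x gam]. Integration over the law of
    [(c, n)] then meets the same value at every angle, by [normal_prob_rotation]. *)
Lemma iid_normal_rotate (H : set (set T)) (J : {set I}) (Z : I -> T -> R)
    (i j : I) (c n : T -> R) :
  H `<=` measurable -> setI_closed H ->
  (forall E, measurable E -> H ((fun w => (c w, n w)) @^-1` E)) ->
  measurable_fun setT c -> measurable_fun setT n ->
  (forall w, c w ^+ 2 + n w ^+ 2 = 1)%R ->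
  (forall i, measurable_fun setT (Z i)) ->
  i \in J -> j \in J -> i != j -> s != 0%R ->
  iid_normal H J Z ->
  iid_normal H J (fun l w => if l == i then c w * Z i w + n w * Z j w
    else if l == j then - n w * Z i w + c w * Z j w else Z l w)%R.
Proof.
move=> Hm HI Hcn mc mn cn1 mZ iJ jJ ij s0 iid D A HD mA.
pose J' := (J :\ i :\ j)%SET.
have JE : J = (i |: (j |: J'))%SET.
  by rewrite /J' !finset.setD1K// !inE jJ andbT eq_sym.
have iJ' : i \notin (j |: J')%SET by rewrite !inE negb_or ij eqxx.
have jJ' : j \notin J' by rewrite !inE eqxx.
pose C := \bigcap_(k in [set` J']) (Z k @^-1` A k).
have mC : measurable C by exact: measurable_bigcap_preimage.
have mD : measurable D by exact: Hm.
have mE : measurable (D `&` C) by exact: measurableI.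
pose K := \prod_(k in J') gam (A k).
have keyP D' B1 B2 : H D' -> measurable B1 -> measurable B2 ->
    P (D' `&` C `&` (Z i @^-1` B1 `&` Z j @^-1` B2)) =
    P D' * K * gam B1 * gam B2.
  move=> HD' mB1 mB2.
  pose A' l := if l == i then B1 else if l == j then B2 else A l.
  have A'i : A' i = B1 by rewrite /A' eqxx.
  have A'j : A' j = B2 by rewrite /A' eqxx eq_sym (negbTE ij).
  have A'k k : k \in J' -> A' k = A k.
    by rewrite !inE /A' => /and3P[/negbTE-> /negbTE-> _].
  have mA' k : measurable (A' k).
    by rewrite /A'; case: ifPn => // _; case: ifPn.
  have := iid D' A' HD' mA'.
  rewrite JE !bigcap_setU1 A'i A'j (big_setU1 _ iJ')/= (big_setU1 _ jJ')/= A'i A'j.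
  rewrite (_ : \bigcap_(k in _) _ = C); last first.
    by apply: eq_bigcapr => k kJ; rewrite A'k.
  rewrite (eq_bigr (fun k => gam (A k))); last by move=> k kJ; rewrite A'k.
  rewrite -/K => h; rewrite -setIA [X in _ `&` X]setIC -setIA h.
  by rewrite -[RHS]muleA [RHS]muleAC -!muleA.
have mcn : measurable_fun setT (fun w => (c w, n w)) by exact: measurable_fun_pair.
have mZZ : measurable_fun setT (fun w => (Z i w, Z j w)) by exact: measurable_fun_pair.
have key2 E1 F2 : measurable E1 -> measurable F2 ->
    P (D `&` C `&` ((fun w => (c w, n w)) @^-1` E1 `&` (fun w => (Z i w, Z j w)) @^-1` F2)) =
    P (D `&` C `&` (fun w => (c w, n w)) @^-1` E1) * (gam \x gam) F2.
  move=> mE1 mF2; rewrite setIA.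
  have HD1 : H (D `&` (fun w => (c w, n w)) @^-1` E1) by apply: HI => //; exact: Hcn.
  have mE0 : measurable (D `&` C `&` (fun w => (c w, n w)) @^-1` E1).
    by apply: measurableI => //; apply: Hm; exact: Hcn.
  have PE0 : P (D `&` C `&` (fun w => (c w, n w)) @^-1` E1) =
     P (D `&` (fun w => (c w, n w)) @^-1` E1) * K.
    have := keyP _ _ _ HD1 measurableT measurableT.
    rewrite !preimage_setT setIT setIT !probability_setT !mule1 => <-.
    by congr (P _); rewrite setIAC.
  apply: (@joint_lawE2 _ _ _ P _ _ (measurableTypeR R) (measurableTypeR R) _ mE0 _ _ (mZ i) (mZ j) gam gam) => // B1 B2 mB1 mB2.
  by rewrite PE0 -keyP//; congr (P (_ `&` _)); rewrite setIAC.
pose F := [set e : (R * R) * (R * R) |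
   A i (e.1.1 * e.2.1 + e.1.2 * e.2.2)%R /\ A j (- e.1.2 * e.2.1 + e.1.1 * e.2.2)%R].
have m11 : measurable_fun setT (fun e : (R * R) * (R * R) => e.1.1).
  exact: (measurableT_comp measurable_fst measurable_fst).
have m12 : measurable_fun setT (fun e : (R * R) * (R * R) => e.1.2).
  exact: (measurableT_comp measurable_snd measurable_fst).
have m21 : measurable_fun setT (fun e : (R * R) * (R * R) => e.2.1).
  exact: (measurableT_comp measurable_fst measurable_snd).
have m22 : measurable_fun setT (fun e : (R * R) * (R * R) => e.2.2).
  exact: (measurableT_comp measurable_snd measurable_snd).
have mF : measurable F.
  apply: measurableI.
    rewrite -[X in measurable X]setTI.
    have mf : measurable_fun setT (fun e : (R * R) * (R * R) => e.1.1 * e.2.1 + e.1.2 * e.2.2)%R.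
      exact: measurable_funD (measurable_funM m11 m21) (measurable_funM m12 m22).
    exact: (mf measurableT _ (mA i)).
  rewrite -[X in measurable X]setTI.
  have mf : measurable_fun setT (fun e : (R * R) * (R * R) => - e.1.2 * e.2.1 + e.1.1 * e.2.2)%R.
    apply: measurable_funD (measurable_funM _ m21) (measurable_funM m11 m22).
    exact: measurableT_comp m12.
  exact: (mf measurableT _ (mA j)).
transitivity (P (D `&` C `&` [set w | F ((c w, n w), (Z i w, Z j w))])).
  rewrite -setIA {1}JE; congr (P (_ `&` _)); rewrite !bigcap_setU1 eqxx eq_sym (negbTE ij) eqxx.
  rewrite setIA setIC; congr (_ `&` _); apply: eq_bigcapr => k.
  by rewrite /= !inE => /and3P[/negbTE-> /negbTE-> _].
rewrite (@joint_lawE _ _ _ P _ _ _ (measurableTypeR R * measurableTypeR R)%type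
  _ mE _ _ mcn mZZ (gam \x gam)%E)//.
have PE : P (D `&` C) = P D * K.
  have := keyP _ _ _ HD measurableT measurableT.
  by rewrite !preimage_setT setIT setIT !probability_setT !mule1.
(* The integrand is known to equal this constant only on the unit circle, which carries the whole
   law of [(c, n)] by [cn1]. *)
rewrite (@ae_eq_integral _ _ _ _ setT (cst (gam (A i) * gam (A j))))//; first last.
- exists ((fun e : R * R => e.1 ^+ 2 + e.2 ^+ 2)%R @^-1` (~` [set 1%R])); split.
  + have mf : measurable_fun setT (fun e : R * R => e.1 ^+ 2 + e.2 ^+ 2)%R.
      by apply: measurable_funD; apply: measurable_funX; [exact: measurable_fst|exact: measurable_snd].
    by rewrite -[X in measurable X]setTI; apply: mf => //; exact: measurableC.
  + transitivity (P set0); last by rewrite measure0.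
    rewrite -[LHS]/(restr_law P mE mcn _) /restr_law; congr (P _).
    by apply/seteqP; split => // w [_] /=; rewrite cn1.
  + move=> [a b] /= h /= ab; apply: h => _.
    apply: etrans (@normal_prob_rotation R s s0 a b _ _ ab (mA i) (mA j)); congr (_ _).
    by apply/seteqP; split => -[x y]; rewrite /xsection/= !inE.
- exact: measurable_fun_xsection.
rewrite integral_cst// -[X in _ * X]/(restr_law P mE mcn _) /restr_law.
rewrite preimage_setT setIT PE.
rewrite JE (big_setU1 _ iJ')/= (big_setU1 _ jJ')/= -/K.
by rewrite muleC -!muleA; congr (_ * _); rewrite muleC -muleA.
Qed.

End independence.

Section conditioning.
Local Open Scope ereal_scope.
Context d (T : measurableType d) (R : realType) (P : probability T R).
Variables (I : finType) (s : R).
Local Notation gam := (@normal_prob R 0 s).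

Lemma iid_normal_subset (H : set (set T)) (J J' : {set I}) (Z : I -> T -> R) :
  J' \subset J -> iid_normal P s H J Z -> iid_normal P s H J' Z.
Proof.
move=> J'J iid D A HD mA.
pose A' l := if l \in J' then A l else setT.
have mA' l : measurable (A' l) by rewrite /A'; case: ifPn.
have := iid D A' HD mA'.
rewrite (_ : \bigcap_(i in [set` J]) _ = \bigcap_(i in [set` J']) (Z i @^-1` A i)).
  move=> ->; congr (_ * _); rewrite (big_setID J')/=.
  rewrite [X in _ * X]big1 ?mule1; last first.
    by move=> i; rewrite inE /A' => /andP[/negbTE-> _]; rewrite probability_setT.
  move/finset.setIidPr: J'J => ->; apply: eq_bigr => i iJ'; by rewrite /A' iJ'.
apply/seteqP; split => w h i /=.
  by move=> iJ'; have := h i (fintype.subsetP J'J _ iJ'); rewrite /A' iJ'.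
by rewrite /A'; case: ifPn => //= iJ' _; exact: h.
Qed.

Definition cylinders (Z : I -> T -> R) (J : {set I}) : set (set T) :=
  [set B | exists2 A : I -> set R, (forall i, measurable (A i)) &
     B = \bigcap_(i in [set` J]) (Z i @^-1` A i)].

Lemma cylinders_setI (Z : I -> T -> R) (J : {set I}) : setI_closed (cylinders Z J).
Proof.
move=> _ _ [A mA ->] [B mB ->]; exists (fun i => A i `&` B i).
  by move=> i; exact: measurableI.
by rewrite -bigcapI.
Qed.

Lemma cylinders_setT (Z : I -> T -> R) (J : {set I}) : cylinders Z J setT.
Proof. by exists (fun=> setT) => //; apply/seteqP; split. Qed.

Lemma cylinders_measurable (Z : I -> T -> R) (J : {set I}) :
  (forall i, measurable_fun setT (Z i)) -> <<s cylinders Z J >> `<=` measurable.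
Proof.
move=> mZ; apply: smallest_sub; first exact: sigma_algebra_measurable.
by move=> _ [A mA ->]; exact: measurable_bigcap_preimage.
Qed.

Lemma cylinders_measurable_fun (Z : I -> T -> R) (J : {set I}) (i : I) : i \in J ->
  measurable_fun [set: g_sigma_algebraType (cylinders Z J)] (Z i).
Proof.
move=> iJ _ B mB; rewrite setTI; apply: sub_sigma_algebra.
exists (fun k => if k == i then B else setT).
  by move=> k; case: ifPn.
apply/seteqP; split => w /=.
  by move=> h k kJ; case: ifPn => // /eqP ->.
by move=> /(_ i iJ); rewrite eqxx.
Qed.

(** For fixed [A], restricting [P] to [C] and scaling [P] by [q] give two finite measures that agree
    on the cylinders over [K]. These form a pi-system, so the measures agree on the sigma-algebra
    they generate. In this way the entries of a row become available for the choice of an angle. *)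
Lemma iid_normal_cylinders (J K : {set I}) (Z : I -> T -> R) (H : set (set T)) :
  (forall i, measurable_fun setT (Z i)) -> H setT ->
  (forall i, i \in J -> i \in K = false) -> iid_normal P s H (J :|: K)%SET Z ->
  iid_normal P s <<s cylinders Z K >> J Z.
Proof.
move=> mZ HT KJ iid D A HD mA.
have JK : fintype.disjoint (mem J) (mem K).
  by rewrite disjoint_subset; apply/fintype.subsetP => i iJ; rewrite inE KJ.
have bU (F : I -> \bar R) : \prod_(i in (J :|: K)%SET) F i =
    (\prod_(i in J) F i) * \prod_(i in K) F i.
  by rewrite -bigU//; apply: eq_bigl => i; rewrite !inE.
pose C := \bigcap_(i in [set` J]) (Z i @^-1` A i).
have mC : measurable C by exact: measurable_bigcap_preimage.
pose q := \prod_(i in J) gam (A i).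
have q0 : 0 <= q by apply: prode_ge0 => i _; exact: measure_ge0.
have qfin : q \is a fin_num.
  apply: (big_ind (fun x => x \is a fin_num)) => //.
  - by move=> x y; exact: fin_numM.
  - by move=> i _; apply: fin_num_measure; exact: mA.
have fq0 : (0 <= fine q)%R by rewrite fine_ge0.
have qE : q = (fine q)%:E by rewrite fineK.
suff : mrestr P mC D = mscale (NngNum fq0) P D.
  move=> h; change (P (D `&` C) = (fine q)%:E * P D) in h.
  by rewrite h -qE muleC.
apply: (g_sigma_algebra_measure_unique (cylinders Z K) _ (fun=> setT)) => //.
- by move=> E KE; apply: (cylinders_measurable (J := K) mZ); exact: sub_sigma_algebra.
- by move=> _; exact: cylinders_setT.
- by rewrite bigcup_const//; exists 0%N.
- exact: cylinders_setI.
- move=> _ [B mB ->]; set E := \bigcap_(i in _) _.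
  change (P (E `&` C) = (fine q)%:E * P E); rewrite -qE.
  pose A' i := if i \in K then B i else A i.
  have mA' i : measurable (A' i) by rewrite /A'; case: ifPn.
  have := iid setT A' HT mA'.
  pose A1 i := if i \in K then B i else setT.
  have mA1 i : measurable (A1 i) by rewrite /A1; case: ifPn.
  have := iid setT A1 HT mA1.
  rewrite !setTI !probability_setT !mul1e.
  rewrite (_ : \bigcap_(i in [set` (J :|: K)%SET]) _ = E); last first.
    apply/seteqP; split => w h i /=.
      by move=> iK; have := h i; rewrite /= inE /A1 iK orbT; apply.
    by rewrite inE /A1; case: ifPn => // iK _; exact: h.
  rewrite (_ : \bigcap_(i in [set` (J :|: K)%SET]) _ = E `&` C); last first.
    apply/seteqP; split => w.
      move=> h; split=> i /=.
        by move=> iK; have := h i; rewrite /= inE /A' iK orbT; apply.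
      by move=> iJ; have := h i; rewrite /= inE /A' iJ (KJ _ iJ); apply.
    move=> [h1 h2] i /=; rewrite inE /A'; case: ifPn => [iK _|iK]; first exact: h1.
    by rewrite orbF => iJ; exact: h2.
  move=> -> ->; rewrite !bU/= ?mule1//.
  rewrite [X in X * _ = _](eq_bigr (fun i => gam (A i))); last by move=> i iJ; rewrite /A' (KJ _ iJ).
  rewrite [X in _ = _ * (X * _)]big1 ?mul1e; last first.
    by move=> i iJ; rewrite /A1 (KJ _ iJ) probability_setT.
  congr (_ * _); apply: eq_bigr => i iK; by rewrite /A' /A1 iK.
- move=> _; change (P (setT `&` C) < +oo).
  by rewrite setTI (le_lt_trans (probability_le1 _ mC))// ltry.
Qed.

End conditioning.

(** * Chi-square tails *)

Section integral_law.
Local Open Scope ereal_scope.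
Context d (T : measurableType d) (R : realType) (P : probability T R).
Context d1 (S1 : measurableType d1).

Lemma ge0_integral_restr_law (X : T -> S1) (mX : measurable_fun setT X)
    (f : S1 -> \bar R) :
  measurable_fun setT f -> (forall x, 0 <= f x) ->
  \int[restr_law P measurableT mX]_x f x = \int[P]_w f (X w).
Proof.
move=> mf f0.
rewrite -[RHS]/(\int[P]_(w in X @^-1` setT) (f \o X) w).
rewrite -ge0_integral_pushforward//; apply: eq_measure_integral => A mA _.
by change (P (setT `&` X @^-1` A) = P (X @^-1` A)); rewrite setTI.
Qed.

End integral_law.

Section independent_expectation.
Local Open Scope ereal_scope.
Context d (T : measurableType d) (R : realType) (P : probability T R).
Context d1 d2 (S1 : measurableType d1) (S2 : measurableType d2).

Lemma ge0_expectation_indep (X : T -> S1) (Y : T -> S2) (m2 : probability S2 R)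
    (f : S1 -> R) (g : S2 -> R) :
  measurable_fun setT X -> measurable_fun setT Y ->
  measurable_fun setT f -> measurable_fun setT g ->
  (forall x, 0 <= f x)%R -> (forall x, 0 <= g x)%R ->
  (forall A B, measurable A -> measurable B ->
     P (X @^-1` A `&` Y @^-1` B) = P (X @^-1` A) * m2 B) ->
  \int[P]_w (f (X w) * g (Y w))%:E =
  (\int[P]_w (f (X w))%:E) * \int[m2]_y (g y)%:E.
Proof.
move=> mX mY mf mg f0 g0 XY.
have mXY : measurable_fun setT (fun w => (X w, Y w)) by exact: measurable_fun_pair.
pose F (z : S1 * S2) := (f z.1 * g z.2)%:E.
have mF : measurable_fun setT F.
  apply/measurable_EFinP; apply: measurable_funM.
    exact: (measurableT_comp mf measurable_fst).
  exact: (measurableT_comp mg measurable_snd).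
have F0 z : 0 <= F z by rewrite lee_fin mulr_ge0.
transitivity (\int[restr_law P measurableT mX \x m2]_z F z).
  transitivity (\int[restr_law P measurableT mXY]_z F z).
    by rewrite (ge0_integral_restr_law P mXY mF F0).
  apply: eq_measure_integral => A mA _; apply/esym.
  apply: (@product_measure_unique _ _ S1 S2 R (restr_law P measurableT mX) m2
     (restr_law P measurableT mXY)) => // A1 B1 mA1 mB1.
  change (P (setT `&` (X @^-1` A1 `&` Y @^-1` B1)) =
          P (setT `&` X @^-1` A1) * m2 B1).
  by rewrite !setTI XY.
rewrite (fubini_tonelli1 _ mF F0).
under eq_integral => x _.
  rewrite /fubini_F/=; under eq_integral do rewrite /F EFinM /=.
  rewrite ge0_integralZl//=; first over.
  - exact/measurable_EFinP.
  - by move=> y _; rewrite lee_fin.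
  - by rewrite lee_fin.
have mf' : measurable_fun setT (EFin \o f) by exact/measurable_EFinP.
rewrite ge0_integralZr//=.
- by rewrite (ge0_integral_restr_law P mX mf')// => x; rewrite lee_fin.
- by move=> x _; rewrite lee_fin.
- by apply: integral_ge0 => y _; rewrite lee_fin.
Qed.

End independent_expectation.

Section gaussian_square.
Local Open Scope ereal_scope.
Context (R : realType).

(** From exp y >= 1 + y at y = x + 2 x^2, since (1 - x)(1 + x + 2 x^2) - 1 = x^2 (1 - 2 x). *)
Lemma expR_sqr_bound (x : R) : (`|x| <= 2^-1 -> expR (- x - 2 * x ^+ 2) <= 1 - x)%R.
Proof.
move=> xh; have [x1 x2] : (- 2^-1 <= x /\ x <= 2^-1)%R by apply/andP; rewrite -ler_norml.
rewrite (_ : (- x - 2 * x ^+ 2 = - (x + 2 * x ^+ 2))%R); last by ring.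
have x0 : (0 < 1 - x)%R by lra.
rewrite expRN -[leRHS]invrK lef_pV2 ?posrE ?expR_gt0 ?invr_gt0//.
apply: le_trans (expR_ge1Dx _).
rewrite -div1r ler_pdivrMr//.
rewrite -subr_ge0 (_ : _ - _ = x ^+ 2 * (1 - 2 * x))%R; last by ring.
by rewrite mulr_ge0 ?sqr_ge0//; lra.
Qed.

(** The integrand times the density is (1 - 2 tau)^(-1/2) times the density of variance s^2 / (1 - 2
    tau). That factor is bounded by [expR_sqr_bound] at 2 tau. *)
Lemma integral_normal_sqr (s tau : R) : (0 < s)%R -> (`|tau| <= 4^-1)%R ->
  \int[@normal_prob R 0 s]_y (expR (tau / s ^+ 2 * y ^+ 2))%:E <=
  (expR (tau + 4 * tau ^+ 2))%:E.
Proof.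
move=> s0 tauh.
have [t1 t2] : (- 4^-1 <= tau /\ tau <= 4^-1)%R by apply/andP; rewrite -ler_norml.
have sn0 : s != 0%R by rewrite gt_eqF.
have a0 : (0 < 1 - 2 * tau)%R by lra.
pose s' := (s / Num.sqrt (1 - 2 * tau))%R.
have r0 : (0 < Num.sqrt (1 - 2 * tau))%R by rewrite sqrtr_gt0.
have s'0 : (0 < s')%R by rewrite divr_gt0.
have s'n0 : s' != 0%R by rewrite gt_eqF.
rewrite ge0_integral_normal//; last first.
  by apply/measurable_EFinP; apply: measurableT_comp => //; apply: measurable_funM => //; exact: measurable_funX.
rewrite (_ : (fun y => _) = (fun y => ((Num.sqrt (1 - 2 * tau))^-1)%:E * (normal_pdf 0 s' y)%:E)); last first.
  apply/funext => y; rewrite -!EFinM; congr EFin.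
  rewrite !normal_pdfE// /normal_fun !subr0 [LHS]mulrC -[LHS]mulrA -expRD [RHS]mulrA.
  congr (_ * expR _)%R.
    rewrite /normal_peak -invfM; congr (_^-1)%R.
    rewrite -sqrtrM; last by lra.
    congr (Num.sqrt _); rewrite /s' expr_div_n sqr_sqrtr; last by lra.
    by rewrite ?(mulr2n (_ * pi)); field; lra.
  rewrite /s' expr_div_n sqr_sqrtr; last by lra.
  rewrite ?(mulr2n (_ ^+ 2)) ?(mulr2n (_ / _)); field.
  have ss : (0 < s ^+ 2 + s ^+ 2)%R by rewrite addr_gt0// exprn_gt0.
  by apply/and3P; split => //; rewrite gt_eqF.
rewrite ge0_integralZl//=; first last.
- by move=> x _; rewrite lee_fin normal_pdf_ge0.
- by apply/measurable_EFinP; exact: measurable_normal_pdf.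
rewrite integral_normal_pdf mule1 lee_fin.
rewrite -[leRHS]invrK -expRN lef_pV2 ?posrE ?expR_gt0//.
rewrite -(ler_pXn2r (ltn0Sn 1)) ?nnegrE ?expR_ge0 ?sqrtr_ge0// sqr_sqrtr; last by lra.
have h : (`|2 * tau| <= 2^-1)%R by rewrite normrM ger0_norm//; lra.
apply: le_trans (expR_sqr_bound h).
rewrite expr2 -expRD ler_expR le_eqVlt; apply/orP; left; apply/eqP; ring.
Qed.

End gaussian_square.

Lemma measurable_sum_set d (T : measurableType d) (R : realType) (I : finType)
    (K : {set I}) (f : I -> T -> R) :
  (forall i, i \in K -> measurable_fun setT (f i)) ->
  measurable_fun setT (fun w => \sum_(i in K) f i w)%R.
Proof.
move=> mf; rewrite (_ : (fun w => _) = fun w => \sum_(k <- enum K) f k w)%R; last first.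
  by apply/funext => w; rewrite big_enum.
have : all (fun k => k \in K) (enum K) by apply/allP => k; rewrite mem_enum.
elim: (enum K) => [_|k l IHl /= /andP[kK lK]].
  by under eq_fun do rewrite big_nil; exact: measurable_cst.
under eq_fun do rewrite big_cons.
by apply: measurable_funD; [exact: mf|exact: IHl].
Qed.

Section chi_square_tail.
Local Open Scope ereal_scope.
Context d (T : measurableType d) (R : realType) (P : probability T R).
Variables (I : finType) (s : R).
Hypothesis s0 : (0 < s)%R.
Variables (H : set (set T)) (J : {set I}) (Z : I -> T -> R).
Hypotheses (HT : H setT) (mZ : forall i, measurable_fun setT (Z i)).
Hypothesis iid : iid_normal P s H J Z.

Let measurable_sumsq (K : {set I}) :
  measurable_fun setT (fun w => \sum_(i in K) Z i w ^+ 2)%R.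
Proof. by apply: measurable_sum_set => i _; exact: measurable_funX. Qed.

(** One coordinate is split off at a time: it is independent of the sigma-algebra of the others, for
    which the rest of the sum is measurable, so the expectation factors. *)
Lemma exp_moment_sumsq (tau : R) (K : {set I}) : (`|tau| <= 4^-1)%R -> K \subset J ->
  \int[P]_w (expR (tau / s ^+ 2 * \sum_(i in K) Z i w ^+ 2))%:E <=
  (expR (tau + 4 * tau ^+ 2) ^+ #|K|)%:E.
Proof.
move=> tauh; set th := (tau / s ^+ 2)%R.
have [n] := ubnP #|K|; elim: n K => // n IH K; rewrite ltnS => Kn KJ.
have [->|[i iK]] := set_0Vmem K.
  under eq_integral do rewrite big_set0 mulr0 expR0.
  by rewrite integral_cst// [X in _ * X]probability_setT mule1 cards0 expr0.
pose K' := (K :\ i)%SET.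
have KE : K = (i |: K')%SET by rewrite finset.setD1K.
have iK' : i \notin K' by rewrite !inE eqxx.
have K'J : K' \subset J by rewrite (fintype.subset_trans _ KJ)// subD1set.
have cK : #|K| = #|K'|.+1 by rewrite KE cardsU1 iK'.
pose X w := (\sum_(i in K') Z i w ^+ 2)%R.
have mX : measurable_fun setT X by exact: measurable_sumsq.
have mexp (a : R) : measurable_fun setT (fun x : R => expR (a * x)).
  by apply: measurableT_comp => //; exact: measurable_funM.
rewrite (eq_integral (fun w =>
    (expR (th * X w) * expR (th * (Z i w) ^+ 2))%:E)); last first.
  by move=> w _; rewrite -expRD -mulrDr KE big_setU1//= addrC.
have mg : measurable_fun setT (fun y : R => expR (th * y ^+ 2)).
  exact: (measurableT_comp (mexp th) (exprn_measurable 2)).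
rewrite (@ge0_expectation_indep _ T R P _ _ _ (measurableTypeR R) X (Z i)
   (normal_prob 0 s) (fun x => expR (th * x)%R) (fun y => expR (th * y ^+ 2)%R))//.
- rewrite cK exprSr EFinM; apply: lee_pmul.
  + by apply: integral_ge0 => w _; rewrite lee_fin expR_ge0.
  + by apply: integral_ge0 => w _; rewrite lee_fin expR_ge0.
  + by apply: IH => //; rewrite -ltnS -cK.
  + exact: integral_normal_sqr.
- exact: mZ.
move=> A B mA mB.
have iid1 : iid_normal P s H ([set i] :|: K')%SET Z.
  by apply: iid_normal_subset iid; rewrite -KE.
have KJ1 k : k \in [set i]%SET -> k \in K' = false.
  by rewrite inE => /eqP->; exact: negbTE.
have iid2 := iid_normal_cylinders mZ HT KJ1 iid1.
have mXH : measurable_fun [set: g_sigma_algebraType (cylinders Z K')] X.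
  apply: measurable_sum_set => k kK'; apply: measurable_funX.
  exact: cylinders_measurable_fun.
have XA : <<s cylinders Z K' >> (X @^-1` A).
  by rewrite -[X @^-1` A]setTI; exact: mXH.
have := iid2 _ (fun=> B) XA (fun=> mB).
rewrite big_set1 => <-; congr (P (_ `&` _)).
by apply/seteqP; split => w /=; [move=> ? k; rewrite /= inE => /eqP->|
  move=> /(_ i); rewrite /= inE eqxx; apply].
Qed.

(** Chernoff bounds with exponents [tau] and [- tau] for the two tails. The value of [tau] stays
    free; it is fixed later, uniformly in the dimensions. *)
Lemma chi_square_tail (K : {set I}) (tau e : R) : K \subset J ->
  (0 < tau <= 4^-1)%R ->
  P [set w | (e <= `|\sum_(i in K) Z i w ^+ 2 - #|K|%:R * s ^+ 2|)%R] <=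
  (2 * expR (4 * #|K|%:R * tau ^+ 2 - tau * e / s ^+ 2))%:E.
Proof.
move=> KJ /andP[tau0 tau4]; set m := #|K|.
pose X w := (\sum_(i in K) Z i w ^+ 2)%R.
have mX : measurable_fun setT X by exact: measurable_sumsq.
have s2 : (0 < s ^+ 2)%R by rewrite exprn_gt0.
have key (t : R) : (`|t| = tau)%R ->
    P [set w | (tau * e <= t * (X w - m%:R * s ^+ 2))%R] <=
    (expR (4 * m%:R * tau ^+ 2 - tau * e / s ^+ 2))%:E.
  move=> tt.
  pose a := expR ((tau * e + t * (m%:R * s ^+ 2)) / s ^+ 2).
  have a0 : (0 < a)%R by exact: expR_gt0.
  pose g w := (expR (t / s ^+ 2 * X w))%:E.
  have mg : measurable_fun setT g.
    apply/measurable_EFinP; apply: measurableT_comp => //.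
    exact: measurable_funM.
  have := @le_integral_abse _ _ _ P setT measurableT g a mg a0.
  rewrite setTI => h.
  have h2 : \int[P]_w `|g w| <= (expR (t + 4 * t ^+ 2) ^+ m)%:E.
    under eq_integral do rewrite gee0_abs ?lee_fin ?expR_ge0//.
    by apply: exp_moment_sumsq => //; rewrite tt.
  have {h h2} := le_trans h h2.
  rewrite (_ : [set x | _] = [set w | (tau * e <= t * (X w - m%:R * s ^+ 2))%R]); last first.
    apply/seteqP; split => w /=; rewrite lee_fin ger0_norm ?expR_ge0// ler_expR;
      rewrite (mulrAC t) ler_pM2r ?invr_gt0// => hw; move: hw; lra.
  rewrite -lee_pdivlMl// => h; apply: le_trans h _; rewrite -EFinM lee_fin /a.
  rewrite -expRN -expRM_natl -expRD ler_expR.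
  have -> : (t ^+ 2 = tau ^+ 2)%R by rewrite -tt real_normK ?num_real.
  rewrite le_eqVlt; apply/orP; left; apply/eqP; field.
  by rewrite gt_eqF.
have mset (t : R) : measurable [set w | (tau * e <= t * (X w - m%:R * s ^+ 2))%R].
  rewrite (_ : mkset _ = (fun w => t * (X w - m%:R * s ^+ 2))%R @^-1` `[(tau * e)%R, +oo[%classic); last first.
    by apply/seteqP; split => w /=; rewrite in_itv/= andbT.
  have mf : measurable_fun setT (fun w => t * (X w - m%:R * s ^+ 2))%R.
    by apply: measurable_funM => //; exact: measurable_funB.
  by rewrite -[X in measurable X]setTI; exact: mf.
apply: (@le_trans _ _ (P ([set w | (tau * e <= tau * (X w - m%:R * s ^+ 2))%R] `|`
   [set w | (tau * e <= - tau * (X w - m%:R * s ^+ 2))%R]))).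
  apply: le_measure.
  - rewrite inE; have mf : measurable_fun setT (fun w => `|X w - m%:R * s ^+ 2|)%R.
      by apply: measurableT_comp => //; exact: measurable_funB.
    rewrite (_ : mkset _ = (fun w => `|X w - m%:R * s ^+ 2|)%R @^-1` `[e, +oo[%classic); last first.
      by apply/seteqP; split => w /=; rewrite in_itv/= andbT.
    by rewrite -[X in measurable X]setTI; exact: mf.
  - by rewrite inE; exact: measurableU.
  - move=> w /=; rewrite -/(X w) mulNr -mulrN !ler_pM2l//.
    by have [h|h] := ger0P (X w - m%:R * s ^+ 2); [left|right].
apply: le_trans (measureU2 _ _ _) _ => //.
rewrite mulr2n mulrDl mul1r EFinD; apply: leeD; apply: key.
  by rewrite gtr0_norm.
by rewrite normrN gtr0_norm.
Qed.

End chi_square_tail.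

(** * Givens reduction of Gaussian noise to band form *)

Section givens.
Context (R : realType) (n : nat).
Implicit Types (a b : 'I_n) (c s : R).

Definition givens a b c s : 'M[R]_n := \matrix_(i, j)
  if j == a then c * (i == a)%:R + s * (i == b)%:R
  else if j == b then - s * (i == a)%:R + c * (i == b)%:R else (i == j)%:R.

Lemma sum_delta (m : nat) (x : 'I_m -> R) (a : 'I_m) :
  \sum_(i < m) x i * (i == a)%:R = x a.
Proof.
rewrite (bigD1 a)//= eqxx mulr1 big1 ?addr0// => i /negbTE ->.
by rewrite mulr0.
Qed.

Lemma mulmx_givens (m : nat) (x : 'M[R]_(m, n)) a b c s k j :
  (x *m givens a b c s) k j =
  if j == a then c * x k a + s * x k b
  else if j == b then - s * x k a + c * x k b else x k j.
Proof.
rewrite mxE; under eq_bigr do rewrite mxE.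
case: ifPn => _; last case: ifPn => _; last exact: sum_delta.
- under eq_bigr do rewrite mulrDr !mulrA ![_ * c]mulrC ![_ * s]mulrC -!mulrA.
  by rewrite big_split/= -!mulr_sumr !sum_delta.
- under eq_bigr do rewrite mulrDr !mulrA ![_ * c]mulrC ![_ * - s]mulrC -!mulrA.
  by rewrite big_split/= -!mulr_sumr !sum_delta.
Qed.

Lemma givens_orthogonal a b c s : a != b -> c ^+ 2 + s ^+ 2 = 1 ->
  (givens a b c s)^T *m givens a b c s = 1%:M.
Proof.
move=> ab cs; apply/matrixP => k j; rewrite mulmx_givens !mxE !eqxx.
have ba : (b == a) = false by rewrite eq_sym; exact: negbTE.
rewrite (negbTE ab) ba.
have [ja|ja] := eqVneq j a; have [ka|ka] := eqVneq k a;
  have [kb|kb] := eqVneq k b; have [jb|jb] := eqVneq j b; subst=> //;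
  rewrite ?eqxx ?(negbTE ab) ?ba ?(negbTE ja) ?(negbTE ka) ?(negbTE kb)
    ?(negbTE jb) ?mulr1 ?mulr0 ?addr0 ?add0r ?oppr0 ?mulrN ?mulNr ?opprK -?expr2 ?cs//;
  try (by rewrite addrC cs); try ring.
all: try (by rewrite eqxx in ab); try (by rewrite eqxx in ka);
  try (by rewrite eqxx in ja); try (by rewrite eqxx in jb);
  try (by rewrite eqxx in kb); try (by rewrite [LHS]/= mulrC addNr);
  by rewrite eq_sym ?(negbTE ja) ?(negbTE jb).
Qed.

End givens.

Lemma measurable_fun_sqrt d (T : measurableType d) (R : realType) (f : T -> R) :
  measurable_fun setT f -> measurable_fun setT (fun x => Num.sqrt (f x)).
Proof.
move=> mf; apply: measurableT_comp mf.
by apply: continuous_measurable_fun; exact: sqrt_continuous.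
Qed.

Lemma measurable_fun_inv_ge0 d (T : measurableType d) (R : realType) (f : T -> R) :
  (forall x, 0 <= f x) ->
  measurable_fun setT f -> measurable_fun setT (fun x => (f x)^-1).
Proof.
move=> f0 mf; rewrite (_ : (fun x => _) = (fun x => f x `^ (-1))); last first.
  by apply/funext => x; rewrite powR_inv1.
have mp : measurable_fun setT (fun y : R => y `^ (-1)) by exact: measurable_powR.
exact: (measurableT_comp mp mf).
Qed.

(** The indicator makes the cosine 1 at [x = y = 0], where the quotient is 0 by convention. So the
    pair lies on the unit circle everywhere and is still measurable in [x] and [y]. *)
Definition givens_cos (R : realType) (x y : R) : R :=
  let rho := Num.sqrt (x ^+ 2 + y ^+ 2) in x / rho + \1_[set (0 : R)] rho.

Definition givens_sin (R : realType) (x y : R) : R :=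
  y / Num.sqrt (x ^+ 2 + y ^+ 2).

Section givens_coefficients.
Context (R : realType).
Implicit Types x y : R.

Lemma givens_cos_sin x y : givens_cos x y ^+ 2 + givens_sin x y ^+ 2 = 1.
Proof.
rewrite /givens_cos /givens_sin; set rho := Num.sqrt _.
have r2 : rho ^+ 2 = x ^+ 2 + y ^+ 2 by rewrite sqr_sqrtr// addr_ge0// sqr_ge0.
rewrite indicE; case: (eqVneq rho 0) => [r0|r0].
  by rewrite mem_set// r0 invr0 !mulr0 add0r expr1n expr0n addr0.
rewrite memNset; last by move=> /= h; rewrite h eqxx in r0.
by rewrite addr0 !expr_div_n -mulrDl -r2 divff// expf_neq0.
Qed.

Lemma givens_pivot x y :
  givens_cos x y * x + givens_sin x y * y = Num.sqrt (x ^+ 2 + y ^+ 2).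
Proof.
rewrite /givens_cos /givens_sin; set rho := Num.sqrt _.
have r2 : rho ^+ 2 = x ^+ 2 + y ^+ 2 by rewrite sqr_sqrtr// addr_ge0// sqr_ge0.
rewrite indicE; case: (eqVneq rho 0) => [r0|r0].
  have x0 : x = 0.
    apply/eqP; rewrite -sqrf_eq0; move/eqP: r2; rewrite r0 expr0n/= eq_sym.
    by rewrite paddr_eq0 ?sqr_ge0// => /andP[].
  by rewrite r0 invr0 x0 !mulr0 mul0r addr0.
rewrite memNset; last by move=> /= h; rewrite h eqxx in r0.
rewrite addr0; apply: (mulfI r0); rewrite -[RHS]expr2 r2; field.
exact: r0.
Qed.

Lemma givens_zero x y : - givens_sin x y * x + givens_cos x y * y = 0.
Proof.
rewrite /givens_cos /givens_sin; set rho := Num.sqrt _.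
have r2 : rho ^+ 2 = x ^+ 2 + y ^+ 2 by rewrite sqr_sqrtr// addr_ge0// sqr_ge0.
rewrite indicE; case: (eqVneq rho 0) => [r0|r0].
  have y0 : y = 0.
    apply/eqP; rewrite -sqrf_eq0; move/eqP: r2; rewrite r0 expr0n/= eq_sym.
    by rewrite paddr_eq0 ?sqr_ge0// => /andP[].
  by rewrite r0 invr0 y0 !mulr0 oppr0 mul0r addr0.
rewrite memNset; last by move=> /= h; rewrite h eqxx in r0.
by rewrite addr0; ring.
Qed.

Lemma measurable_givens d (T : measurableType d) (f g : T -> R) :
  measurable_fun setT f -> measurable_fun setT g ->
  measurable_fun setT (fun w => givens_cos (f w) (g w)) /\
  measurable_fun setT (fun w => givens_sin (f w) (g w)).
Proof.
move=> mf mg.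
have mr : measurable_fun setT (fun w => Num.sqrt (f w ^+ 2 + g w ^+ 2)).
  apply: measurable_fun_sqrt; apply: measurable_funD; exact: measurable_funX.
have mri : measurable_fun setT (fun w => (Num.sqrt (f w ^+ 2 + g w ^+ 2))^-1).
  by apply: measurable_fun_inv_ge0 => // w; exact: sqrtr_ge0.
split; last exact: measurable_funM.
apply: measurable_funD; first exact: measurable_funM.
have mi : measurable_fun setT (\1_[set (0 : R)] : R -> R) by exact: measurable_indic.
exact: (measurableT_comp mi mr).
Qed.

End givens_coefficients.

Section random_givens.
Context d (T : measurableType d) (R : realType) (P : probability T R).
Variables (s : R).
Hypothesis s0 : s != 0.

Lemma eq_iid_normal (I : finType) (H : set (set T)) (J : {set I}) (Z Z' : I -> T -> R) :
  (forall i, i \in J -> Z i = Z' i) -> iid_normal P s H J Z -> iid_normal P s H J Z'.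
Proof.
move=> ZZ' iid D A HD mA; rewrite -iid//; congr (P (_ `&` _)).
by apply: eq_bigcapr => i iJ; rewrite ZZ'.
Qed.

Section fixed_sigma_algebra.
Variables (p n : nat) (G : set (set T)).
Hypothesis Gm : <<s G >> `<=` measurable.
Local Notation TG := (g_sigma_algebraType G).

Definition entries (M : T -> 'M[R]_(p, n)) : 'I_p * 'I_n -> T -> R :=
  fun ij w => M w ij.1 ij.2.

Definition region (I0 : {set 'I_p}) (l : nat) : {set 'I_p * 'I_n} :=
  [set ij : 'I_p * 'I_n | (ij.1 \in I0) && (l <= ij.2)%N]%SET.

Lemma measurable_fun_coarse (f : T -> R) :
  measurable_fun [set: TG] f -> measurable_fun [set: T] f.
Proof. by move=> mf _ B mB; rewrite setTI; apply: Gm; rewrite -[X in _ X]setTI; exact: mf. Qed.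

Lemma measurable_mulmx_givens (M : T -> 'M[R]_(p, n)) (a b : 'I_n) (c e : T -> R) :
  measurable_fun setT c -> measurable_fun setT e ->
  (forall ij, measurable_fun setT (entries M ij)) ->
  forall ij, measurable_fun setT
    (entries (fun w => M w *m givens a b (c w) (e w)) ij).
Proof.
move=> mc me mM [i j]; rewrite /entries /=.
rewrite (_ : (fun w => _) = fun w => if j == a then c w * M w i a + e w * M w i b
    else if j == b then - e w * M w i a + c w * M w i b else M w i j); last first.
  by apply/funext => w; rewrite mulmx_givens.
have [_|_] := eqVneq j a; last have [_|_] := eqVneq j b.
- apply: measurable_funD; apply: measurable_funM => //.
    exact: (mM (i, a)).
  exact: (mM (i, b)).
- apply: measurable_funD; apply: measurable_funM => //.
  + exact: measurableT_comp.
  + exact: (mM (i, a)).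
  + exact: (mM (i, b)).
- exact: (mM (i, j)).
Qed.

(** All rows of [I0] turn by the same random angle, one row after the other; [Z S] is the array in
    which the rows of [S] are done. Each step keeps the independence from [<<s G>>], so the angle
    can be used again. *)
Lemma iid_normal_givens (I0 : {set 'I_p}) (l : nat) (a b : 'I_n)
    (c e : T -> R) (M : T -> 'M[R]_(p, n)) :
  a != b -> (l <= a)%N -> (l <= b)%N ->
  measurable_fun [set: TG] c -> measurable_fun [set: TG] e ->
  (forall w, c w ^+ 2 + e w ^+ 2 = 1) ->
  (forall ij, measurable_fun setT (entries M ij)) ->
  iid_normal P s <<s G >> (region I0 l) (entries M) ->
  iid_normal P s <<s G >> (region I0 l)
    (entries (fun w => M w *m givens a b (c w) (e w))).
Proof.
move=> ab la lb mc me ce1 mM iid.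
have mc' := measurable_fun_coarse mc; have me' := measurable_fun_coarse me.
pose M1 w := M w *m givens a b (c w) (e w).
have mM1 : forall ij, measurable_fun setT (entries M1 ij).
  exact: measurable_mulmx_givens.
pose Z (S : {set 'I_p}) ij := if ij.1 \in S then entries M1 ij else entries M ij.
suff: forall S : {set 'I_p}, S \subset I0 -> iid_normal P s <<s G >> (region I0 l) (Z S).
  move=> /(_ I0 (fintype.subxx _)); apply: eq_iid_normal => ij.
  by rewrite inE /Z => /andP[-> _].
move=> S; have [m] := ubnP #|S|; elim: m S => // m IH S; rewrite ltnS => Sm SI0.
have [->|[i iS]] := set_0Vmem S.
  by apply: eq_iid_normal iid => ij _; rewrite /Z inE.
pose S' := (S :\ i)%SET.
have SE : S = (i |: S')%SET by rewrite finset.setD1K.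
have iS' : i \notin S' by rewrite !inE eqxx.
have S'I : S' \subset I0 by rewrite (fintype.subset_trans _ SI0)// subD1set.
have S'm : (#|S'| < m)%N by move: Sm; rewrite SE cardsU1 iS'.
clearbody S'; have iid' := IH S' S'm S'I.
have iI0 : i \in I0 by exact: (fintype.subsetP SI0).
have mG : forall E, measurable E -> <<s G >> ((fun w => (c w, e w)) @^-1` E).
  move=> E mE; have mce : measurable_fun [set: TG] (fun w => (c w, e w)).
    exact: measurable_fun_pair.
  by rewrite -[X in _ X]setTI; exact: mce.
have HI : setI_closed <<s G >>.
  by move=> A B GA GB; exact: (@measurableI _ TG).
have mZ ij : measurable_fun setT (Z S' ij) by rewrite /Z; case: ifPn.
have ia : (i, a) \in region I0 l by rewrite inE iI0.
have ib : (i, b) \in region I0 l by rewrite inE iI0.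
have iab : (i, a) != (i, b) by rewrite xpair_eqE eqxx.
have := iid_normal_rotate Gm HI mG mc' me' ce1 mZ ia ib iab s0 iid'.
apply: eq_iid_normal => -[k j] _; apply/funext => w.
rewrite /Z SE !inE !xpair_eqE /= /entries /= (negbTE iS').
have [->|ki] := eqVneq k i; rewrite ?(negbTE iS')//=.
by rewrite /M1 mulmx_givens; have [] := eqVneq j a; have [] := eqVneq j b.
Qed.

End fixed_sigma_algebra.
End random_givens.

Section elimination.
Context d (T : measurableType d) (R : realType) (P : probability T R).
Variables (s : R).
Hypothesis s0 : s != 0.
Variables (p n : nat).

(** These are the matrices diag(1, O) with an identity block of size [h] and [O] orthogonal,
    described by their action on rows to avoid casts between dimensions. *)
Definition acts_from (h : nat) (F : 'M[R]_n) : Prop :=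
  [/\ F^T *m F = 1%:M,
    forall m (x : 'M[R]_(m, n)) k (j : 'I_n), (j < h)%N -> (x *m F) k j = x k j &
    forall m (x : 'M[R]_(m, n)) k, (forall j : 'I_n, (h <= j)%N -> x k j = 0) ->
      forall j, (x *m F) k j = x k j].

Lemma acts_from1 h : acts_from h 1%:M.
Proof. by split => [|m x k j _|m x k _ j]; rewrite ?trmx1 mulmx1. Qed.

Lemma acts_fromM h F F' : acts_from h F -> acts_from h F' -> acts_from h (F *m F').
Proof.
move=> [F1 F2 F3] [F'1 F'2 F'3]; split.
- by rewrite trmx_mul mulmxA -(mulmxA F'^T) F1 mulmx1.
- by move=> m x k j jh; rewrite mulmxA F'2// F2.
- move=> m x k xk j; rewrite mulmxA F'3 ?F3// => i hi.
  by rewrite F3// xk.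
Qed.

Lemma acts_from_givens (h : nat) (a b : 'I_n) (c e : R) :
  a != b -> (h <= a)%N -> (h <= b)%N -> c ^+ 2 + e ^+ 2 = 1 ->
  acts_from h (givens a b c e).
Proof.
move=> ab ha hb ce; split; first exact: givens_orthogonal.
  move=> m x k j jh; rewrite mulmx_givens.
  by do 2 (case: eqP => [E|_]; first by move: jh; rewrite E ltnNge ?ha ?hb).
move=> m x k xk j; rewrite mulmx_givens (xk a ha) (xk b hb) !mulr0 addr0.
by case: eqP => [->|_]; [rewrite xk|case: eqP => [->|//]; rewrite xk].
Qed.

Lemma acts_from_row h F (i j : 'I_n) : acts_from h F -> (i < h)%N -> F i j = (i == j)%:R.
Proof.
move=> [_ _ F3] ih; have := F3 1 (delta_mx 0 i) 0.
rewrite -rowE => F3i; have := F3i _ j; rewrite !mxE eqxx => ->; first by rewrite eq_sym.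
move=> k hk; rewrite mxE eqxx; case: eqP => // E.
by move: ih; rewrite -E ltnNge hk.
Qed.

Lemma acts_from_ext h F m m' (x : 'M[R]_(m, n)) (y : 'M[R]_(m', n)) k k' :
  acts_from h F -> (forall j : 'I_n, (h <= j)%N -> x k j = y k' j) ->
  forall j : 'I_n, (h <= j)%N -> (x *m F) k j = (y *m F) k' j.
Proof.
move=> hF xy j hj; rewrite !mxE; apply: eq_bigr => i _.
have [hi|ih] := leqP h i; first by rewrite xy.
rewrite (acts_from_row j hF ih); case: eqP => [E|_]; last by rewrite !mulr0.
by move: ih; rewrite E ltnNge hj.
Qed.

Lemma acts_from_le h h' F : (h' <= h)%N -> acts_from h F -> acts_from h' F.
Proof.
move=> hh [F1 F2 F3]; split => //.
- by move=> m x k j jh; apply: F2; exact: leq_trans hh.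
- by move=> m x k xk j; apply: F3 => i hi; apply: xk; exact: leq_trans hi.
Qed.

(** Rotations in the planes (h, h + dd), ..., (h, h + 1) clear the row from its end. The matrix is a
    function [f] of the row alone, so the angles are measurable for [G] and the rest of the array
    stays iid. A pivot made by a rotation is a norm, hence nonnegative; without any rotation it
    keeps its old sign, whence the disjunction. *)
Lemma eliminate (G : set (set T)) (I0 : {set 'I_p}) (l : nat) (h : 'I_n) (dd : nat)
    (g : T -> 'rV[R]_n) (M : T -> 'M[R]_(p, n)) :
  <<s G >> `<=` measurable -> (l <= h)%N ->
  (forall j, measurable_fun [set: g_sigma_algebraType G] (fun w => g w 0 j)) ->
  (forall ij, measurable_fun setT (entries M ij)) ->
  iid_normal P s <<s G >> (region n I0 l) (entries M) ->
  (forall w (j : 'I_n), (h + dd < j)%N -> g w 0 j = 0) ->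
  exists f : 'rV[R]_n -> 'M[R]_n,
    [/\ forall w, acts_from h (f (g w)),
      forall w (j : 'I_n), (h < j)%N -> (g w *m f (g w)) 0 j = 0,
      (0 < dd)%N && (h + dd < n)%N \/ (forall w, 0 <= g w 0 h) ->
        forall w, 0 <= (g w *m f (g w)) 0 h,
      forall ij, measurable_fun setT (entries (fun w => M w *m f (g w)) ij) &
      iid_normal P s <<s G >> (region n I0 l) (entries (fun w => M w *m f (g w)))].
Proof.
move=> Gm lh; elim: dd g M => [|dd IH] g M mg mM iid gz.
  have E : (fun w => M w *m 1%:M) = M by apply/funext => w; rewrite mulmx1.
  exists (fun=> 1%:M); rewrite E; split => //.
  - by move=> w; exact: acts_from1.
  - by move=> w j hj; rewrite mulmx1 gz// addn0.
  - by move=> [//|gh] w; rewrite mulmx1.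
have [hd|hd] := ltnP (h + dd.+1) n; last first.
  have [] := IH g M mg mM iid.
    move=> w j hj; apply: gz; rewrite addnS ltn_neqAle hj andbT.
    by apply/eqP => E; have := ltn_ord j; rewrite -E -addnS ltnNge hd.
  move=> f [F1 F2 F3 F4 F5].
  by exists f; split => // -[|h0]; [rewrite andbF|apply: F3; right].
pose b := Ordinal hd.
have hb : h != b by rewrite -val_eqE /= neq_ltn addnS ltnS leq_addr.
have hbl : (h <= b)%N by rewrite /= leq_addr.
pose c w := givens_cos (g w 0 h) (g w 0 b).
pose e w := givens_sin (g w 0 h) (g w 0 b).
have [mc me] := measurable_givens (mg h) (mg b).
have ce1 w : c w ^+ 2 + e w ^+ 2 = 1 by exact: givens_cos_sin.
pose f0 (x : 'rV[R]_n) :=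
  givens h b (givens_cos (x 0 h) (x 0 b)) (givens_sin (x 0 h) (x 0 b)).
pose F0 w := givens h b (c w) (e w).
have mc' := measurable_fun_coarse Gm mc; have me' := measurable_fun_coarse Gm me.
have [] := IH (fun w => g w *m F0 w) (fun w => M w *m F0 w).
- move=> j; rewrite (_ : (fun w => _) = fun w =>
    if j == h then c w * g w 0 h + e w * g w 0 b
    else if j == b then - e w * g w 0 h + c w * g w 0 b else g w 0 j); last first.
    by apply/funext => w; rewrite mulmx_givens.
  have [_|_] := eqVneq j h; last have [_|_] := eqVneq j b; last exact: mg.
    by apply: measurable_funD; exact: measurable_funM.
  apply: measurable_funD; apply: measurable_funM => //.
  exact: measurableT_comp.
- exact: measurable_mulmx_givens.
- by apply: iid_normal_givens => //; exact: leq_trans hbl.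
- move=> w j hj; rewrite mulmx_givens.
  case: eqP => [E|_]; first by move: hj; rewrite E ltnNge leq_addr.
  case: eqP => [_|/eqP jb]; first by rewrite /c /e; exact: givens_zero.
  by apply: gz; rewrite ltn_neqAle eq_sym -[(_ + _)%N]/(val b) val_eqE jb /= addnS.
move=> f [F1 F2 F3 F4 F5]; exists (fun x => f0 x *m f (x *m f0 x)).
have E : (fun w => M w *m (f0 (g w) *m f (g w *m f0 (g w)))) =
    (fun w => M w *m F0 w *m f (g w *m F0 w)).
  by apply/funext => w; rewrite mulmxA.
rewrite E; split => //.
- move=> w; apply: acts_fromM; last exact: F1.
  by apply: acts_from_givens => //; exact: ce1.
- by move=> w j hj; rewrite mulmxA; exact: F2.
- move=> _ w; rewrite mulmxA; apply: F3; right => {}w.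
  by rewrite mulmx_givens eqxx /c /e givens_pivot sqrtr_ge0.
Qed.

Definition tail_set (k : 'I_p) (h : nat) : {set 'I_p * 'I_n} :=
  [set ij : 'I_p * 'I_n | (ij.1 == k) && (h <= ij.2)%N]%SET.

Definition corner (k l : nat) : {set 'I_p * 'I_n} :=
  [set ij : 'I_p * 'I_n | (k <= ij.1)%N && (l <= ij.2)%N]%SET.

Lemma acts_from_norm h F (x : 'rV[R]_n) : acts_from h F ->
  \sum_(j < n | (h <= j)%N) (x *m F) 0 j ^+ 2 = \sum_(j < n | (h <= j)%N) x 0 j ^+ 2.
Proof.
move=> [F1 F2 _].
have FF : F *m F^T = 1%:M by rewrite mulmx1C.
have : \sum_j (x *m F) 0 j ^+ 2 = \sum_j x 0 j ^+ 2.
  have E (y : 'rV[R]_n) : \sum_j y 0 j ^+ 2 = (y *m y^T) 0 0.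
    by rewrite mxE; apply: eq_bigr => j _; rewrite mxE expr2.
  by rewrite !E trmx_mul mulmxA -(mulmxA x) FF mulmx1.
rewrite [LHS](bigID (fun j : 'I_n => (h <= j)%N))/= [RHS](bigID (fun j : 'I_n => (h <= j)%N))/=.
rewrite (eq_bigr (fun j => x 0 j ^+ 2) (P := fun j : 'I_n => ~~ (h <= j)%N)).
  by move/addIr.
by move=> j; rewrite -ltnNge => jh; rewrite F2.
Qed.

(** The angles depend on the entries of row [k] from column [l] on, and the rows below are
    independent of these. The norm of the tail of the row is preserved, so the squared pivot is a
    chi-square sum. Its sign is known unless [h] is the last column, where nothing is rotated. *)
Lemma row_step (M : T -> 'M[R]_(p, n)) (k : 'I_p) (l : nat) (h : 'I_n) :
  (l <= h)%N -> (forall ij, measurable_fun setT (entries M ij)) ->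
  iid_normal P s [set setT] (corner k l) (entries M) ->
  exists F : T -> 'M[R]_n,
    [/\ forall w, acts_from h (F w),
      forall w (j : 'I_n), (h < j)%N -> (M w *m F w) k j = 0,
      (forall w, (h.+1 < n)%N -> 0 <= (M w *m F w) k h) /\
      (forall w, (M w *m F w) k h ^+ 2 = \sum_(ij in tail_set k h) entries M ij w ^+ 2),
      forall ij, measurable_fun setT (entries (fun w => M w *m F w) ij) &
      iid_normal P s [set setT] (corner k.+1 l) (entries (fun w => M w *m F w))].
Proof.
move=> lh mM iid.
pose K := tail_set k l; pose I0 : {set 'I_p} := [set i : 'I_p | (k < i)%N]%SET.
have JK ij : ij \in region n I0 l -> ij \in K = false.
  rewrite !inE => /andP[ki _]; apply/negbTE; rewrite negb_and.
  by rewrite -val_eqE neq_ltn ki orbT.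
have iidK : iid_normal P s [set setT] (region n I0 l :|: K)%SET (entries M).
  apply: iid_normal_subset iid; apply/fintype.subsetP => -[i j]; rewrite !inE /=.
  case/orP => /andP[]; first by move/ltnW => -> ->.
  by move=> /eqP -> ->; rewrite leqnn.
have iid1 := iid_normal_cylinders mM erefl JK iidK.
have Gm := cylinders_measurable (J := K) mM.
pose g w : 'rV[R]_n := \row_j (if (l <= j)%N then M w k j else 0).
have [] := @eliminate (cylinders (entries M) K) I0 l h (n.-1 - h)%N g M Gm lh.
- move=> j; rewrite (_ : (fun w => _) = fun w => if (l <= j)%N then M w k j else 0); last first.
    by apply/funext => w; rewrite mxE.
  have [lj|lj] := leqP l j; last exact: measurable_cst.
  by apply: (@cylinders_measurable_fun _ _ _ _ (entries M) K (k, j)); rewrite !inE eqxx.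
- exact: mM.
- exact: iid1.
- move=> w j; rewrite subnKC; last by rewrite -ltnS prednK// (leq_ltn_trans _ (ltn_ord h)).
  by rewrite ltnNge -ltnS prednK ?ltn_ord// (leq_ltn_trans _ (ltn_ord h)).
move=> f [F1 F2 F3 F4 F5]; pose F w := f (g w).
have gF w (j : 'I_n) : (h <= j)%N -> (M w *m F w) k j = (g w *m F w) 0 j.
  move=> hj; apply: (acts_from_ext (F1 w)) => // i hi.
  by rewrite mxE (leq_trans lh hi).
exists F; split => //.
- by move=> w j hj; rewrite gF ?F2// ltnW.
- split=> w.
    move=> hn; rewrite gF//; apply: F3; left.
    have hn1 : (h <= n.-1)%N by rewrite -ltnS (ltn_predK hn) ltn_ord.
    by rewrite subn_gt0 -ltnS (ltn_predK hn) hn subnKC// -ltnS (ltn_predK hn) leqnn.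
  have := acts_from_norm (g w) (F1 w).
  rewrite (bigD1 h)//= [X in _ + X]big1 ?addr0; last first.
    move=> j /andP[hj jh]; rewrite F2 ?expr0n// ltn_neqAle eq_sym hj andbT.
    by rewrite -val_eqE in jh.
  rewrite gF// => ->.
  rewrite [RHS](reindex_onto (fun j => (k, j)) (fun ij => ij.2))/=; last first.
    by move=> [i j]; rewrite inE /= => /andP[/eqP-> _].
  apply: eq_big => j; first by rewrite !inE /= !eqxx ?andbT.
  by move=> hj; rewrite /entries mxE (leq_trans lh hj).
- move=> D A -> mA.
  have DG : <<s cylinders (entries M) K >> setT.
    by apply: sub_sigma_algebra; exact: cylinders_setT.
  have <- : region n I0 l = corner k.+1 l by apply/finset.setP => ij; rewrite !inE.
  exact: (F5 setT A DG mA).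
Qed.

End elimination.

Lemma iid_normal_tr d (T : measurableType d) (R : realType) (P : probability T R)
    (s : R) (p n k l : nat) (M : T -> 'M[R]_(p, n)) (H : set (set T)) :
  iid_normal P s H (corner p n k l) (entries M) ->
  iid_normal P s H (corner n p l k) (entries (fun w => (M w)^T)).
Proof.
move=> iid D A HD mA.
have := iid D (fun ij => A (ij.2, ij.1)) HD (fun ij => mA _).
rewrite (_ : \bigcap_(i in _) _ = \bigcap_(i in [set` corner n p l k])
    (entries (fun w => (M w)^T) i @^-1` A i)).
  move=> ->; congr (_ * _)%E.
  rewrite [RHS](reindex_onto (fun ij : 'I_p * 'I_n => (ij.2, ij.1))
    (fun ij : 'I_n * 'I_p => (ij.2, ij.1)))/=; last by case.
  apply: eq_bigl => -[i j]; rewrite !inE /= andbC eqxx andbT.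
  by [].
apply/seteqP; split => w h [i j] /=; rewrite inE /= => /andP[ik jl].
  by have := h (j, i); rewrite /entries /= mxE; apply; rewrite inE /= ik jl.
by have := h (j, i); rewrite /entries /= mxE; apply; rewrite inE /= ik jl.
Qed.

Section band_reduction.
Context d (T : measurableType d) (R : realType) (P : probability T R).
Variables (s : R) (r : nat) (e tau : R).
Hypotheses (s0 : 0 < s) (tauh : 0 < tau <= 4^-1).

(** The flag [b] holds when at least one rotation produced the pivot, which fixes its sign. *)
Definition pivot_near (x : R) (m : nat) (b : bool) : Prop :=
  `|x ^+ 2 - m%:R * s ^+ 2| <= e /\ (b -> 0 <= x).

(** The bound of [chi_square_tail] with the number of squares replaced by [p + n], so that one
    expression serves all the sums that occur. *)
Definition tail_bound (p n : nat) : R :=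
  2 * expR (4 * (p + n)%:R * tau ^+ 2 - tau * e / s ^+ 2).

(* The state after k row steps and l column steps.  Each step is a function of the
   row or column that it reduces, so the corner that it rotates stays iid. *)
Definition band_state (p n : nat) (M0 : T -> 'M[R]_(p, n)) (k l : nat) : Prop :=
  exists (M : T -> 'M[R]_(p, n)) (E : set T),
  [/\ measurable E /\
        (P E <= ((k + l)%:R * ((p + n).+1%:R * tail_bound p n))%:E)%E,
      (forall ij, measurable_fun setT (entries M ij)) /\
        iid_normal P s [set setT] (corner p n k l) (entries M),
      forall w, exists U1 U2,
        [/\ acts_from r U1, acts_from r U2 & M w = U1^T *m M0 w *m U2],
      forall w (i : 'I_p) (j : 'I_n),
        (i < k)%N && (i + r < j)%N || (j < l)%N && (j + r < i)%N -> M w i j = 0 &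
      forall w, ~ E w -> forall (i : 'I_p) (j : 'I_n),
        [/\ (i < k)%N || (j < l)%N -> (i < j + r)%N -> (j < i + r)%N ->
              M w i j ^+ 2 <= e + s ^+ 2,
            (i < k)%N -> j = (i + r)%N :> nat -> pivot_near (M w i j) (n - j) (j.+1 < n)%N &
            (j < l)%N -> i = (j + r)%N :> nat -> pivot_near (M w i j) (p - i) (i.+1 < p)%N]].

Lemma band_state_tr (p n : nat) (M0 : T -> 'M[R]_(p, n)) (k l : nat) :
  band_state M0 k l -> band_state (fun w => (M0 w)^T) l k.
Proof.
move=> [M [E [[mE PE] [mM iid] MO Mz Mn]]].
exists (fun w => (M w)^T), E; split.
- by split; rewrite // addnC /tail_bound (addnC n).
- split; last exact: iid_normal_tr.
  move=> [i j]; have := mM (j, i); rewrite /entries /=.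
  by under [in X in _ -> X]eq_fun do rewrite mxE.
- move=> w; have [U1 [U2 [h1 h2 ->]]] := MO w; exists U2, U1; split => //.
  by rewrite !trmx_mul trmxK mulmxA.
- by move=> w i j h; rewrite mxE Mz// orbC.
- move=> w wE i j; have [h1 h2 h3] := Mn w wE j i; rewrite !mxE; split.
  + by rewrite orbC => ? ? ?; apply: h1.
  + exact: h3.
  + exact: h2.
Qed.

Lemma row_step_nat (p n : nat) (M : T -> 'M[R]_(p, n)) (k : 'I_p) (l h : nat) :
  (l <= h)%N -> (forall ij, measurable_fun setT (entries M ij)) ->
  iid_normal P s [set setT] (corner p n k l) (entries M) ->
  exists F : T -> 'M[R]_n,
    [/\ forall w, acts_from h (F w),
      forall w (j : 'I_n), (h < j)%N -> (M w *m F w) k j = 0,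
      forall w (j : 'I_n), j = h :> nat ->
        ((j.+1 < n)%N -> 0 <= (M w *m F w) k j) /\
        (M w *m F w) k j ^+ 2 = \sum_(ij in tail_set n k h) entries M ij w ^+ 2,
      forall ij, measurable_fun setT (entries (fun w => M w *m F w) ij) &
      iid_normal P s [set setT] (corner p n k.+1 l) (entries (fun w => M w *m F w))].
Proof.
move=> lh mM iid; have [hn|hn] := ltnP h n.
  have sn0 : s != 0 by rewrite gt_eqF.
  have [F [F1 F2 [F3 F3'] F4 F5]] := row_step sn0 (h := Ordinal hn) lh mM iid.
  exists F; split => // w j jh; have -> : j = Ordinal hn by exact: val_inj.
  by split; [exact: F3|exact: F3'].
exists (fun=> 1%:M).
have E : (fun w => M w *m 1%:M) = M by apply/funext => w; rewrite mulmx1.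
rewrite E; split => //.
- by move=> _; exact: acts_from1.
- by move=> w j hj; have := ltn_ord j; rewrite ltnNge (leq_trans hn (ltnW hj)).
- by move=> w j hj; have := ltn_ord j; rewrite hj ltnNge hn.
- apply: iid_normal_subset iid; apply/fintype.subsetP => ij; rewrite !inE.
  by move=> /andP[/ltnW -> ->].
Qed.

Lemma probability_bigsetU_le (I : Type) (q : seq I) (A : I -> set T) (b : R) :
  0 <= b -> (forall i, measurable (A i)) -> (forall i, (P (A i) <= b%:E)%E) ->
  measurable (\big[setU/set0]_(i <- q) A i) /\
  (P (\big[setU/set0]_(i <- q) A i) <= ((size q)%:R * b)%:E)%E.
Proof.
move=> b0 mA PA; elim: q => [|i q [mq IH]].
  by rewrite big_nil mul0r measure0; split.
rewrite big_cons; split; first exact: measurableU.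
apply: le_trans (measureU2 _ _ _) _ => //.
by rewrite /= -addn1 natrD mulrDl mul1r addrC EFinD; apply: leeD.
Qed.

(** The rotation acts from column [k + r] on. The finished columns [j < l] lie before it, as
    [l <= k + r], and the finished rows [i < k] vanish there, so earlier work is not disturbed.
    Since [k + r >= r], the accumulated factor also leaves the signal coordinates alone. *)
Lemma band_state_row (p n : nat) (M0 : T -> 'M[R]_(p, n)) (k l : nat) :
  (k < p)%N -> (l <= k + r)%N -> band_state M0 k l -> band_state M0 k.+1 l.
Proof.
move=> kp lh [M [E [[mE PE] [mM iid] MO Mz Mn]]].
pose k' := Ordinal kp.
have [F [F1 F2 F3 F4 F5]] := row_step_nat (k := k') lh mM iid.
pose bad (K : {set 'I_p * 'I_n}) : set T :=
  [set w | e <= `|\sum_(ij in K) entries M ij w ^+ 2 - #|K|%:R * s ^+ 2|].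
have mbad K : measurable (bad K).
  have mf : measurable_fun setT (fun w =>
      `|\sum_(ij in K) entries M ij w ^+ 2 - #|K|%:R * s ^+ 2|).
    apply: measurableT_comp => //; apply: measurable_funB => //.
    by apply: measurable_sum_set => ij _; exact: measurable_funX.
  rewrite (_ : bad K = (fun w =>
      `|\sum_(ij in K) entries M ij w ^+ 2 - #|K|%:R * s ^+ 2|) @^-1` `[e, +oo[%classic).
    by rewrite -[X in measurable X]setTI; exact: mf.
  by apply/seteqP; split => w /=; rewrite in_itv/= andbT.
have tb0 : 0 <= tail_bound p n by rewrite mulr_ge0// expR_ge0.
have Pbad (K : {set 'I_p * 'I_n}) : K \subset corner p n k l -> (#|K| <= p + n)%N ->
    (P (bad K) <= (tail_bound p n)%:E)%E.
  move=> KJ Kn; apply: le_trans (chi_square_tail s0 erefl mM iid e KJ tauh) _.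
  rewrite lee_fin ler_pM2l// ler_expR lerD2r -!mulrA ler_pM2l//.
  by rewrite ler_wpM2r ?sqr_ge0// ler_nat.
(* Two kinds of bad event: entries of row [k] left of the pivot, which are never rotated again, are
   bounded as sums of one square ([K1]), and the pivot comes from the tail of the row ([K2]). These
   are [n + 1] events, within the [(p + n).+1] that the state allows per step. *)
pose K1 (j : 'I_n) := if (l <= j)%N then [set (k', j)]%SET else finset.set0.
pose E1 := \big[setU/set0]_(j <- enum 'I_n) bad (K1 j).
have PK1 j : (P (bad (K1 j)) <= (tail_bound p n)%:E)%E.
  apply: Pbad; rewrite /K1; case: ifPn => lj; rewrite ?finset.sub0set ?cards0//.
  + by apply/fintype.subsetP => ij; rewrite !inE => /eqP -> /=; rewrite leqnn.
  + by rewrite cards1 (leq_trans (leq_ltn_trans (leq0n j) (ltn_ord j)))// leq_addl.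
have [mE1 PE1] := probability_bigsetU_le (enum 'I_n) tb0 (fun j => mbad (K1 j)) PK1.
rewrite size_enum_ord in PE1.
pose K2 := tail_set n k' (k + r).
have cK2 : #|K2| = (n - (k + r))%N.
  rewrite -sum1_card (reindex_onto (fun j => (k', j)) (fun ij => ij.2))/=; last first.
    by move=> [i j]; rewrite inE /= => /andP[/eqP-> _].
  rewrite -[RHS]muln1 -sum_nat_const_nat big_geq_mkord.
  by apply: eq_bigl => j; rewrite !inE /= !eqxx andbT.
exists (fun w => M w *m F w), (E `|` (bad K2 `|` E1)).
have mE2 : measurable (bad K2 `|` E1) by exact: measurableU.
split.
- split; first exact: measurableU.
  apply: le_trans (measureU2 _ mE mE2) _.
  rewrite addSn -addn1 natrD mulrDl mul1r EFinD; apply: leeD => //.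
  apply: le_trans (measureU2 _ (mbad _) mE1) _.
  apply: (@le_trans _ _ ((tail_bound p n)%:E + (n%:R * tail_bound p n)%:E)%E).
    apply: leeD => //; apply: Pbad.
      apply/fintype.subsetP => ij; rewrite !inE => /andP[/eqP -> h].
      by rewrite leqnn (leq_trans lh).
    by rewrite cK2 (leq_trans (leq_subr _ _))// leq_addl.
  rewrite -EFinD lee_fin -addn1 addnC natrD mulrDl mul1r lerD2l.
  by rewrite ler_wpM2r// ler_nat leq_addl.
- by split.
- move=> w; have [U1 [U2 [h1 h2 E2]]] := MO w; exists U1, (U2 *m F w); split => //.
    by apply: acts_fromM => //; apply: acts_from_le (F1 w); rewrite leq_addl.
  by rewrite E2 !mulmxA.
- move=> w i j; have [_ Flt Fz] := F1 w.
  case/orP => /andP[].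
    rewrite ltnS leq_eqVlt => /orP[/eqP ik|ik] ij.
      have -> : i = k' by exact: val_inj.
      by rewrite F2// -ik.
    rewrite Fz ?Mz ?ik ?ij// => j' hj'; rewrite Mz// ik /=.
    by rewrite (leq_trans _ hj')// ltn_add2r.
  move=> jl ji; rewrite Flt; first by rewrite Mz// jl ji orbT.
  by rewrite (leq_trans jl)// (leq_trans lh).
- move=> w; rewrite /setU /= => /not_orP[wE /not_orP[wK wE1]] i j.
  have [h1 h2 h3] := Mn w wE i j.
  have [_ Flt Fz] := F1 w.
  have old : (i < k)%N || (j < l)%N -> (M w *m F w) i j = M w i j.
    case/orP => [ik|jl]; last by rewrite Flt// (leq_trans jl lh).
    by rewrite Fz// => j' hj'; rewrite Mz// ik /= (leq_trans _ hj')// ltn_add2r.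
  have new : (i < k)%N = false -> (i < k.+1)%N -> i = k'.
    move=> /negbT; rewrite -leqNgt => ki ik; apply: val_inj => /=.
    by apply/eqP; rewrite eqn_leq ki -ltnS ik.
  split.
  + move=> hij ijr jir; have [ik|ik] := boolP ((i < k)%N || (j < l)%N).
      by rewrite old// h1.
    move: ik hij; rewrite negb_or => /andP[/negbTE ik /negbTE jl].
    rewrite jl orbF => /(new ik) ik'; rewrite {h1 h2 h3 old new ik}ik' in ijr jir *.
    rewrite Flt//; have : ~ bad (K1 j) w.
      move=> hb; apply: wE1; rewrite /E1 -bigcup_seq; exists j => //=.
      by rewrite mem_enum.
    rewrite /bad /= /K1 leqNgt jl /= big_set1 cards1 mul1r => /negP; rewrite -ltNge.
    by rewrite /entries/= => /ltW; rewrite ler_norml => /andP[_]; rewrite lerBlDr addrC.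
  + move=> ik1 ji; case: (boolP (i < k)%N) => [ik|/negbTE ik].
      by rewrite old ?ik//; exact: h2.
    have ik' := new ik ik1; rewrite ik' in ji *.
    have [F3a F3b] := F3 w j ji; split; last exact: F3a.
    rewrite F3b; move/negP: wK; rewrite /bad /= -ltNge => /ltW.
    by rewrite cK2 ji.
  + by move=> jl ij; rewrite old ?jl ?orbT//; exact: h3.
Qed.

End band_reduction.

(** * Bases that start with the signal vectors, and the final band form *)

Section prepared_bases.
Context d (T : measurableType d) (R : realType) (P : probability T R).
Variables (s : R).
Hypothesis s0 : s != 0.

(** The elimination is reused on the constant row of [v k], with the sigma-algebra of no entries. By
    orthonormality this row has no component before [k], so its pivot has square 1. As [r < n], a
    rotation takes place and makes the pivot +1. *)
Lemma prepare_basis (p n r : nat) (M0 : T -> 'M[R]_(p, n)) (v : 'I_r -> 'cV[R]_n) :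
  (r < n)%N -> orthonormal_family v ->
  (forall ij, measurable_fun setT (entries M0 ij)) ->
  iid_normal P s [set setT] (corner p n 0 0) (entries M0) ->
  exists Q : 'M[R]_n,
    [/\ Q^T *m Q = 1%:M,
      forall (i : 'I_r) (j : 'I_n), ((v i)^T *m Q) 0 j = (i == j :> nat)%:R,
      forall ij, measurable_fun setT (entries (fun w => M0 w *m Q) ij) &
      iid_normal P s [set setT] (corner p n 0 0) (entries (fun w => M0 w *m Q))].
Proof.
move=> rn ov mM0 iid0.
suff: forall k, (k <= r)%N -> exists Q : 'M[R]_n,
    [/\ Q^T *m Q = 1%:M,
      forall (i : 'I_r) (j : 'I_n), (i < k)%N -> ((v i)^T *m Q) 0 j = (i == j :> nat)%:R,
      forall ij, measurable_fun setT (entries (fun w => M0 w *m Q) ij) &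
      iid_normal P s [set setT] (corner p n 0 0) (entries (fun w => M0 w *m Q))].
  move=> /(_ r (leqnn _)) [Q [Q1 Q2 Q3 Q4]]; exists Q; split => // i j.
  exact: Q2.
elim=> [_|k IH kr].
  exists 1%:M; have E : (fun w => M0 w *m 1%:M) = M0 by apply/funext => w; rewrite mulmx1.
  by rewrite E; split; rewrite // trmx1 mulmx1.
have [Q [Q1 Q2 Q3 Q4]] := IH (ltnW kr).
pose M w := M0 w *m Q.
pose k' : 'I_r := Ordinal kr.
have kn : (k < n)%N by exact: (ltn_trans kr rn).
have kn1 : (k.+1 < n)%N by exact: (leq_ltn_trans kr rn).
pose h := Ordinal kn.
pose g : T -> 'rV[R]_n := fun=> (v k')^T *m Q.
have cE : corner p n 0 0 = (region n [set: 'I_p] 0 :|: finset.set0)%SET.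
  by apply/finset.setP => ij; rewrite !inE.
have JK ij : ij \in region n [set: 'I_p]%SET 0 -> ij \in (finset.set0 : {set 'I_p * 'I_n}) = false.
  by rewrite !inE.
have iid1 := Q4; rewrite cE in iid1.
have iid2 := iid_normal_cylinders Q3 erefl JK iid1.
have Gm := cylinders_measurable (J := finset.set0) Q3.
have [] := eliminate s0 (dd := n.-1 - h) (g := g) Gm (leq0n h) _ Q3 iid2.
- by move=> j; exact: measurable_cst.
- move=> w j; rewrite subnKC; last by rewrite -ltnS prednK// (leq_ltn_trans _ kn).
  by rewrite ltnNge -ltnS prednK ?ltn_ord// (leq_ltn_trans _ kn).
move=> f [F1 F2 F3 F4 F5].
pose F := f ((v k')^T *m Q).
have QQ : Q *m Q^T = 1%:M by rewrite mulmx1C.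
have aF : acts_from h F by exact: (F1 point).
have [Fo Flt Fz] := aF.
have E : (fun w => M0 w *m (Q *m F)) = (fun w => M0 w *m Q *m f (g w)).
  by apply/funext => w; rewrite mulmxA.
exists (Q *m F); rewrite E; split => //.
- by rewrite trmx_mul mulmxA -(mulmxA F^T) Q1 mulmx1.
- move=> i j; rewrite ltnS leq_eqVlt mulmxA => /orP[/eqP ik|ik]; last first.
    rewrite Fz ?Q2// => l hl; rewrite Q2//.
    by case: eqP => // E1; move: hl; rewrite /= -E1 leqNgt ik.
  have -> : i = k' by exact: val_inj.
  have glt (l : 'I_n) : (l < k)%N -> ((v k')^T *m Q) 0 l = 0.
    move=> lk; have lr : (l < r)%N by exact: (ltn_trans lk kr).
    pose l' := Ordinal lr.
    have : ((v k')^T *m Q *m ((v l')^T *m Q)^T) 0 0 = 0.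
      rewrite trmx_mul mulmxA -(mulmxA _ Q) QQ mulmx1 trmxK ov.
      by rewrite !mxE -val_eqE /= gtn_eqF.
    rewrite mxE (bigD1 l)//= [X in _ + X]big1 ?addr0.
      by rewrite [((v l')^T *m Q)^T _ _]mxE Q2//= eqxx mulr1.
    by move=> m ml; rewrite [((v l')^T *m Q)^T _ _]mxE Q2//= -[_ == _]/(val l == val m)
      val_eqE eq_sym (negbTE ml) mulr0.
  have gnorm : \sum_(l < n | (h <= l)%N) ((v k')^T *m Q) 0 l ^+ 2 = 1.
    have : ((v k')^T *m Q *m ((v k')^T *m Q)^T) 0 0 = 1.
      by rewrite trmx_mul mulmxA -(mulmxA _ Q) QQ mulmx1 trmxK ov eqxx mxE.
    rewrite mxE (bigID (fun l : 'I_n => (h <= l)%N))/= [X in _ + X]big1 ?addr0.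
      by move=> <-; apply: eq_bigr => l _; rewrite [((v k')^T *m Q)^T _ _]mxE expr2.
    by move=> l; rewrite -ltnNge => lk; rewrite glt// mul0r.
  have := acts_from_norm ((v k')^T *m Q) aF; rewrite gnorm.
  rewrite (bigD1 h)//= [X in _ + X]big1 ?addr0; last first.
    move=> l /andP[hl lh]; have := F2 point l; rewrite /g -/F => -> //.
      by rewrite expr0n.
    by rewrite ltn_neqAle hl andbT eq_sym.
  have pos : 0 <= ((v k')^T *m Q *m F) 0 h.
    apply: (F3 _ point); left.
    have hn1 : (h <= n.-1)%N by rewrite -ltnS (ltn_predK kn1) ltn_ord.
    by rewrite subn_gt0 -ltnS (ltn_predK kn1) /= kn1 subnKC// -ltnS (ltn_predK kn1) leqnn.
  move=> /eqP; rewrite sqrf_eq1 => /orP[]/eqP gh; last first.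
    by move: pos; rewrite gh ler0N1.
  have [jk|kj|jk] := ltngtP j h.
  + by rewrite Flt// glt// gtn_eqF.
  + by have := F2 point j kj; rewrite /g -/F => ->; rewrite ?ltn_eqF.
  + by rewrite (_ : j = h) ?gh ?eqxx//; exact: val_inj.
- move=> D A -> mA; have DG : <<s cylinders (entries M) finset.set0 >> setT.
    by apply: sub_sigma_algebra; exact: cylinders_setT.
  have <- : region n [set: 'I_p] 0 = corner p n 0 0.
    by apply/finset.setP => ij; rewrite !inE.
  exact: (F5 setT A DG mA).
Qed.

End prepared_bases.

Section band_reduction_final.
Context d (T : measurableType d) (R : realType) (P : probability T R).
Variables (s : R) (r : nat) (e tau : R).
Hypotheses (s0 : 0 < s) (r0 : (0 < r)%N) (tauh : 0 < tau <= 4^-1).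

(** Row and column steps alternate, a column step being a row step of the transpose. After row [k]
    the column step needs [k.+1 <= k + r], which is where [0 < r] enters. *)
Lemma band_state_min (p n : nat) (M0 : T -> 'M[R]_(p, n)) :
  (forall ij, measurable_fun setT (entries M0 ij)) ->
  iid_normal P s [set setT] (corner p n 0 0) (entries M0) ->
  band_state P s r e tau M0 (minn p n) (minn p n).
Proof.
move=> mM iid; suff : forall k, (k <= minn p n)%N -> band_state P s r e tau M0 k k.
  by apply; exact: leqnn.
elim=> [_|k IH kpn].
  exists M0, set0; split => //.
  - by split; rewrite // measure0 addn0 mul0r.
  - move=> w; exists 1%:M, 1%:M; split; [exact: acts_from1|exact: acts_from1|].
    by rewrite trmx1 mul1mx mulmx1.
have [kp kn] : (k < p)%N /\ (k < n)%N by apply/andP; rewrite -leq_min.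
have st := IH (ltnW kpn).
have st1 : band_state P s r e tau M0 k.+1 k.
  by apply: band_state_row => //; rewrite leq_addr.
have st2 := band_state_tr st1.
have lk : (k.+1 <= k + r)%N by rewrite -addn1 leq_add2l.
have := band_state_tr (band_state_row s0 tauh kn lk st2).
by under eq_fun do rewrite trmxK.
Qed.

(** The prepared bases send the signal vectors to the first [r] unit vectors, and the later
    rotations, acting from [r] on, keep them there. Every entry has its row or its column index
    below [minn p n], so all entries are reduced. *)
Lemma gaussian_band_form (p n : nat) (M0 : T -> 'M[R]_(p, n))
    (u : 'I_r -> 'cV[R]_p) (v : 'I_r -> 'cV[R]_n) :
  (r < p)%N -> (r < n)%N -> orthonormal_family u -> orthonormal_family v ->
  (forall ij, measurable_fun setT (entries M0 ij)) ->
  iid_normal P s [set setT] (corner p n 0 0) (entries M0) ->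
  exists E : set T,
    [/\ measurable E,
      (P E <= ((p + n)%:R * ((p + n).+1%:R * tail_bound s e tau p n))%:E)%E &
      forall w, ~ E w -> exists Q1 : 'M[R]_p, exists Q2 : 'M[R]_n,
        [/\ Q1^T *m Q1 = 1%:M, Q2^T *m Q2 = 1%:M,
          forall (i : 'I_r) (j : 'I_p), ((u i)^T *m Q1) 0 j = (i == j :> nat)%:R,
          forall (i : 'I_r) (j : 'I_n), ((v i)^T *m Q2) 0 j = (i == j :> nat)%:R &
          forall (i : 'I_p) (j : 'I_n), let B := Q1^T *m M0 w *m Q2 in
            [/\ (i + r < j)%N || (j + r < i)%N -> B i j = 0,
                (i < j + r)%N -> (j < i + r)%N -> B i j ^+ 2 <= e + s ^+ 2,
                j = (i + r)%N :> nat -> pivot_near s e (B i j) (n - j) (j.+1 < n)%N &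
                i = (j + r)%N :> nat -> pivot_near s e (B i j) (p - i) (i.+1 < p)%N]]].
Proof.
move=> rp rn ou ov mM0 iid0.
have sn0 : s != 0 by rewrite gt_eqF.
have [Q2 [Q2o Q2v mM1 iid1]] := prepare_basis sn0 rn ov mM0 iid0.
have mM1t : forall ij, measurable_fun setT (entries (fun w => (M0 w *m Q2)^T) ij).
  move=> [i j]; have := mM1 (j, i); rewrite /entries /=.
  by under [in X in _ -> X]eq_fun do rewrite mxE.
have [Q1 [Q1o Q1u mM2t iid2t]] :=
  prepare_basis sn0 rp ou mM1t (iid_normal_tr iid1).
pose M w := Q1^T *m (M0 w *m Q2).
have ME : M = fun w => ((M0 w *m Q2)^T *m Q1)^T.
  by apply/funext => w; rewrite trmx_mul trmxK.
have mM ij : measurable_fun setT (entries M ij).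
  rewrite ME; case: ij => i j; have := mM2t (j, i); rewrite /entries /=.
  by under [in X in _ -> X]eq_fun do rewrite mxE.
have iid : iid_normal P s [set setT] (corner p n 0 0) (entries M).
  by rewrite ME; exact: iid_normal_tr.
have [B [E [[mE PE] _ BO Bz Bn]]] := band_state_min mM iid.
exists E; split => //.
  apply: le_trans PE _; rewrite lee_fin ler_wpM2r//.
    by rewrite mulr_ge0// mulr_ge0// expR_ge0.
  by rewrite ler_nat leq_add// ?geq_minl// geq_minr.
move=> w wE; have [U1 [U2 [aU1 aU2 BE]]] := BO w.
have [U1o _ U1z] := aU1; have [U2o _ U2z] := aU2.
exists (Q1 *m U1), (Q2 *m U2); split.
- by rewrite trmx_mul mulmxA -(mulmxA U1^T) Q1o mulmx1.
- by rewrite trmx_mul mulmxA -(mulmxA U2^T) Q2o mulmx1.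
- move=> i j; rewrite mulmxA U1z// => k rk; rewrite Q1u.
  by case: eqP => // ik; move: rk; rewrite -ik leqNgt ltn_ord.
- move=> i j; rewrite mulmxA U2z// => k rk; rewrite Q2v.
  by case: eqP => // ik; move: rk; rewrite -ik leqNgt ltn_ord.
move=> i j; have -> : (Q1 *m U1)^T *m M0 w *m (Q2 *m U2) = B w.
  by rewrite BE /M trmx_mul !mulmxA.
have ij : (i < minn p n)%N || (j < minn p n)%N.
  by rewrite !leq_min !ltn_ord/= andbT; case: (ltnP i n) => // ni;
     rewrite (leq_ltn_trans _ (ltn_ord i))// (leq_trans _ ni)// ltnW.
have im : (i < j)%N -> (i < minn p n)%N.
  by move=> h; rewrite leq_min ltn_ord (ltn_trans h).
have jm : (j < i)%N -> (j < minn p n)%N.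
  by move=> h; rewrite leq_min ltn_ord andbT (ltn_trans h).
have [h1 h2 h3] := Bn w wE i j.
split => [h|||]; [apply: Bz|exact: h1| |].
- case/orP: h => h; first by rewrite h im// (leq_ltn_trans _ h)// leq_addr.
  by rewrite h jm ?orbT// (leq_ltn_trans _ h)// leq_addr.
- move=> ijr; apply: h2 => //; apply: im.
  by rewrite ijr -[X in (X < _)%N]addn0 ltn_add2l.
- move=> ijr; apply: h3 => //; apply: jm.
  by rewrite ijr -[X in (X < _)%N]addn0 ltn_add2l.
Qed.

End band_reduction_final.

(** * The band form holds almost surely for all large n *)

Lemma borel_cantelli_geometric d (T : measurableType d) (R : realType)
    (P : probability T R) (E : nat -> set T) (a q : R) (n0 : nat) :
  (forall n, measurable (E n)) -> 0 <= a -> 0 < q < 1 ->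
  (forall n, (n0 <= n)%N -> (P (E n) <= (a * q ^+ n)%:E)%E) ->
  {ae P, forall w, \forall n \near \oo, ~ E n w}.
Proof.
move=> mE a0 /andP[q0 q1] PE.
pose F n := if (n0 <= n)%N then E n else set0.
have mF n : measurable (F n) by rewrite /F; case: ifPn.
have PF n : (P (F n) <= (a * q ^+ n)%:E)%E.
  rewrite /F; case: ifPn => [/PE//|_]; rewrite measure0 lee_fin.
  by rewrite mulr_ge0// exprn_ge0// ltW.
have sF : (\sum_(0 <= n <oo) P (F n) < +oo)%E.
  apply: (@le_lt_trans _ _ (a / (1 - q))%:E); last exact: ltry.
  apply: lime_le; first exact: is_cvg_nneseries.
  near=> n; apply: (@le_trans _ _ (\sum_(0 <= i < n) (a * q ^+ i)%:E)%E).
    by apply: lee_sum.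
  rewrite sumEFin lee_fin; apply: geometric_le_lim => //.
  by rewrite ger0_norm// ltW.
have L0 := lim_sup_set_cvg0 mF sF.
have mL : measurable (lim_sup_set F).
  apply: bigcap_measurable => // k _; apply: bigcup_measurable => j _.
  exact: mF.
exists (lim_sup_set F); split => // w /= wh k _; apply: contrapT => nk.
apply: wh; exists (maxn k n0) => // n /= kn En; apply: nk; exists n => /=.
  by rewrite (leq_trans _ kn)// leq_maxl.
by rewrite /F (leq_trans _ kn)// leq_maxr.
Unshelve. all: by end_near.
Qed.

Lemma gaussian_noise_iid d (T : measurableType d) (R : realType) (P : probability T R)
    (p n : nat) (G : 'I_p * 'I_n -> {RV P >-> R}) : gaussian_noise G ->
  iid_normal P (Num.sqrt n%:R^-1) [set setT] (corner p n 0 0) (entries (noise_mx G)).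
Proof.
move=> [ind law] D A -> mA.
have -> : corner p n 0 0 = [set: 'I_p * 'I_n]%SET by apply/finset.setP => ij; rewrite !inE.
rewrite setTI probability_setT mul1e.
have := ind [set: 'I_p * 'I_n]%SET A (fun i _ => mA i).
rewrite (_ : \bigcap_(i in _) _ = \bigcap_(i in [set` [set: 'I_p * 'I_n]%SET])
    entries (noise_mx G) i @^-1` A i); last first.
  apply: eq_bigcapr => -[i j] _; apply/seteqP; split => w; by rewrite /entries /= mxE.
by move=> ->; apply: eq_bigr => ij _; rewrite -(law ij (A ij) (mA ij)).
Qed.

Lemma entries_noise_measurable d (T : measurableType d) (R : realType)
    (P : probability T R) (p n : nat) (G : 'I_p * 'I_n -> {RV P >-> R}) ij :
  measurable_fun setT (entries (noise_mx G) ij).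
Proof.
case: ij => i j; rewrite /entries /=.
by under eq_fun do rewrite mxE; exact: measurable_funPT.
Qed.

(* The diagonals at distance r are chi variables divided by sqrt n; their limits 1
   and g = sqrt gamma are approached only in the first N rows and columns. *)
Definition band_near (R : realType) (r : nat) (g eps : R) (N : nat) (m n : nat)
    (B : 'M[R]_(m, n)) : Prop :=
  [/\ (N <= m)%N, (N <= n)%N & forall (i : 'I_m) (j : 'I_n),
  [/\ (i + r < j)%N || (j + r < i)%N -> B i j = 0,
      (i < j + r)%N -> (j < i + r)%N -> `|B i j| <= eps,
      j = (i + r)%N :> nat ->
        `|B i j| <= 1 + eps /\ ((i < N)%N -> `|B i j - 1| <= eps) &
      i = (j + r)%N :> nat ->
        `|B i j| <= g + eps /\ ((j < N)%N -> `|B i j - g| <= eps)]].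

Lemma ler_norm_sqr (R : realType) (x y : R) : 0 <= y -> x ^+ 2 <= y ^+ 2 -> `|x| <= y.
Proof.
by move=> y0 h; rewrite -(ler_pXn2r (ltn0Sn 1)) ?nnegrE// real_normK// num_real.
Qed.

(** Passes from squares to the numbers without a division by [g], which is 0 when gamma is 0. *)
Lemma ler_dist_sqr (R : realType) (x g : R) : 0 <= x -> 0 <= g ->
  (x - g) ^+ 2 <= `|x ^+ 2 - g ^+ 2|.
Proof.
move=> x0 g0; rewrite subr_sqr normrM -real_normK ?num_real// expr2.
rewrite ler_wpM2l// [X in _ <= X]ger0_norm ?addr_ge0//.
by rewrite ler_norml; apply/andP; split; lra.
Qed.

Lemma pivot_near_bounds (R : realType) (s e x L eps : R) (m : nat) (b : bool) :
  pivot_near s e x m b -> 0 <= L -> 0 < eps -> 4 * e <= eps ^+ 2 ->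
  m%:R * s ^+ 2 <= L ^+ 2 + e ->
  `|x| <= L + eps /\ (b -> `|m%:R * s ^+ 2 - L ^+ 2| <= e -> `|x - L| <= eps).
Proof.
move=> [xe x0] L0 eps0 ee mL; have := xe; rewrite ler_norml => /andP[_ xe1].
have eps2 : 0 <= eps ^+ 2 by exact: sqr_ge0.
split.
  apply: ler_norm_sqr; first by rewrite addr_ge0// ltW.
  apply: (@le_trans _ _ (L ^+ 2 + eps ^+ 2)); first by lra.
  by have := mulr_ge0 L0 (ltW eps0); rewrite sqrrD; lra.
move=> /x0 {}x0 mLe; apply: ler_norm_sqr; first exact: ltW.
apply: le_trans (ler_dist_sqr x0 L0) _.
have -> : x ^+ 2 - L ^+ 2 = (x ^+ 2 - m%:R * s ^+ 2) + (m%:R * s ^+ 2 - L ^+ 2) by ring.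
apply: le_trans (ler_normD _ _) _.
have e0 : 0 <= e by exact: le_trans (normr_ge0 _) xe.
lra.
Qed.

Section almost_sure_band_form.
Context (R : realType) (d : measure_display) (T : measurableType d) (P : probability T R).
Variables (r : nat) (gamma : R) (p : nat -> nat).
Variables (u : forall n, 'I_r -> 'cV[R]_(p n)) (v : forall n, 'I_r -> 'cV[R]_n).
Variable (G : forall n, 'I_(p n) * 'I_n -> {RV P >-> R}).
Hypotheses (gamma_ge0 : 0 <= gamma) (r0 : (0 < r)%N).
Hypothesis p_infty : p @ \oo --> \oo.
Hypothesis p_ratio : ((p n)%:R / n%:R : R) @[n --> \oo] --> gamma.
Hypothesis uv_orthonormal : forall n, (r <= p n)%N -> (r <= n)%N ->
       orthonormal_family (u n) /\ orthonormal_family (v n).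
Hypothesis G_gaussian : forall n, gaussian_noise (@G n).

Definition has_band_form (eps : R) (N n : nat) (w : T) : Prop :=
  exists Q1 : 'M[R]_(p n), exists Q2 : 'M[R]_n,
    [/\ Q1^T *m Q1 = 1%:M, Q2^T *m Q2 = 1%:M,
      forall (i : 'I_r) (j : 'I_(p n)), ((u n i)^T *m Q1) 0 j = (i == j :> nat)%:R,
      forall (i : 'I_r) (j : 'I_n), ((v n i)^T *m Q2) 0 j = (i == j :> nat)%:R &
      band_near r (Num.sqrt gamma) eps N (Q1^T *m noise_mx (@G n) w *m Q2)].

Let p_large (N : nat) : \forall n \near \oo, (N < p n)%N.
Proof.
have := p_infty; move=> /(_ [set k | (N < k)%N]); apply.
by exists N.+1.
Qed.

Let parameters_large (N : nat) (e : R) : 0 < e ->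
  exists n1, (0 < n1)%N /\ forall n, (n1 <= n)%N ->
    [/\ (N + r + 1 < p n)%N, (N + r + 1 < n)%N,
        `|(p n)%:R / n%:R - gamma| <= e / 2, `|(p n)%:R / n%:R - gamma| <= 1 &
        (N + r + 1)%:R / n%:R <= e / 2].
Proof.
move=> e0.
have pr x : 0 < x -> \forall n \near \oo, `|(p n)%:R / n%:R - gamma| <= x.
  move=> x0; have /cvgrPdist_le/(_ x x0) := p_ratio.
  by apply: filterS => k; rewrite distrC.
suff : \forall n \near \oo, [/\ (N + r + 1 < p n)%N, (N + r + 1 < n)%N,
        `|(p n)%:R / n%:R - gamma| <= e / 2, `|(p n)%:R / n%:R - gamma| <= 1 &
        (N + r + 1)%:R / n%:R <= e / 2].
  case=> n1 _ Hn; exists n1.+1; split => // n hn; apply: Hn => /=.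
  exact: ltnW.
near=> n; have n0 : 0 < n%:R :> R by rewrite ltr0n; near: n; exists 1%N.
split.
- by near: n; exact: p_large.
- by near: n; exists (N + r + 2)%N => // k /=; rewrite addn2 addn1.
- by near: n; apply: pr; rewrite divr_gt0.
- by near: n; exact: pr.
- rewrite ler_pdivrMr// mulrC -ler_pdivrMr ?divr_gt0//.
  by near: n; exact: nbhs_infty_ger.
Unshelve. all: by end_near.
Qed.

(** With s^2 = 1/n and p + n <= C n the tail exponent is at most 4 C n tau^2 - tau e n. The choice
    of [tau] makes the first term at most half of the second, which leaves - c n. Half of this decay
    absorbs the n^2 from the number of events; the other half is a summable geometric sequence.
    Squares of entries are controlled up to multiples of [e], so [e] is of order eps^2. *)
Lemma ae_band_form_eps (eps : R) (N : nat) : 0 < eps <= 1 ->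
  {ae P, forall w, \forall n \near \oo, has_band_form eps N n w}.
Proof.
move=> /andP[eps0 eps1].
pose e := eps ^+ 2 / 4.
have e0 : 0 < e by rewrite divr_gt0// exprn_gt0.
pose C := gamma + 2.
have C0 : 0 < C by rewrite ltr_wpDl.
pose tau := Num.min 4^-1 (e / (8 * C)).
have tau0 : 0 < tau by rewrite lt_min invr_gt0 ltr0n divr_gt0// mulr_gt0.
have tauh : 0 < tau <= 4^-1 by rewrite tau0 ge_min lexx.
have tauC : 8 * C * tau <= e.
  have : tau <= e / (8 * C) by rewrite ge_min lexx orbT.
  by rewrite ler_pdivlMr ?mulr_gt0// mulrC.
pose c := tau * e / 2.
have c0 : 0 < c by rewrite divr_gt0// mulr_gt0.
have [n1 [n1_gt0 Hn]] := parameters_large N e0.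
have HE n : exists E : set T, measurable E /\ ((n1 <= n)%N ->
   (P E <= ((p n + n)%:R * ((p n + n).+1%:R *
      tail_bound (Num.sqrt n%:R^-1) e tau (p n) n))%:E)%E /\
   forall w, ~ E w -> has_band_form eps N n w).
  have [n1n|nn1] := leqP n1 n; last by exists set0.
  have [Np Nn pe p1 Ne] := Hn n n1n.
  have n_gt0 : 0 < n%:R :> R by rewrite ltr0n (leq_trans n1_gt0).
  have rr : (r <= N + r + 1)%N by rewrite addn1 leqW// leq_addl.
  have NN : (N <= N + r + 1)%N by rewrite -addnA leq_addr.
  have rp : (r < p n)%N by exact: leq_ltn_trans Np.
  have rn : (r < n)%N by exact: leq_ltn_trans Nn.
  have [ou ov] := uv_orthonormal (ltnW rp) (ltnW rn).
  set s := Num.sqrt n%:R^-1.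
  have s_gt0 : 0 < s by rewrite sqrtr_gt0 invr_gt0.
  have s2 : s ^+ 2 = n%:R^-1 by rewrite sqr_sqrtr// invr_ge0 ltW.
  have [E [mE PE HE]] := gaussian_band_form (r := r) e s_gt0 r0 tauh rp rn ou ov
    (entries_noise_measurable (@G n)) (gaussian_noise_iid (G_gaussian n)).
  exists E; split => // _; split => // w /HE [Q1 [Q2 [h1 h2 h3 h4 h5]]].
  exists Q1, Q2; split => //; split; [exact: leq_trans (ltnW Np)|exact: leq_trans (ltnW Nn)|].
  move=> i j; have /= [z1 z2 z3 z4] := h5 i j.
  have ee : 4 * e <= eps ^+ 2 by rewrite /e mulrC divfK.
  have NrE : (N + r + 1)%:R <= e / 2 * n%:R by rewrite -ler_pdivrMr.
  have jn : (j%:R : R) <= n%:R by rewrite ler_nat ltnW.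
  have ip : (i%:R : R) <= (p n)%:R by rewrite ler_nat ltnW.
  have inv_n (x y : R) : (x * s ^+ 2 <= y) = (x <= y * n%:R).
    by rewrite s2 ler_pdivrMr.
  split => //.
  - move=> a b; apply: ler_norm_sqr; first exact: ltW.
    apply: le_trans (z2 a b) _.
    have : 1 * s ^+ 2 <= e / 2.
      by rewrite inv_n (le_trans _ NrE)// ler1n addn1.
    by rewrite mul1r; have := sqr_ge0 eps; lra.
  - move=> ji; have [] := pivot_near_bounds (L := 1) (z3 ji) ler01 eps0 ee.
      rewrite inv_n natrB; last exact: ltnW.
      have : 0 <= e * n%:R by rewrite mulr_ge0// ltW.
      have : 0 <= j%:R :> R by []; lra.
    move=> B1 B2; split => // iN; apply: B2.
      by rewrite ji -[(_ + _).+1]addn1 (leq_ltn_trans _ Nn)// !leq_add2r ltnW.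
    rewrite expr1n s2 natrB; last exact: ltnW.
    rewrite (_ : _ - 1 = - (j%:R / n%:R)); last by field; rewrite gt_eqF.
    rewrite normrN ger0_norm ?divr_ge0// ler_pdivrMr//.
    have : (j%:R : R) <= (N + r + 1)%:R.
      by rewrite ler_nat ji addn1 leqW// leq_add2r ltnW.
    have : 0 <= e * n%:R by rewrite mulr_ge0// ltW.
    by lra.
  - move=> ij; have [] := pivot_near_bounds (L := Num.sqrt gamma) (z4 ij) (sqrtr_ge0 _) eps0 ee.
      rewrite (sqr_sqrtr gamma_ge0) inv_n natrB; last exact: ltnW.
      move: pe; rewrite ler_norml => /andP[_]; rewrite lerBlDr ler_pdivrMr//.
      have : 0 <= e * n%:R by rewrite mulr_ge0// ltW.
      have : 0 <= i%:R :> R by []; lra.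
    move=> B1 B2; split => // jN; apply: B2.
      by rewrite ij -[(_ + _).+1]addn1 (leq_ltn_trans _ Np)// !leq_add2r ltnW.
    rewrite (sqr_sqrtr gamma_ge0) s2 natrB; last exact: ltnW.
    rewrite mulrBl addrAC; apply: le_trans (ler_normB _ _) _.
    rewrite [X in _ + X]ger0_norm ?divr_ge0//.
    suff : i%:R / n%:R <= e / 2 by lra.
    rewrite ler_pdivrMr//; apply: le_trans NrE.
    by rewrite ler_nat ij addn1 leqW// leq_add2r ltnW.
have [E HE'] := choice HE.
have mE n : measurable (E n) by have [] := HE' n.
have q01 : 0 < expR (- c / 2) < 1.
  by rewrite expR_gt0 /= -expR0 ltr_expR mulNr oppr_lt0 divr_gt0.
have a0 : 0 <= 2 * C * (C + 1) * (8 / c ^+ 2).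
  by rewrite !mulr_ge0 ?invr_ge0 ?sqr_ge0// ?addr_ge0// ltW.
have PE n : (n1 <= n)%N -> (P (E n) <=
    (2 * C * (C + 1) * (8 / c ^+ 2) * expR (- c / 2) ^+ n)%:E)%E.
  move=> n1n; have [_ /(_ n1n) [PEn _]] := HE' n; apply: le_trans PEn _.
  have [Np Nn pe p1 Ne] := Hn n n1n.
  have n_gt0 : 0 < n%:R :> R by rewrite ltr0n (leq_trans n1_gt0).
  have n_ge1 : 1 <= n%:R :> R by rewrite ler1n (leq_trans n1_gt0).
  have pn : (p n + n)%:R <= C * n%:R :> R.
    move: p1; rewrite ler_norml => /andP[_]; rewrite lerBlDr ler_pdivrMr// natrD /C.
    by lra.
  have pn1 : (p n + n).+1%:R <= (C + 1) * n%:R :> R.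
    by rewrite -addn1 natrD mulrDl mul1r lerD.
  rewrite lee_fin /tail_bound sqr_sqrtr; last by rewrite invr_ge0 ltW.
  rewrite invrK; set x := 4 * _ * _ - _.
  have xc : x <= - (c * n%:R).
    have h1 : 4 * (p n + n)%:R * tau ^+ 2 <= 4 * (C * n%:R) * tau ^+ 2.
      by rewrite ler_wpM2r ?sqr_ge0// ler_pM2l.
    have h2 : 8 * C * tau * (tau * n%:R) <= e * (tau * n%:R).
      by rewrite ler_wpM2r// mulr_ge0// ltW.
    rewrite /x /c; move: h1 h2; rewrite expr2; nra.
  have ex : expR x <= expR (- c / 2) ^+ n * expR (- c / 2) ^+ n.
    by rewrite -!expRM_natl -expRD ler_expR; lra.
  (* From exp y >= 1 + y^2 / 2 at y = c n / 2. *)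
  have nn : n%:R ^+ 2 * expR (- c / 2) ^+ n <= 8 / c ^+ 2.
    rewrite -expRM_natl.
    have -> : n%:R * (- c / 2) = - (c * n%:R / 2) by field.
    have cn0 : 0 <= c * n%:R / 2 by rewrite divr_ge0// mulr_ge0// ltW.
    have h := expR_ge1Dxn 1 cn0; rewrite expRN ler_pdivrMr ?expR_gt0//.
    rewrite [8 / _ * _]mulrAC ler_pdivlMr ?exprn_gt0//.
    have f2 : (2`!%:R : R) = 2 by [].
    rewrite f2 in h; have : 0 <= 8 * expR (c * n%:R / 2) - 8 - (c * n%:R) ^+ 2.
      have : (c * n%:R / 2) ^+ 2 = (c * n%:R) ^+ 2 / 4 by rewrite expr_div_n; field.
      by lra.
    by rewrite exprMn; lra.
  have exp0 : 0 <= expR (- c / 2) ^+ n by rewrite exprn_ge0// expR_ge0.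
  apply: (@le_trans _ _ ((C * n%:R) * (((C + 1) * n%:R) *
     (2 * (expR (- c / 2) ^+ n * expR (- c / 2) ^+ n))))).
    have t1 : 0 <= 2 * expR x by rewrite mulr_ge0// expR_ge0.
    have t2 : 0 <= (p n + n).+1%:R * (2 * expR x) by exact: mulr_ge0.
    apply: (ler_pM _ t2 pn) => //.
    by apply: ler_pM => //; rewrite ler_pM2l.
  rewrite (_ : _ * _ = 2 * C * (C + 1) *
     (n%:R ^+ 2 * expR (- c / 2) ^+ n) * expR (- c / 2) ^+ n); last by ring.
  rewrite ler_wpM2r// ler_wpM2l// !mulr_ge0// ?addr_ge0// ltW.
have [A [mA PA AE]] := borel_cantelli_geometric mE a0 q01 PE.
exists A; split => // w /= wh; apply: AE => /= nE; apply: wh.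
near=> n; have [_ [|_]] := HE' n; first by near: n; exists n1.
by apply; near: n; exact: nE.
Unshelve. all: by end_near.
Qed.

End almost_sure_band_form.

(** * Singular values of spiked band matrices *)

Section vectors.
Context (R : realType).

Definition dot (n : nat) (x y : 'cV[R]_n) : R := \sum_(i < n) x i 0 * y i 0.

Lemma dotE n (x y : 'cV[R]_n) : dot x y = (x^T *m y) 0 0.
Proof. by rewrite mxE; apply: eq_bigr => i _; rewrite mxE. Qed.

Lemma dotC n (x y : 'cV[R]_n) : dot x y = dot y x.
Proof. by apply: eq_bigr => i _; rewrite mulrC. Qed.

Lemma dotDl n (x y z : 'cV[R]_n) : dot (x + y) z = dot x z + dot y z.
Proof. by rewrite /dot -big_split; apply: eq_bigr => i _; rewrite mxE mulrDl. Qed.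

Lemma dotZl n a (x y : 'cV[R]_n) : dot (a *: x) y = a * dot x y.
Proof. by rewrite /dot mulr_sumr; apply: eq_bigr => i _; rewrite mxE mulrA. Qed.

Lemma dotDr n (x y z : 'cV[R]_n) : dot x (y + z) = dot x y + dot x z.
Proof. by rewrite dotC dotDl !(dotC x). Qed.

Lemma dotZr n a (x y : 'cV[R]_n) : dot x (a *: y) = a * dot x y.
Proof. by rewrite dotC dotZl dotC. Qed.

Lemma dotNl n (x y : 'cV[R]_n) : dot (- x) y = - dot x y.
Proof. by rewrite -scaleN1r dotZl mulN1r. Qed.

Lemma dotNr n (x y : 'cV[R]_n) : dot x (- y) = - dot x y.
Proof. by rewrite dotC dotNl dotC. Qed.

Lemma dot_suml n (I : Type) (q : seq I) (x : I -> 'cV[R]_n) y :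
  dot (\sum_(i <- q) x i) y = \sum_(i <- q) dot (x i) y.
Proof.
elim: q => [|i q IH]; last by rewrite !big_cons dotDl IH.
by rewrite !big_nil /dot big1// => i _; rewrite mxE mul0r.
Qed.

Lemma dot_sumr n (I : Type) (q : seq I) (x : I -> 'cV[R]_n) y :
  dot y (\sum_(i <- q) x i) = \sum_(i <- q) dot y (x i).
Proof. by rewrite dotC dot_suml; apply: eq_bigr => i _; rewrite dotC. Qed.

Lemma dot_tr m n (A : 'M[R]_(m, n)) x y : dot x (A *m y) = dot (A^T *m x) y.
Proof. by rewrite !dotE trmx_mul trmxK mulmxA. Qed.

Lemma dot_ge0 n (x : 'cV[R]_n) : 0 <= dot x x.
Proof. by apply: sumr_ge0 => i _; rewrite -expr2 sqr_ge0. Qed.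

Lemma dot_eq0 n (x : 'cV[R]_n) : dot x x = 0 -> x = 0.
Proof.
move=> /eqP; rewrite psumr_eq0; last by move=> i _; rewrite -expr2 sqr_ge0.
move=> /allP h; apply/matrixP => i j; rewrite (ord1 j) mxE; apply/eqP.
by have := h i (mem_index_enum _); rewrite -expr2 sqrf_eq0.
Qed.

Lemma sqr_coord_le_dot n (x : 'cV[R]_n) i : x i 0 ^+ 2 <= dot x x.
Proof.
rewrite /dot (bigD1 i)//= -expr2 lerDl; apply: sumr_ge0 => j _.
by rewrite -expr2 sqr_ge0.
Qed.

Lemma cauchy_schwarz n (x y : 'cV[R]_n) : dot x y ^+ 2 <= dot x x * dot y y.
Proof.
have [y0|y0] := eqVneq (dot y y) 0.
  by rewrite y0 mulr0 (dot_eq0 y0) dotE mulmx0 mxE expr0n.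
have yp : 0 < dot y y by rewrite lt_neqAle eq_sym y0 dot_ge0.
have := dot_ge0 (dot y y *: x - dot x y *: y).
rewrite dotDl !dotDr !dotNl !dotNr !dotZl !dotZr (dotC y x) => h.
have {}h : 0 <= dot y y * (dot x x * dot y y - dot x y ^+ 2) by rewrite expr2; lra.
by rewrite -subr_ge0; rewrite pmulr_rge0 in h.
Qed.

Lemma dot_col m n k (A : 'M[R]_(m, n)) (B : 'M[R]_(m, k)) i j :
  dot (col i A) (col j B) = (A^T *m B) i j.
Proof. by rewrite mxE; apply: eq_bigr => l _; rewrite !mxE. Qed.

Lemma l2normE n (x : 'cV[R]_n) : l2norm x = Num.sqrt (dot x x).
Proof. by congr Num.sqrt; apply: eq_bigr => i _; rewrite expr2. Qed.

Lemma dot_orthogonal n (Q : 'M[R]_n) x y : Q^T *m Q = 1%:M ->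
  dot (Q *m x) (Q *m y) = dot x y.
Proof. by move=> QQ; rewrite dot_tr mulmxA QQ mul1mx. Qed.

End vectors.

Section banded.
Context (R : realType) (r : nat) (t : nat -> R) (g : R).
Hypothesis (r0 : (0 < r)%N) (g0 : 0 <= g).
Hypothesis t_ge_r : forall i, (r <= i)%N -> t i = 0.

Definition spiked m n (B : 'M[R]_(m, n)) : 'M[R]_(m, n) :=
  \matrix_(i, j) (t i *+ (i == j :> nat)) + B.

(** Plays the role of a filter on band matrices of all sizes at once, so that limits are taken
    without sequences or randomness. *)
Definition eventually_banded (Q : forall m n, 'M[R]_(m, n) -> Prop) : Prop :=
  exists eps N, 0 < eps /\ forall m n (B : 'M[R]_(m, n)), band_near r g eps N B -> Q m n B.

Lemma band_near_le eps eps' N N' m n (B : 'M[R]_(m, n)) : eps <= eps' -> (N' <= N)%N ->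
  band_near r g eps N B -> band_near r g eps' N' B.
Proof.
move=> ee NN [h1 h2 h3]; split; [exact: leq_trans h1|exact: leq_trans h2|].
move=> i j; have [z1 z2 z3 z4] := h3 i j; split => //.
- by move=> a b; exact: le_trans (z2 a b) _.
- move=> /z3 [z5 z6]; split; first by rewrite (le_trans z5)// lerD2l.
  by move=> iN; rewrite (le_trans (z6 (leq_trans iN NN))).
- move=> /z4 [z5 z6]; split; first by rewrite (le_trans z5)// lerD2l.
  by move=> iN; rewrite (le_trans (z6 (leq_trans iN NN))).
Qed.

Lemma eventually_banded_and (Q1 Q2 : forall m n, 'M[R]_(m, n) -> Prop) :
  eventually_banded Q1 -> eventually_banded Q2 ->
  eventually_banded (fun m n B => Q1 m n B /\ Q2 m n B).
Proof.
move=> [e1 [N1 [e10 h1]]] [e2 [N2 [e20 h2]]].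
exists (Num.min e1 e2), (maxn N1 N2); split; first by rewrite lt_min e10 e20.
move=> m n B hB; split; [apply: h1|apply: h2]; apply: band_near_le hB.
- by rewrite ge_min lexx.
- exact: leq_maxl.
- by rewrite ge_min lexx orbT.
- exact: leq_maxr.
Qed.

Lemma eventually_banded_imp (Q1 Q2 : forall m n, 'M[R]_(m, n) -> Prop) :
  (forall m n B, Q1 m n B -> Q2 m n B) -> eventually_banded Q1 -> eventually_banded Q2.
Proof. by move=> h [e [N [e0 h1]]]; exists e, N; split => // m n B /h1 /h. Qed.

Lemma eventually_banded_forall (K : nat) (Q : nat -> forall m n, 'M[R]_(m, n) -> Prop) :
  (forall k, (k < K)%N -> eventually_banded (Q k)) ->
  eventually_banded (fun m n B => forall k, (k < K)%N -> Q k m n B).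
Proof.
elim: K => [_|K IH h]; first by exists 1, 0%N; split.
have h1 := IH (fun k kK => h k (ltnW kK)); have h2 := h K (ltnSn K).
apply: eventually_banded_imp (eventually_banded_and h1 h2) => m n B [q1 q2] k.
by rewrite ltnS leq_eqVlt => /orP[/eqP->|/q1].
Qed.

Lemma eventually_band_near eps N : 0 < eps ->
  eventually_banded (fun m n B => band_near r g eps N B).
Proof. by move=> e0; exists eps, N; split. Qed.

Definition model (i j : nat) : R :=
  t i *+ (i == j) + (j == (i + r)%N)%:R + g *+ (i == (j + r)%N).

Lemma spiked_near_model eps N m n (B : 'M[R]_(m, n)) (i : 'I_m) (j : 'I_n) : 0 <= eps ->
  band_near r g eps N B -> (i < N)%N -> (j < N)%N -> `|spiked B i j - model i j| <= eps.
Proof.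
move=> e0 [_ _ /(_ i j) [z1 z2 z3 z4]] iN jN; rewrite !mxE /model.
rewrite (_ : _ - _ = B i j - ((j == (i + r)%N :> nat)%:R + g *+ (i == (j + r)%N :> nat))); last first.
  by move: (t i *+ _) (_%:R) (g *+ _) => a b c; ring.
have [ij|ij] := eqVneq (j : nat) (i + r)%N.
  have -> : (i == (j + r)%N :> nat) = false.
    by apply/negbTE; rewrite ij -addnA -[X in X == _]addn0 eqn_add2l neq_ltn addn_gt0 r0.
  by rewrite addr0; have [_] := z3 ij; apply.
have [ji|ji] := eqVneq (i : nat) (j + r)%N.
  by rewrite add0r; have [_] := z4 ji; apply.
rewrite addr0 subr0; have [h|h] := boolP ((i + r < j)%N || (j + r < i)%N).
  by rewrite z1// normr0.
move: h; rewrite negb_or -!leqNgt => /andP[h1 h2]; apply: z2.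
  by rewrite ltn_neqAle ji.
by rewrite ltn_neqAle ij.
Qed.

End banded.

Section schur.
Context (R : realType).

Lemma weighted_amgm (a b c x y : R) : 0 <= a -> 0 <= b -> c ^+ 2 <= a * b ->
  c * `|x * y| <= (a * x ^+ 2 + b * y ^+ 2) / 2.
Proof.
move=> a0 b0 cab.
have h0 : 0 <= (a * x ^+ 2 + b * y ^+ 2) / 2.
  by rewrite divr_ge0// addr_ge0// mulr_ge0// sqr_ge0.
apply: le_trans (ler_norm _) _; apply: ler_norm_sqr => //.
rewrite exprMn real_normK ?num_real//.
have h1 : c ^+ 2 * (x * y) ^+ 2 <= a * b * (x * y) ^+ 2 by rewrite ler_wpM2r// sqr_ge0.
have := sqr_ge0 (a * x ^+ 2 - b * y ^+ 2); move: h1; rewrite exprMn; lra.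
Qed.

Lemma sum_at_most_one n (P : pred 'I_n) :
  (forall i j, P i -> P j -> i = j) -> \sum_j (P j)%:R <= 1 :> R.
Proof.
move=> Pu; have [i Pi|P0] := pickP P; last by rewrite big1// => i _; rewrite P0.
rewrite (bigD1 i)//= Pi big1 ?addr0// => j ji.
by case: (boolP (P j)) => // Pj; move: ji; rewrite (Pu j i)// eqxx.
Qed.

Lemma sum_band n (r i : nat) :
  \sum_(j < n) ((i < j + r)%N && (j < i + r)%N)%:R <= (2 * r)%:R :> R.
Proof.
apply: (@le_trans _ _ (\sum_(j < n) \sum_(l < 2 * r) (j + r == i + l)%N%:R)).
  apply: ler_sum => j _; case: (boolP (_ && _)) => [/andP[h1 h2]|_]; last first.
    by apply: sumr_ge0 => l _.
  have lr : (j + r - i < 2 * r)%N.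
    by rewrite ltn_subLR ?(ltnW h1)// mul2n -addnn addnA ltn_add2r.
  rewrite (bigD1 (Ordinal lr))//= subnKC ?(ltnW h1)// eqxx lerDl.
  exact: sumr_ge0.
rewrite exchange_big /=; apply: (@le_trans _ _ (\sum_(l < 2 * r) 1)).
  apply: ler_sum => l _; apply: (sum_at_most_one (P := fun j : 'I_n => (j + r == i + l)%N)).
  move=> j j' /eqP <- /eqP /esym /eqP.
  by rewrite eqn_add2r => /eqP h; apply: val_inj.
by rewrite sumr_const card_ord.
Qed.

Lemma weighted_form m n (Y : 'M[R]_(m, n)) (x : 'cV[R]_m) (y : 'cV[R]_n)
    (a b : 'I_m -> 'I_n -> R) (A : R) :
  (forall i j, x i 0 * Y i j * y j 0 <= (a i j * x i 0 ^+ 2 + b i j * y j 0 ^+ 2) / 2) ->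
  (forall i, \sum_j a i j <= A) -> (forall j, \sum_i b i j <= A) ->
  dot x (Y *m y) <= A / 2 * (dot x x + dot y y).
Proof.
move=> h ha hb.
have -> : dot x (Y *m y) = \sum_i \sum_j x i 0 * Y i j * y j 0.
  by apply: eq_bigr => i _; rewrite mxE mulr_sumr; apply: eq_bigr => j _; rewrite mulrA.
apply: (@le_trans _ _ (\sum_i \sum_j (a i j * x i 0 ^+ 2 + b i j * y j 0 ^+ 2) / 2)).
  by apply: ler_sum => i _; apply: ler_sum => j _.
under eq_bigr do rewrite -mulr_suml; rewrite -mulr_suml mulrAC ler_pM2r ?invr_gt0//.
under eq_bigr do rewrite big_split/=.
rewrite big_split/= mulrDr; apply: lerD.
  rewrite mulr_sumr; apply: ler_sum => i _; rewrite -mulr_suml -expr2.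
  by rewrite ler_wpM2r// sqr_ge0.
rewrite exchange_big/= mulr_sumr; apply: ler_sum => i _; rewrite -mulr_suml -expr2.
by rewrite ler_wpM2r// sqr_ge0.
Qed.

Variables (r : nat) (t : nat -> R) (g : R).
Hypothesis (r0 : (0 < r)%N) (g0 : 0 <= g).
Hypothesis t_ge_r : forall i, (r <= i)%N -> t i = 0.

(* Schur test: with the weights [kap] and [tau] every row and every column of the
   limiting band matrix has total weight at most [sig]. *)
Lemma schur_bound (eps : R) (N m n : nat) (B : 'M[R]_(m, n)) (kap tau sig : R)
    (x : 'cV[R]_m) (y : 'cV[R]_n) :
  band_near r g eps N B -> 0 <= eps -> 0 < kap -> 0 < tau ->
  kap * (1 + tau ^+ 2) <= sig -> (1 + g ^+ 2 / tau ^+ 2) / kap <= sig ->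
  (forall (i : 'I_m) (j : 'I_n), i = j :> nat -> t i * (x i 0 * y j 0) <= tau * `|x i 0 * y j 0|) ->
  dot x (spiked t B *m y) <= (sig / 2 + (r.+1)%:R * eps) * (dot x x + dot y y).
Proof.
move=> [_ _ hB] e0 kap0 tau0 hs1 hs2 ht.
(* A spike sits in a row [i < r] and the lower band in rows [i >= r], so in each row the two share a
   single weight. In the same way the spike and the upper band share the weight of a column ([d1]).
   The errors of size [eps] meet at most [2 + 2 r] entries in a row or column. *)
pose c1 (i : 'I_m) (j : 'I_n) := ((i == j :> nat) && (i < r)%N) || (i == (j + r)%N :> nat).
pose c2 (i : 'I_m) (j : 'I_n) := (j == (i + r)%N :> nat).
pose d1 (i : 'I_m) (j : 'I_n) := ((i == j :> nat) && (i < r)%N) || (j == (i + r)%N :> nat).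
pose d2 (i : 'I_m) (j : 'I_n) := (i == (j + r)%N :> nat).
pose bd (i : 'I_m) (j : 'I_n) := ((i < j + r)%N && (j < i + r)%N).
pose E i j : R := (c2 i j)%:R + (d2 i j)%:R + (bd i j)%:R.
pose a i j := kap * tau ^+ 2 * (c1 i j)%:R + kap * (c2 i j)%:R + eps * E i j.
pose b i j := kap^-1 * (d1 i j)%:R + g ^+ 2 / (kap * tau ^+ 2) * (d2 i j)%:R + eps * E i j.
have kn : kap != 0 by rewrite gt_eqF.
have tn : tau != 0 by rewrite gt_eqF.
have t20 : 0 < tau ^+ 2 by rewrite exprn_gt0.
have k_ge0 : 0 <= kap by exact: ltW.
have ik_ge0 : 0 <= kap^-1 by rewrite invr_ge0.
have kt_ge0 : 0 <= kap * tau ^+ 2 by rewrite mulr_ge0// ltW.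
have gk_ge0 : 0 <= g ^+ 2 / (kap * tau ^+ 2) by rewrite divr_ge0// sqr_ge0.
have uc2 i j j' : c2 i j -> c2 i j' -> j = j'.
  by move=> /eqP h1 /eqP h2; apply: val_inj; rewrite /= h1 h2.
have ud2 i i' j : d2 i j -> d2 i' j -> i = i'.
  by move=> /eqP h1 /eqP h2; apply: val_inj; rewrite /= h1 h2.
have uc2' i i' j : c2 i j -> c2 i' j -> i = i'.
  by move=> /eqP h1 /eqP h2; apply: val_inj; apply: (@addIn r); rewrite /= -h1 -h2.
have ud2' i j j' : d2 i j -> d2 i j' -> j = j'.
  by move=> /eqP h1 /eqP h2; apply: val_inj; apply: (@addIn r); rewrite /= -h1 -h2.
have nbd (k l : nat) : (k < r)%N -> k = (l + r)%N -> False.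
  by move=> kr kl; move: kr; rewrite kl ltnNge leq_addl.
have uc1 i j j' : c1 i j -> c1 i j' -> j = j'.
  case/orP => [/andP[/eqP h1 ir]|/eqP h1]; case/orP => [/andP[/eqP h2 ir']|/eqP h2].
  - by apply: val_inj; rewrite /= -h1 -h2.
  - by case: (nbd _ _ ir h2).
  - by case: (nbd _ _ ir' h1).
  - by apply: (ud2' i); apply/eqP.
have ud1 i i' j : d1 i j -> d1 i' j -> i = i'.
  case/orP => [/andP[/eqP h1 ir]|/eqP h1]; case/orP => [/andP[/eqP h2 ir']|/eqP h2].
  - by apply: val_inj; rewrite /= h1 h2.
  - by rewrite h1 in ir; case: (nbd _ _ ir h2).
  - by rewrite h2 in ir'; case: (nbd _ _ ir' h1).
  - by apply: (uc2' _ _ j); apply/eqP.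
have Ea i : \sum_j E i j <= 2 + (2 * r)%:R.
  rewrite !big_split/=; apply: lerD; last exact: sum_band.
  rewrite (_ : 2 = 1 + 1) //; apply: lerD; apply: sum_at_most_one => j j'; [exact: uc2|exact: ud2'].
have Eb j : \sum_i E i j <= 2 + (2 * r)%:R.
  rewrite !big_split/=; apply: lerD.
    rewrite (_ : 2 = 1 + 1) //; apply: lerD; apply: sum_at_most_one => i i'; [exact: uc2'|exact: ud2].
  apply: le_trans (sum_band m r j); apply: ler_sum => i _.
  by rewrite /bd andbC.
have -> : (sig / 2 + r.+1%:R * eps) = (sig + eps * (2 + (2 * r)%:R)) / 2.
  by rewrite natrM -addn1 natrD; field.
apply: (weighted_form (a := a) (b := b)); last 2 first.
- move=> i; rewrite !big_split/= -!mulr_sumr; apply: lerD; last first.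
    by rewrite ler_wpM2l.
  apply: le_trans hs1; rewrite mulrDr mulr1 addrC; apply: lerD.
    by rewrite -[leRHS]mulr1 ler_wpM2l//; apply: sum_at_most_one => j j'; exact: uc2.
  rewrite -[leRHS]mulr1 ler_wpM2l//.
  by apply: sum_at_most_one => j j'; exact: uc1.
- move=> j; rewrite !big_split/= -!mulr_sumr; apply: lerD; last first.
    by rewrite ler_wpM2l.
  apply: le_trans hs2; rewrite mulrDl div1r; apply: lerD.
    rewrite -[leRHS]mulr1 ler_wpM2l//.
    by apply: sum_at_most_one => i i'; exact: ud1.
  rewrite (_ : g ^+ 2 / tau ^+ 2 / kap = g ^+ 2 / (kap * tau ^+ 2)); last by field; rewrite kn tn.
  rewrite -[leRHS]mulr1 ler_wpM2l//.
  by apply: sum_at_most_one => i i'; exact: ud2.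
move=> i j; have [z1 z2 z3 z4] := hB i j.
set X := x i 0; set W := y j 0.
have XW0 : 0 <= `|X * W| by exact: normr_ge0.
have epsXW : eps * `|X * W| <= (eps * X ^+ 2 + eps * W ^+ 2) / 2.
  by apply: weighted_amgm => //; rewrite expr2.
have Bterm c : `|B i j| <= c -> X * B i j * W <= c * `|X * W|.
  move=> Bc; apply: le_trans (ler_norm _) _; rewrite mulrAC mulrC normrM.
  by rewrite ler_wpM2r.
rewrite !mxE.
have [ij|ij] := eqVneq (j : nat) (i + r)%N.
  have ijn : (i == j :> nat) = false.
    by apply/negbTE; rewrite neq_ltn ij -[X in (X < _)%N]addn0 ltn_add2l r0.
  have d2F : d2 i j = false.
    by apply/negbTE; rewrite /d2 ij neq_ltn -addnA -[X in (X < _)%N]addn0 ltn_add2l addn_gt0 r0.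
  rewrite /a /b /E /c1 /d1 /c2 ijn -[(i == (j + r)%N :> nat)]/(d2 i j) d2F ij eqxx /=.
  have -> : bd i j = false by rewrite /bd ij ltnn andbF.
  have [/Bterm h _] := z3 ij; rewrite mulr0n add0r.
  have h2 : 1 * `|X * W| <= (kap * X ^+ 2 + kap^-1 * W ^+ 2) / 2.
    by apply: weighted_amgm => //; rewrite expr1n mulfV.
  rewrite !mulr0 !addr0 !mulr1 ?add0r; lra.
have [ji|ji] := eqVneq (i : nat) (j + r)%N.
  have ijn : (i == j :> nat) = false.
    by rewrite ji gtn_eqF// -[X in (X < _)%N]addn0 ltn_add2l.
  rewrite /a /b /E /c1 /d1 /c2 /d2 ijn (negbTE ij) ji eqxx /=.
  have -> : bd i j = false by rewrite /bd ji ltnn.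
  have [/Bterm h _] := z4 ji; rewrite mulr0n add0r.
  have h2 : g * `|X * W| <= (kap * tau ^+ 2 * X ^+ 2 + g ^+ 2 / (kap * tau ^+ 2) * W ^+ 2) / 2.
    apply: weighted_amgm => //.
    by rewrite le_eqVlt; apply/orP; left; apply/eqP; field; rewrite kn tn.
  rewrite !mulr0 !addr0 !mulr1 ?add0r; lra.
rewrite /a /b /E /c1 /d1 /c2 /d2 (negbTE ij) (negbTE ji) !orbF.
have [eij|nij] := eqVneq (i : nat) j.
  have -> : bd i j by rewrite /bd eij -[X in (X < _)%N]addn0 ltn_add2l r0.
  have Be : `|B i j| <= eps by apply: z2; rewrite eij -[X in (X < _)%N]addn0 ltn_add2l r0.
  have h := Bterm _ Be.
  have h1 := ht i j eij; rewrite -/X -/W in h1.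
  have [ir|ir] := ltnP i r.
    have h2 : tau * `|X * W| <= (kap * tau ^+ 2 * X ^+ 2 + kap^-1 * W ^+ 2) / 2.
      apply: weighted_amgm => //.
      by rewrite le_eqVlt; apply/orP; left; apply/eqP; field.
    rewrite mulr1n /= !mulr0 !addr0 !mulr1 ?add0r; lra.
  by rewrite t_ge_r//= mulr1n !mulr0 ?addr0 ?add0r ?mulr1; lra.
have [/z1 ->|] := boolP ((i + r < j)%N || (j + r < i)%N).
  rewrite mulr0n add0r mulr0 mul0r /=; apply: divr_ge0 => //.
  by apply: addr_ge0; apply: mulr_ge0; rewrite ?sqr_ge0// !mulr0 ?addr0 ?add0r mulr_ge0.
rewrite negb_or -!leqNgt => /andP[le1 le2].
have b1 : (i < j + r)%N by rewrite ltn_neqAle ji.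
have b2 : (j < i + r)%N by rewrite ltn_neqAle ij.
have h := Bterm _ (z2 b1 b2).
by rewrite mulr0n add0r /bd b1 b2 /= !mulr0 ?addr0 ?add0r ?mulr1; lra.
Qed.

(** The test vector x = A y / a turns the bound on the bilinear form into a bound on the norm. *)
Lemma schur_norm_bound m n
   (A : 'M[R]_(m, n)) (a : R) (y : 'cV[R]_n) : 0 < a ->
  (forall x : 'cV[R]_m, dot x (A *m y) <= a / 2 * (dot x x + dot y y)) ->
  dot (A *m y) (A *m y) <= a ^+ 2 * dot y y.
Proof.
move=> a0 h; have := h (a^-1 *: (A *m y)).
rewrite !dotZl !dotZr => {}h; set Z := dot (A *m y) (A *m y) in h *.
have : a * (2 * a) * (a^-1 * Z) <= a * (2 * a) * (a / 2 * (a^-1 * (a^-1 * Z) + dot y y)).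
  by rewrite ler_wpM2l// !mulr_ge0// ltW.
have -> : a * (2 * a) * (a^-1 * Z) = 2 * a * Z by field; rewrite gt_eqF.
have -> : a * (2 * a) * (a / 2 * (a^-1 * (a^-1 * Z) + dot y y)) =
   a * Z + a * (a ^+ 2 * dot y y) by field; rewrite gt_eqF.
move=> h2; have : a * Z <= a * (a ^+ 2 * dot y y) by lra.
by rewrite ler_pM2l.
Qed.

End schur.

Section nat_coordinates.
Context (R : realType).

(** Extension by 0 to all natural indices, so that coordinates of vectors of different lengths can
    be compared. *)
Definition ext n (x : 'cV[R]_n) (i : nat) : R :=
  if insub i is Some k then x k 0 else 0.

Lemma ext_ord n (x : 'cV[R]_n) (i : 'I_n) : ext x i = x i 0.
Proof. by rewrite /ext valK. Qed.

Lemma ext_out n (x : 'cV[R]_n) i : (n <= i)%N -> ext x i = 0.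
Proof. by move=> ni; rewrite /ext insubN// -leqNgt. Qed.

Lemma dot_ext n M (x y : 'cV[R]_n) : (n <= M)%N ->
  dot x y = \sum_(0 <= i < M) ext x i * ext y i.
Proof.
move=> nM; rewrite (big_cat_nat (leq0n n) nM)/= [X in _ = _ + X]big_nat_cond.
rewrite [X in _ = _ + X]big1 ?addr0; last first.
  by move=> i /andP[/andP[ni _] _]; rewrite ext_out// mul0r.
by rewrite big_mkord; apply: eq_bigr => i _; rewrite !ext_ord.
Qed.

Lemma extD n (x y : 'cV[R]_n) i : ext (x + y) i = ext x i + ext y i.
Proof.
have [ni|ni] := leqP n i; first by rewrite !ext_out// addr0.
by rewrite -[i]/(val (Ordinal ni)) !ext_ord mxE.
Qed.

Lemma extZ n a (x : 'cV[R]_n) i : ext (a *: x) i = a * ext x i.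
Proof.
have [ni|ni] := leqP n i; first by rewrite !ext_out// mulr0.
by rewrite -[i]/(val (Ordinal ni)) !ext_ord mxE.
Qed.

Lemma extN n (x : 'cV[R]_n) i : ext (- x) i = - ext x i.
Proof. by rewrite -scaleN1r extZ mulN1r. Qed.

Lemma sqr_ext_le_dot n (x : 'cV[R]_n) i : ext x i ^+ 2 <= dot x x.
Proof.
have [ni|ni] := leqP n i; first by rewrite ext_out// expr0n dot_ge0.
by rewrite -[i]/(val (Ordinal ni)) ext_ord; exact: sqr_coord_le_dot.
Qed.

(** There are [k] equations for the first [k + 1] coordinates, the others being set to 0. *)
Lemma kernel_vector (k n : nat) (A : 'M[R]_(k, n)) : (k < n)%N ->
  exists P : 'cV[R]_n, [/\ P != 0, forall j : 'I_n, (k < j)%N -> P j 0 = 0 & A *m P = 0].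
Proof.
move=> kn; pose w (i : 'I_k.+1) : 'I_n := widen_ord kn i.
pose A' : 'M[R]_(k, k.+1) := \matrix_(i, j) A i (w j).
have : kermx A'^T != 0.
  rewrite -mxrank_eq0 mxrank_ker mxrank_tr subn_eq0 -ltnNge ltnS.
  exact: rank_leq_row.
case/rowV0Pn => u uker u0.
have uA : u *m A'^T = 0 by apply/eqP; rewrite -sub_kermx.
pose P : 'cV[R]_n := \col_j (if insub (val j) is Some l then u 0 l else 0).
have Pw l : P (w l) 0 = u 0 l by rewrite mxE /= valK.
have Pz (j : 'I_n) : (k < j)%N -> P j 0 = 0.
  by move=> kj; rewrite mxE insubN// -leqNgt.
exists P; split => //.
  apply: contraNneq u0 => P0; apply/eqP/rowP => l.
  by rewrite -Pw P0 !mxE.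
apply/matrixP => i z; rewrite (ord1 z) {z}.
have uAi : \sum_j u 0 j * A i (w j) = 0.
  transitivity ((u *m A'^T) 0 i); last by rewrite uA mxE.
  by rewrite [RHS]mxE; apply: eq_bigr => j _; rewrite !mxE.
rewrite mxE [RHS]mxE -[RHS]uAi (bigID (fun j : 'I_n => (j < k.+1)%N))/=.
rewrite [X in _ + X]big1 ?addr0; last first.
  by move=> j; rewrite -leqNgt => kj; rewrite Pz// mulr0.
rewrite (reindex_onto w (fun j => inord (val j)))/=; last first.
  by move=> j jk; apply: val_inj; rewrite /= inordK.
apply: eq_big => l; first by rewrite ltn_ord; apply/eqP/val_inj; rewrite /= inordK.
by move=> _; rewrite Pw mulrC.
Qed.

End nat_coordinates.

Section singular_values.
Context (R : realType) (m n : nat) (Y : 'M[R]_(m, n)) (U : 'M[R]_m) (s : nat -> R) (V : 'M[R]_n).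
Hypothesis svd : is_svd Y U s V.

(** From [minn m n] on, [Y] does not determine [s]; with the value 0 there, the rectangular diagonal
    factor multiplies coordinate [i] by [sv i] for every [i]. *)
Definition sv (i : nat) : R := if (i < minn m n)%N then s i else 0.

Let S : 'M[R]_(m, n) := \matrix_(i < m, j < n) (s i *+ (i == j :> nat)).

Lemma sv_ge0 i : 0 <= sv i.
Proof. by rewrite /sv; case: ifP => // _; have [_ _ ->] := svd. Qed.

Lemma sv_le i j : (i <= j)%N -> sv j <= sv i.
Proof.
move=> ij; have [_ _ s0 sle _] := svd; rewrite /sv; case: (ltnP j _) => h.
  by rewrite (leq_ltn_trans ij h) sle.
by case: ifP.
Qed.

Lemma ext_singular (P : 'cV[R]_n) i : ext (S *m P) i = sv i * ext P i.
Proof.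
have [mi|im] := leqP m i.
  by rewrite ext_out// /sv ltn_min ltnNge mi mul0r.
rewrite -[i in LHS]/(val (Ordinal im)) ext_ord mxE /sv ltn_min im /=.
have [ni|ni] := leqP n i.
  rewrite mul0r big1// => j _; rewrite mxE /= gtn_eqF ?mul0r//.
  exact: leq_trans (ltn_ord j) ni.
rewrite -[i in ext _ i]/(val (Ordinal ni)) ext_ord (bigD1 (Ordinal ni))//= mxE eqxx mulr1n.
rewrite big1 ?addr0// => j; rewrite mxE -val_eqE /= => ji.
by rewrite eq_sym (negbTE ji) mulr0n mul0r.
Qed.

Lemma ext_singular_tr (Q : 'cV[R]_m) i : ext (S^T *m Q) i = sv i * ext Q i.
Proof.
have [ni|ni] := leqP n i.
  by rewrite ext_out// /sv ltn_min (ltnNge i n) ni andbF mul0r.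
rewrite -[i in LHS]/(val (Ordinal ni)) ext_ord mxE /sv ltn_min ni andbT.
have [mi|im] := leqP m i.
  rewrite mul0r big1// => j _; rewrite !mxE /= ltn_eqF ?mul0r//.
  exact: leq_trans (ltn_ord j) mi.
rewrite -[i in ext _ i]/(val (Ordinal im)) ext_ord (bigD1 (Ordinal im))//= !mxE eqxx mulr1n.
rewrite big1 ?addr0// => j; rewrite !mxE -val_eqE /= => ji.
by rewrite (negbTE ji) mulr0n mul0r.
Qed.

Lemma svd_orthogonal : [/\ U *m U^T = 1%:M & V *m V^T = 1%:M].
Proof. by have [h1 h2 _ _ _] := svd; rewrite mulmx1C// [V *m _]mulmx1C. Qed.

Lemma svdE : Y = U *m S *m V^T. Proof. by have [] := svd. Qed.

Lemma svd_mulmx (y : 'cV[R]_n) : U^T *m (Y *m y) = S *m (V^T *m y).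
Proof. by have [UU _ _ _ _] := svd; rewrite svdE !mulmxA UU mul1mx. Qed.

Lemma svd_mulmx_tr (x : 'cV[R]_m) : V^T *m (Y^T *m x) = S^T *m (U^T *m x).
Proof. by have [_ VV _ _ _] := svd; rewrite svdE !trmx_mul trmxK !mulmxA VV mul1mx. Qed.

Lemma dot_left (x y : 'cV[R]_m) : dot (U^T *m x) (U^T *m y) = dot x y.
Proof. by apply: dot_orthogonal; rewrite trmxK; have [] := svd_orthogonal. Qed.

Lemma dot_right (x y : 'cV[R]_n) : dot (V^T *m x) (V^T *m y) = dot x y.
Proof. by apply: dot_orthogonal; rewrite trmxK; have [] := svd_orthogonal. Qed.

(* Courant-Fischer: some combination of the first k + 1 right singular vectors
   vanishes in the first k coordinates. *)
Lemma sv_upper (k : nat) (a : R) : (k < m)%N -> (k < n)%N -> 0 <= a ->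
  (forall y : 'cV[R]_n, (forall j : 'I_n, (j < k)%N -> y j 0 = 0) ->
     dot (Y *m y) (Y *m y) <= a ^+ 2 * dot y y) ->
  sv k <= a.
Proof.
move=> km kn a0 h.
pose A : 'M[R]_(k, n) := \matrix_(i, j) V (widen_ord (ltnW kn) i) j.
have [P [P0 Pz AP]] := kernel_vector A kn.
have [_ VV _ _ _] := svd.
have VP (j : 'I_n) : (j < k)%N -> (V *m P) j 0 = 0.
  move=> jk; transitivity ((A *m P) (Ordinal jk) 0); last by rewrite AP mxE.
  rewrite mxE [RHS]mxE; apply: eq_bigr => l _; rewrite [in RHS]mxE; congr (V _ _ * _).
  exact: val_inj.
have := h _ VP; rewrite dot_orthogonal//.
rewrite -[X in X <= _]dot_left svd_mulmx [V^T *m _]mulmxA VV mul1mx.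
rewrite (dot_ext _ _ (leq_addr n m)) (dot_ext _ _ (leq_addl m n)).
have Pk i : (k < i)%N -> ext P i = 0.
  move=> ki; have [ni|ni] := leqP n i; first by rewrite ext_out.
  by rewrite -[i]/(val (Ordinal ni)) ext_ord Pz.
move=> le; have PP : 0 < dot P P.
  by rewrite lt_neqAle dot_ge0 andbT eq_sym; apply: contraNneq P0 => /dot_eq0 ->.
have : sv k ^+ 2 * dot P P <= a ^+ 2 * dot P P.
  rewrite [X in _ <= _ * X](dot_ext _ _ (leq_addl m n)); apply: le_trans le.
  rewrite (dot_ext _ _ (leq_addl m n)) mulr_sumr; apply: ler_sum => i _.
  rewrite ext_singular; have [ki|ik] := ltnP k i; first by rewrite Pk// !mulr0.
  rewrite -expr2 -[X in _ <= X]expr2 exprMn ler_wpM2r ?sqr_ge0//.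
  by rewrite ler_pXn2r ?nnegrE ?sv_ge0// sv_le.
by rewrite ler_pM2r// ler_pXn2r ?nnegrE ?sv_ge0.
Qed.

(** The span of the [k + 1] columns of [Z] contains a nonzero vector orthogonal to the first [k]
    right singular vectors. There [Y] stretches by at most [sv k], while the form is at least [a]
    times the squared norm. *)
Lemma sv_lower (k : nat) (a : R) (X : 'M[R]_(m, k.+1)) (Z : 'M[R]_(n, k.+1)) :
  X^T *m X = 1%:M -> Z^T *m Z = 1%:M -> 0 <= a ->
  (forall c : 'cV[R]_k.+1, a * dot c c <= dot (X *m c) (Y *m (Z *m c))) ->
  a <= sv k.
Proof.
move=> XX ZZ a0 h.
pose A : 'M[R]_(k, k.+1) := \matrix_(i, j) ext (V^T *m col j Z) i.
have [c [c0 _ Ac]] := kernel_vector A (ltnSn k).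
have cc : 0 < dot c c.
  by rewrite lt_neqAle dot_ge0 andbT eq_sym; apply: contraNneq c0 => /dot_eq0 ->.
have xc : dot (X *m c) (X *m c) = dot c c.
  by rewrite dot_tr mulmxA XX mul1mx.
have zc : dot (Z *m c) (Z *m c) = dot c c.
  by rewrite dot_tr mulmxA ZZ mul1mx.
have Vz i : (i < k)%N -> ext (V^T *m (Z *m c)) i = 0.
  move=> ik; transitivity ((A *m c) (Ordinal ik) 0); last by rewrite Ac mxE.
  rewrite [RHS]mxE; have [ni|ni] := leqP n i.
    rewrite ext_out// big1// => j _; by rewrite mxE ext_out// mul0r.
  rewrite -[i in LHS]/(val (Ordinal ni)) ext_ord mulmxA mxE; apply: eq_bigr => j _.
  rewrite [in RHS]mxE -[val (Ordinal ik)]/(val (Ordinal ni)) ext_ord; congr (_ * _).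
  by rewrite !mxE; apply: eq_bigr => l _; rewrite !mxE.
have Yz : dot (Y *m (Z *m c)) (Y *m (Z *m c)) <= sv k ^+ 2 * dot c c.
  rewrite -[X in X <= _]dot_left svd_mulmx -zc -[X in _ <= _ * X]dot_right.
  rewrite (dot_ext _ _ (leq_addr n m)) (dot_ext _ _ (leq_addl m n)) mulr_sumr.
  apply: ler_sum => i _; rewrite ext_singular.
  have [ik|ki] := ltnP i k; first by rewrite Vz// !mulr0.
  rewrite -expr2 -[X in _ <= _ * X]expr2 exprMn ler_wpM2r ?sqr_ge0//.
  by rewrite ler_pXn2r ?nnegrE ?sv_ge0// sv_le.
have h2 : (a * dot c c) ^+ 2 <= dot c c * (sv k ^+ 2 * dot c c).
  apply: le_trans (_ : dot (X *m c) (Y *m (Z *m c)) ^+ 2 <= _).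
    by rewrite ler_pXn2r ?nnegrE// ?(le_trans _ (h c)) ?mulr_ge0// ltW.
  apply: le_trans (cauchy_schwarz _ _) _; rewrite xc.
  by rewrite ler_wpM2l// ltW.
have : a ^+ 2 * dot c c ^+ 2 <= sv k ^+ 2 * dot c c ^+ 2.
  by move: h2; rewrite exprMn [X in _ <= X]mulrCA -expr2.
by rewrite ler_pM2r ?exprn_gt0// ler_pXn2r ?nnegrE ?sv_ge0.
Qed.

End singular_values.

Section chain_weights.
Context (R : realType) (g tau : R).
Hypothesis (tau0 : 0 < tau).

(* Away from the ends of the chain, [alpha] and [beta] satisfy the singular vector
   equations of the limiting band matrix with singular value [edge]. *)
Definition edge : R := Num.sqrt ((tau ^+ 2 + 1) * (1 + g ^+ 2 / tau ^+ 2)).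
Definition slope : R := edge / (1 + tau ^+ 2).
Definition ratio : R := g / tau ^+ 2.
Definition alpha (l : nat) : R := ratio ^+ l./2 * (if odd l then ratio * tau else 1).
Definition beta (l : nat) : R := slope * ratio ^+ l./2 * (if odd l then 1 else tau).

Let t20 : 0 < tau ^+ 2. Proof. by rewrite exprn_gt0. Qed.
Let tn : tau != 0. Proof. by rewrite gt_eqF. Qed.
Let d0 : 0 < 1 + tau ^+ 2. Proof. by rewrite addr_gt0. Qed.
Let dn : 1 + tau ^+ 2 != 0. Proof. by rewrite gt_eqF. Qed.
Let q0 : 0 < 1 + g ^+ 2 / tau ^+ 2.
Proof. by rewrite ltr_wpDr// divr_ge0// ?sqr_ge0// ltW. Qed.

Lemma edge_gt0 : 0 < edge.
Proof. by rewrite sqrtr_gt0 mulr_gt0// addrC. Qed.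

Lemma sqr_edge : edge ^+ 2 = (tau ^+ 2 + 1) * (1 + g ^+ 2 / tau ^+ 2).
Proof. by rewrite sqr_sqrtr// mulr_ge0// ltW// addrC. Qed.

Lemma slope_gt0 : 0 < slope.
Proof. by rewrite divr_gt0// edge_gt0. Qed.

Lemma slopeE : slope * (1 + tau ^+ 2) = edge.
Proof. by rewrite divfK. Qed.

Lemma slope_edge : edge * slope = 1 + g ^+ 2 / tau ^+ 2.
Proof. by rewrite mulrA -expr2 sqr_edge (addrC (tau ^+ 2)) [(1 + tau ^+ 2) * _]mulrC mulfK. Qed.

Lemma slope_inv : (1 + g ^+ 2 / tau ^+ 2) / slope = edge.
Proof. by rewrite -slope_edge mulfK// gt_eqF// slope_gt0. Qed.

Lemma betaS l : beta l.+1 = slope * alpha l.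
Proof.
rewrite /beta /alpha /= uphalf_half; case: (odd l) => /=; last by rewrite add0n !mulr1.
by rewrite add1n exprS; ring.
Qed.

Lemma alphaS l : g * beta l = slope * tau ^+ 2 * alpha l.+1.
Proof.
rewrite /beta /alpha /= uphalf_half; case: (odd l) => /=.
  by rewrite add1n [ratio ^+ _.+1]exprS; move: (_ ^+ l./2) => x; rewrite /ratio; field.
by rewrite add0n; move: (_ ^+ l./2) => x; rewrite /ratio; field.
Qed.

Lemma sum_alpha_sqr L :
  \sum_(l < L.*2) alpha l ^+ 2 = (1 + g ^+ 2 / tau ^+ 2) * \sum_(l < L) (ratio ^+ 2) ^+ l.
Proof.
elim: L => [|L IH]; first by rewrite !big_ord0 mulr0.
rewrite doubleS !big_ord_recr /= {}IH mulrDr -addrA; congr (_ + _).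
rewrite /alpha /= odd_double uphalf_double doubleK /= mulr1 [(ratio ^+ 2) ^+ L]exprAC.
by move: (ratio ^+ L) => x; rewrite /ratio; field.
Qed.

(** The indices [2 l] and [2 l + 1] together carry the same energy in [alpha] and in [beta]. For
    this reason the trial vectors have even length, and both are normalized by the same mass. *)
Lemma sum_beta_sqr L :
  \sum_(l < L.*2) beta l ^+ 2 = \sum_(l < L.*2) alpha l ^+ 2.
Proof.
rewrite sum_alpha_sqr; elim: L => [|L IH]; first by rewrite !big_ord0 mulr0.
rewrite doubleS !big_ord_recr /= {}IH mulrDr -addrA; congr (_ + _).
rewrite /beta /= odd_double uphalf_double doubleK /= mulr1 [(ratio ^+ 2) ^+ L]exprAC.
rewrite -slope_edge -slopeE; move: (ratio ^+ L) => x; ring.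
Qed.

(** By [betaS] and [alphaS] an inner index contributes [edge] times its squared weight. Two boundary
    terms remain: at the head the spike [s] may differ from [tau], and at the end the chain is
    cut. *)
Lemma chain_energy L (s : R) :
  s * (alpha 0 * beta 0) + \sum_(l < L.*2.+1) (alpha l * beta l.+1 + g * (alpha l.+1 * beta l)) =
  edge * \sum_(l < L.*2.+2) alpha l ^+ 2 - slope * tau * (tau - s) - slope * alpha L.*2.+1 ^+ 2.
Proof.
have -> : \sum_(l < L.*2.+1) (alpha l * beta l.+1 + g * (alpha l.+1 * beta l)) =
    slope * (\sum_(l < L.*2.+2) alpha l ^+ 2 - alpha L.*2.+1 ^+ 2) +
    slope * tau ^+ 2 * (\sum_(l < L.*2.+2) alpha l ^+ 2 - alpha 0 ^+ 2).
  rewrite big_split/=; congr (_ + _).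
    rewrite [X in _ * (X - _)]big_ord_recr /= addrK mulr_sumr; apply: eq_bigr => l _.
    by rewrite betaS; ring.
  rewrite [X in _ * (X - _)]big_ord_recl /= addrAC subrr add0r mulr_sumr.
  apply: eq_bigr => l _; rewrite (_ : g * _ = alpha l.+1 * (g * beta l)); last by ring.
  by rewrite alphaS /bump /= add1n; ring.
rewrite -slopeE /alpha /beta /= !expr0; ring.
Qed.

End chain_weights.

(** The squares differ by (b^2 - a^2)(1 - g^2 / (a^2 b^2)). For positive [g], [edge] increases past
    tau^2 = g, where its value is 1 + g, the edge of the bulk. *)
Lemma edge_mono (R : realType) (g a b : R) : 0 <= g -> 0 < a -> g <= a ^+ 2 -> a <= b ->
  edge g a <= edge g b.
Proof.
move=> g0 a0 ga ab; have b0 : 0 < b by exact: lt_le_trans ab.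
rewrite ler_sqrt; last by rewrite mulr_ge0// addr_ge0// ?divr_ge0 ?sqr_ge0// ltW// exprn_gt0.
have ab2 : a ^+ 2 <= b ^+ 2 by rewrite ler_pXn2r ?nnegrE// ltW.
have A0 : 0 < a ^+ 2 by rewrite exprn_gt0.
have B0 : 0 < b ^+ 2 by rewrite exprn_gt0.
move: (a ^+ 2) (b ^+ 2) ga ab2 A0 B0 => A B gA AB A0 B0.
rewrite -subr_ge0.
have -> : (B + 1) * (1 + g ^+ 2 / B) - (A + 1) * (1 + g ^+ 2 / A) =
   (B - A) * (1 - (g / A) * (g / B)) by field; rewrite !gt_eqF.
have [A0' B0'] := (ltW A0, ltW B0); apply: mulr_ge0; first by rewrite subr_ge0.
rewrite subr_ge0 mulr_ile1 ?divr_ge0//; first by rewrite ler_pdivrMr// mul1r.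
by rewrite ler_pdivrMr// mul1r (le_trans gA).
Qed.

Lemma edge_lt (R : realType) (g a b : R) : 0 <= g -> 0 < a -> g <= a ^+ 2 -> a < b ->
  edge g a < edge g b.
Proof.
move=> g0 a0 ga ab; have b0 : 0 < b by exact: lt_trans ab.
rewrite ltr_sqrt; last by rewrite mulr_gt0 ?ltr_wpDr ?divr_ge0 ?sqr_ge0 ?exprn_gt0.
have ab2 : a ^+ 2 < b ^+ 2 by rewrite ltr_pXn2r ?nnegrE// ltW.
have A0 : 0 < a ^+ 2 by rewrite exprn_gt0.
have B0 : 0 < b ^+ 2 by rewrite exprn_gt0.
move: (a ^+ 2) (b ^+ 2) ga ab2 A0 B0 => A B gA AB A0 B0.
rewrite -subr_gt0.
have -> : (B + 1) * (1 + g ^+ 2 / B) - (A + 1) * (1 + g ^+ 2 / A) =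
   (B - A) * (1 - (g / A) * (g / B)) by field; rewrite !gt_eqF.
rewrite mulr_gt0 ?subr_gt0//.
apply: (@le_lt_trans _ _ (1 * (g / B))).
  have B0' := ltW B0; by rewrite ler_wpM2r ?divr_ge0// ler_pdivrMr// mul1r.
by rewrite mul1r ltr_pdivrMr// mul1r; exact: le_lt_trans AB.
Qed.

Section chain_vectors.
Context (R : realType) (r : nat) (t : nat -> R) (g : R).
Hypothesis (r0 : (0 < r)%N) (g0 : 0 <= g).
Hypothesis t_ge_r : forall i, (r <= i)%N -> t i = 0.

Definition basis n (i : nat) : 'cV[R]_n := \col_(a < n) (a == i :> nat)%:R.

Definition chain n k M (f : nat -> R) : 'cV[R]_n :=
  \sum_(l < M) f l *: basis n (k + l * r).

Lemma dot_basis n (x : 'cV[R]_n) i : dot x (basis n i) = ext x i.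
Proof.
have [ni|ni] := leqP n i.
  rewrite ext_out// /dot big1// => j _; rewrite mxE ltn_eqF ?mulr0//.
  exact: leq_trans (ltn_ord j) ni.
rewrite -[i in RHS]/(val (Ordinal ni)) ext_ord /dot (bigD1 (Ordinal ni))//= mxE eqxx mulr1.
rewrite big1 ?addr0// => j; rewrite mxE -val_eqE /= => /negbTE ->; exact: mulr0.
Qed.

Lemma ext_basis n i j : (j < n)%N -> ext (basis n i) j = (j == i)%:R :> R.
Proof. by move=> jn; rewrite -[j in LHS]/(val (Ordinal jn)) ext_ord mxE. Qed.

Lemma basis_form m n (Y : 'M[R]_(m, n)) (i : 'I_m) (j : 'I_n) :
  dot (basis m i) (Y *m basis n j) = Y i j.
Proof.
rewrite dotC dot_basis ext_ord mxE (bigD1 j)//= mxE eqxx mulr1 big1 ?addr0// => l.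
by rewrite mxE -val_eqE => /negbTE ->; exact: mulr0.
Qed.

Lemma chain_index k k' l l' : (k < r)%N -> (k' < r)%N ->
  (k + l * r == k' + l' * r)%N = (k == k') && (l == l').
Proof.
move=> kr kr'; apply/eqP/andP => [h|[/eqP -> /eqP ->]//].
have hl : l = l'.
  have := congr1 (fun x => x %/ r)%N h.
  by rewrite !divnDMl// !divn_small.
by move: h; rewrite hl => /addIn ->.
Qed.

Lemma chain_lt k l M : (k < r)%N -> (l < M)%N -> (k + l * r < M * r)%N.
Proof.
move=> kr lM; apply: (@leq_trans (l.+1 * r)%N); first by rewrite mulSn ltn_add2r.
by rewrite leq_mul2r lM orbT.
Qed.

Lemma ext_chain n k M f j : (j < n)%N ->
  ext (chain n k M f) j = \sum_(l < M) f l * (j == (k + l * r)%N)%:R.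
Proof.
move=> jn; rewrite -dot_basis /chain dot_suml; apply: eq_bigr => l _.
by rewrite dotZl dot_basis ext_basis.
Qed.

Lemma ext_chain_lt n k M f j : (j < n)%N -> (j < k)%N -> ext (chain n k M f) j = 0.
Proof.
move=> jn jk; rewrite ext_chain// big1// => l _; rewrite ltn_eqF ?mulr0//.
by rewrite (leq_trans jk)// leq_addr.
Qed.

Lemma ext_chain_head n k M f j : (j < n)%N -> (j < r)%N -> (k < r)%N ->
  ext (chain n k M.+1 f) j = f 0%N * (j == k)%:R.
Proof.
move=> jn jr kr; rewrite ext_chain// (bigD1 ord0)//= big1 ?addr0.
  by rewrite addn0.
move=> l l0; rewrite -[j in j == _]addn0 -[X in (_ + X)%N == _](mul0n r) chain_index//.
by rewrite [0%N == _]eq_sym -[X in (X == 0)%N]/(val l) -[0%N]/(val (@ord0 M)) val_eqE (negbTE l0) andbF mulr0.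
Qed.

Lemma chain_dot n k k' M f h : (k < r)%N -> (k' < r)%N -> (M * r <= n)%N ->
  dot (chain n k M f) (chain n k' M h) = (k == k')%:R * \sum_(l < M) f l * h l.
Proof.
move=> kr kr' Mn; rewrite /chain dot_suml mulr_sumr; apply: eq_bigr => l _.
rewrite dot_sumr (bigD1 l)//= dotZl dotZr dot_basis ext_basis; last first.
  by rewrite (leq_trans (chain_lt _ _) Mn).
rewrite chain_index// eqxx andbT big1 ?addr0.
  by rewrite eq_sym; ring.
move=> l' ll'; rewrite dotZl dotZr dot_basis ext_basis; last first.
  by rewrite (leq_trans (chain_lt _ _) Mn).
by rewrite chain_index// val_eqE (negbTE ll') andbF !mulr0.
Qed.

(** All couplings of the model join indices that are equal modulo [r], so chains with different
    heads do not interact. *)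
Lemma model_chain k k' l l' : (k < r)%N -> (k' < r)%N ->
  model r t g (k + l * r) (k' + l' * r) =
  (k == k')%:R * ((t k *+ (l == 0)%N) *+ (l' == 0)%N + (l' == l.+1)%:R + g *+ (l == l'.+1)).
Proof.
move=> kr kr'; rewrite /model chain_index// -!addnA -!mulSnr !chain_index//.
have [_|_] := eqVneq k k'; last by rewrite /= !mulr0n mul0r !addr0.
rewrite /= mul1r; congr (_ + _ + _); case: l => [|l] /=.
  by rewrite addn0 mulr1n eq_sym.
by rewrite mulr0n mul0rn t_ge_r ?mul0rn// mulSn addnCA leq_addr.
Qed.

Lemma sum_pick n (F : nat -> R) a : \sum_(i < n) F i * (i == a :> nat)%:R = F a *+ (a < n)%N.
Proof.
have [an|na] := ltnP a n.
  rewrite (bigD1 (Ordinal an))//= eqxx mulr1 big1 ?addr0// => i; rewrite -val_eqE /= => /negbTE ->.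
  exact: mulr0.
rewrite big1// => i _; rewrite ltn_eqF ?mulr0//; exact: leq_trans (ltn_ord i) na.
Qed.

Lemma model_chain_form k M (f h : nat -> R) :
  \sum_(l < M.+1) \sum_(l' < M.+1)
     f l * h l' * ((t k *+ (l == 0 :> nat)%N) *+ (l' == 0 :> nat)%N + (l' == l.+1 :> nat)%:R + g *+ (l == l'.+1 :> nat)) =
  t k * (f 0%N * h 0%N) + \sum_(l < M) (f l * h l.+1 + g * (f l.+1 * h l)).
Proof.
have -> : \sum_(l < M.+1) \sum_(l' < M.+1)
     f l * h l' * ((t k *+ (l == 0 :> nat)%N) *+ (l' == 0 :> nat)%N + (l' == l.+1 :> nat)%:R + g *+ (l == l'.+1 :> nat)) =
  \sum_(l < M.+1) (\sum_(l' < M.+1) (t k * f l *+ (l == 0 :> nat)%N * h l') * (l' == 0 :> nat)%:R) +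
  \sum_(l < M.+1) (\sum_(l' < M.+1) (f l * h l') * (l' == l.+1 :> nat)%:R) +
  \sum_(l' < M.+1) (\sum_(l < M.+1) (g * (f l * h l')) * (l == l'.+1 :> nat)%:R).
  rewrite [X in _ = _ + X]exchange_big -!big_split; apply: eq_bigr => l _.
  rewrite -!big_split; apply: eq_bigr => l' _.
  case: (_ == 0%N :> nat); case: (_ == 0%N :> nat); case: (_ == _.+1 :> nat);
    case: (_ == _.+1 :> nat); rewrite /= ?mulr1n ?mulr0n; ring.
rewrite big_split/= addrA; congr (_ + _ + _).
- rewrite (eq_bigr (fun l : 'I_M.+1 => t k * f l * h 0%N * (l == 0 :> nat)%N%:R)); last first.
    move=> l _; rewrite (sum_pick M.+1 (fun l' => t k * f l *+ (l == 0 :> nat)%N * h l')) mulr1n.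
    by case: (_ == _); rewrite /= ?mulr1n ?mulr0n; ring.
  by rewrite (sum_pick M.+1 (fun l => t k * f l * h 0%N)) mulr1n mulrA.
- under eq_bigr do rewrite (sum_pick M.+1 (fun l' => f _ * h l')).
  rewrite big_ord_recr /= ltnn mulr0n addr0; apply: eq_bigr => l _.
  by rewrite ltnS ltn_ord.
- under eq_bigr do rewrite (sum_pick M.+1 (fun l => g * (f l * h _))).
  rewrite big_ord_recr /= ltnn mulr0n addr0; apply: eq_bigr => l _.
  by rewrite ltnS ltn_ord.
Qed.

Lemma chain_form eps M m n (B : 'M[R]_(m, n)) k k' (f h : nat -> R) :
  0 <= eps -> band_near r g eps (M.+1 * r) B -> (k < r)%N -> (k' < r)%N ->
  `|dot (chain m k M.+1 f) (spiked t B *m chain n k' M.+1 h)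
    - (k == k')%:R * (t k * (f 0%N * h 0%N) + \sum_(l < M) (f l * h l.+1 + g * (f l.+1 * h l)))|
   <= eps * ((\sum_(l < M.+1) `|f l|) * (\sum_(l < M.+1) `|h l|)).
Proof.
move=> e0 hB kr kr'; have [Nm Nn _] := hB.
rewrite -model_chain_form mulr_sumr /chain dot_suml -sumrB mulr_suml mulr_sumr.
apply: le_trans (ler_norm_sum _ _ _) _; apply: ler_sum => l _.
rewrite mulmx_sumr dot_sumr !mulr_sumr -sumrB.
apply: le_trans (ler_norm_sum _ _ _) _; apply: ler_sum => l' _.
have hl := chain_lt kr (ltn_ord l); have hl' := chain_lt kr' (ltn_ord l').
rewrite -scalemxAr dotZl dotZr.
rewrite -[(k + l * r)%N]/(val (Ordinal (leq_trans hl Nm))).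
rewrite -[(k' + l' * r)%N]/(val (Ordinal (leq_trans hl' Nn))) basis_form.
rewrite [(k == k')%:R * _]mulrCA -model_chain// mulrA -mulrBr !normrM mulrC; apply: ler_wpM2r.
  by rewrite mulr_ge0.
by apply: (spiked_near_model t r0 (N := (M.+1 * r)%N)).
Qed.

End chain_vectors.

(** * Limits of the singular values *)

Section singular_value_limits.
Context (R : realType) (r : nat) (t : nat -> R) (g : R).
Hypotheses (r0 : (0 < r)%N) (g0 : 0 <= g).
Hypothesis t_ge_r : forall i, (r <= i)%N -> t i = 0.
Hypothesis t_gt0 : forall i, (i < r)%N -> 0 < t i.
Hypothesis t_decr : forall i j, (i < j)%N -> (j < r)%N -> t j < t i.

Local Notation eventually Q := (@eventually_banded R r g Q).

Lemma spike_ge0 i : 0 <= t i.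
Proof. by have [/t_ge_r ->//|/t_gt0/ltW] := leqP r i. Qed.

Lemma spike_le i j : (i <= j)%N -> t j <= t i.
Proof.
have [/t_ge_r ->|jr] := leqP r j; first by move=> _; exact: spike_ge0.
by rewrite leq_eqVlt => /orP[/eqP ->//|/t_decr/(_ jr)/ltW].
Qed.

(** Vectors that vanish before index [k] do not meet the first [k] spikes on the diagonal, and the
    remaining spikes are at most [tau], as the Schur test requires. *)
Lemma eventually_tail_norm k tau eta : 0 < eta -> 0 < tau -> g <= tau ^+ 2 -> t k <= tau ->
  eventually (fun m n B =>
    (forall y : 'cV[R]_n, (forall j : 'I_n, (j < k)%N -> y j 0 = 0) ->
     dot (spiked t B *m y) (spiked t B *m y) <= (edge g tau + eta) ^+ 2 * dot y y) /\
    (forall x : 'cV[R]_m, (forall j : 'I_m, (j < k)%N -> x j 0 = 0) ->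
     dot ((spiked t B)^T *m x) ((spiked t B)^T *m x) <= (edge g tau + eta) ^+ 2 * dot x x)).
Proof.
move=> eta0 tau0 gtau tk; pose eps := eta / (2 * r.+1%:R).
have eps0 : 0 < eps by rewrite divr_gt0// mulr_gt0.
(* The corner is empty: only the upper bounds valid in all rows and columns are used. *)
exists eps, 0%N; split => // m n B hB.
have aE : edge g tau / 2 + r.+1%:R * eps = (edge g tau + eta) / 2.
  by rewrite /eps; field; rewrite addrC natr1 pnatr_eq0.
have a0 : 0 < edge g tau + eta by rewrite addr_gt0// edge_gt0.
have form (x : 'cV[R]_m) (y : 'cV[R]_n) :
    (forall (i : 'I_m) (j : 'I_n), i = j :> nat -> (i < k)%N -> x i 0 * y j 0 = 0) ->
    dot x (spiked t B *m y) <= (edge g tau + eta) / 2 * (dot x x + dot y y).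
  move=> xy0; rewrite -aE; apply: (schur_bound r0 t_ge_r (kap := slope g tau) (tau := tau) hB) => //.
  - exact: ltW.
  - exact: slope_gt0.
  - by rewrite slopeE.
  - by rewrite slope_inv.
  move=> i j ij; have [ik|ki] := ltnP i k; first by rewrite (xy0 i j ij ik) mulr0 normr0 mulr0.
  apply: (@le_trans _ _ (t i * `|x i 0 * y j 0|)).
    by rewrite ler_wpM2l ?spike_ge0// ler_norm.
  by rewrite ler_wpM2r// (le_trans _ tk)// spike_le.
split=> [y y0|x x0]; apply: schur_norm_bound => //.
  by move=> x; apply: form => i j ij ik; rewrite y0 ?mulr0// -ij.
move=> y; rewrite dot_tr trmxK dotC [dot y y + _]addrC.
by apply: form => i j ij ik; rewrite x0 ?mul0r.
Qed.

Lemma eventually_sv_upper k tau eta : 0 < eta -> 0 < tau -> g <= tau ^+ 2 -> t k <= tau ->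
  eventually (fun m n B => forall U s V, is_svd (spiked t B) U s V ->
     sv m n s k <= edge g tau + eta).
Proof.
move=> eta0 tau0 gtau tk; apply: eventually_banded_imp (eventually_tail_norm eta0 tau0 gtau tk).
move=> m n B [h _] U s V svd; have a0 : 0 <= edge g tau + eta by rewrite addr_ge0 ?sqrtr_ge0// ltW.
have [km|mk] := ltnP k m; last by rewrite /sv ltn_min (ltnNge k m) mk.
have [kn|nk] := ltnP k n; last by rewrite /sv ltn_min (ltnNge k n) nk andbF.
exact: (sv_upper svd) km kn a0 h.
Qed.

(** The parameter of the weights on chain [k]: the spike itself above the threshold, and below it
    sqrt g, for which [edge] is the bulk edge 1 + g. *)
Definition eff k : R := Num.max (t k) (Num.sqrt g).

Lemma eff_gt0 k : (k < r)%N -> 0 < eff k.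
Proof. by move=> kr; rewrite lt_max t_gt0. Qed.

Lemma eff_sqr k : g <= eff k ^+ 2.
Proof.
rewrite -[g in X in X <= _]sqr_sqrtr// ler_pXn2r ?nnegrE ?sqrtr_ge0//.
  by rewrite le_max lexx orbT.
by rewrite le_max sqrtr_ge0 orbT.
Qed.

Lemma eff_le k k' : (k <= k')%N -> eff k' <= eff k.
Proof. by move=> kk; rewrite ge_max !le_max lexx orbT spike_le. Qed.

Definition mass k L : R := \sum_(l < L.*2.+2) alpha g (eff k) l ^+ 2.
(** The two boundary terms of [chain_energy] divided by the mass: what the normalized truncated pair
    loses against [edge]. *)
Definition defect k L : R :=
  (slope g (eff k) * eff k * (eff k - t k) + slope g (eff k) * alpha g (eff k) L.*2.+1 ^+ 2) / mass k L.
Definition left_weight k L l : R := alpha g (eff k) l / Num.sqrt (mass k L).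
Definition right_weight k L l : R := beta g (eff k) l / Num.sqrt (mass k L).
Definition left_trial m k L : 'cV[R]_m := chain r m k L.*2.+2 (left_weight k L).
Definition right_trial n k L : 'cV[R]_n := chain r n k L.*2.+2 (right_weight k L).

Lemma mass_ge1 k L : 1 <= mass k L.
Proof.
rewrite /mass big_ord_recl /= {1}/alpha /= expr0 mulr1 expr1n lerDl.
by apply: sumr_ge0 => l _; exact: sqr_ge0.
Qed.

Lemma massE k L : (k < r)%N ->
  mass k L = (1 + g ^+ 2 / eff k ^+ 2) * \sum_(l < L.+1) (ratio g (eff k) ^+ 2) ^+ l.
Proof. by move=> kr; rewrite /mass -doubleS sum_alpha_sqr// eff_gt0. Qed.

Let mass_gt0 k L : 0 < mass k L.
Proof. exact: lt_le_trans (mass_ge1 k L). Qed.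

Lemma sum_left_weight k L : \sum_(l < L.*2.+2) left_weight k L l ^+ 2 = 1.
Proof.
under eq_bigr do rewrite exprMn exprVn sqr_sqrtr ?(ltW (mass_gt0 _ _))//.
by rewrite -mulr_suml -/(mass k L) mulfV// gt_eqF.
Qed.

Lemma sum_right_weight k L : (k < r)%N -> \sum_(l < L.*2.+2) right_weight k L l ^+ 2 = 1.
Proof.
move=> kr; under eq_bigr do rewrite exprMn exprVn sqr_sqrtr ?(ltW (mass_gt0 _ _))//.
rewrite -mulr_suml -doubleS sum_beta_sqr ?eff_gt0// doubleS -/(mass k L) mulfV// gt_eqF//.
Qed.

Lemma sum_norm_le M (f : nat -> R) : \sum_(l < M) f l ^+ 2 = 1 -> \sum_(l < M) `|f l| <= M%:R.
Proof.
move=> f1; rewrite -[M in M%:R]card_ord -sumr_const; apply: ler_sum => l _.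
apply: ler_norm_sqr => //; rewrite expr1n -f1 (bigD1 l)//= lerDl.
by apply: sumr_ge0 => i _; exact: sqr_ge0.
Qed.

Lemma eventually_trial_form L delta : 0 < delta ->
  eventually (fun m n B => [/\ (L.*2.+2 * r <= m)%N, (L.*2.+2 * r <= n)%N &
    forall k k', (k < r)%N -> (k' < r)%N ->
    `|dot (left_trial m k L) (spiked t B *m right_trial n k' L)
       - (k == k')%:R * (edge g (eff k) - defect k L)| <= delta]).
Proof.
move=> d0; pose M := L.*2.+2; pose eps := delta / (M%:R * M%:R).
have MM : 0 < M%:R * M%:R :> R by rewrite mulr_gt0.
have e0 : 0 < eps by rewrite divr_gt0.
exists eps, (M * r)%N; split => // m n B hB; have [Mm Mn _] := hB; split => // k k' kr kr'.
have := chain_form r0 t_ge_r (left_weight k L) (right_weight k' L) (ltW e0) hB kr kr'.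
rewrite (_ : (k == k')%:R * _ = (k == k')%:R * (edge g (eff k) - defect k L)); last first.
  have [<-|_] := eqVneq k k'; last by rewrite !mul0r.
  rewrite !mul1r; have sm : Num.sqrt (mass k L) * Num.sqrt (mass k L) = mass k L.
    by rewrite -expr2 sqr_sqrtr// ltW.
  have sn : Num.sqrt (mass k L) != 0 by rewrite gt_eqF// sqrtr_gt0.
  have mn : mass k L != 0 by rewrite gt_eqF.
  have tr : edge g (eff k) - defect k L =
     (t k * (alpha g (eff k) 0 * beta g (eff k) 0) +
      \sum_(l < L.*2.+1) (alpha g (eff k) l * beta g (eff k) l.+1 +
        g * (alpha g (eff k) l.+1 * beta g (eff k) l))) / mass k L.
    rewrite chain_energy ?eff_gt0// -/(mass k L) /defect; field.
    exact: mn.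
  rewrite tr [RHS]mulrDl mulr_suml; congr (_ + _).
    by rewrite /left_weight /right_weight -{3}sm; field.
  by apply: eq_bigr => l _; rewrite /left_weight /right_weight -{5}sm; field.
move=> h; apply: le_trans h _.
apply: (@le_trans _ _ (eps * (M%:R * M%:R))).
  rewrite ler_pM2l//; apply: ler_pM; rewrite ?sumr_ge0//; apply: sum_norm_le.
    exact: sum_left_weight.
  exact: sum_right_weight.
by rewrite divfK// gt_eqF.
Qed.

Lemma left_trial_dot m k k' L : (k < r)%N -> (k' < r)%N -> (L.*2.+2 * r <= m)%N ->
  k = k' -> dot (left_trial m k L) (left_trial m k' L) = 1.
Proof. by move=> kr kr' Lm <-; rewrite (chain_dot r0)// eqxx mul1r -[RHS](sum_left_weight k L). Qed.
End singular_value_limits.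

Section trial_limits.
Context (R : realType) (r : nat) (t : nat -> R) (g : R).
Hypotheses (r0 : (0 < r)%N) (g0 : 0 <= g).
Hypothesis t_gt0 : forall i, (i < r)%N -> 0 < t i.

Lemma ratio_lt1 k : (k < r)%N -> Num.sqrt g < t k -> ratio g (eff t g k) < 1.
Proof.
move=> kr gt; have h := eff_gt0 g t_gt0 kr.
rewrite /ratio ltr_pdivrMr ?exprn_gt0// mul1r.
rewrite -[g in X in X < _]sqr_sqrtr// ltr_pXn2r ?nnegrE ?sqrtr_ge0//.
  by rewrite lt_max gt.
by rewrite le_max sqrtr_ge0 orbT.
Qed.

Lemma ratio_eq1 k : (k < r)%N -> t k <= Num.sqrt g -> ratio g (eff t g k) = 1.
Proof.
move=> kr tg; have h := eff_gt0 g t_gt0 kr; move: h; rewrite /ratio /eff max_r// => h.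
by rewrite sqr_sqrtr// mulfV// gt_eqF// -sqrtr_gt0.
Qed.

(** The mass is a geometric sum. The limit of its inverse, with g^2 = gamma, is c_k^2: the overlap
    is the first entry of the normalized chain vector. *)
Lemma cvg_mass k : (k < r)%N -> Num.sqrt g < t k ->
  (fun L => (mass t g k L)^-1) @ \oo --> ((1 - g ^+ 2 / t k ^+ 4) / (1 + g ^+ 2 / t k ^+ 2) : R).
Proof.
move=> kr gt; have q1 := ratio_lt1 kr gt; have tk := t_gt0 kr.
have e : eff t g k = t k by rewrite /eff max_l// ltW.
have q0 : 0 <= ratio g (eff t g k) by rewrite /ratio divr_ge0// sqr_ge0.
rewrite (_ : _ / _ = ((1 + g ^+ 2 / t k ^+ 2) * ((1 - ratio g (t k) ^+ 2)^-1 * (1 - 0)))^-1); last first.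
  rewrite subr0 mulr1 [RHS]invfM invrK mulrC /ratio; congr (_ * (1 - _)).
  by field; rewrite gt_eqF.
have -> : (fun L => (mass t g k L)^-1) = (fun L => ((1 + g ^+ 2 / t k ^+ 2) *
    ((1 - ratio g (t k) ^+ 2)^-1 * (1 - ratio g (t k) ^+ 2 * (ratio g (t k) ^+ 2) ^+ L)))^-1).
  apply/funext => L; rewrite (massE g t_gt0)// e -exprS; congr (_ * _)^-1.
  rewrite -e in q1 *; rewrite mulrC -[X in (X - _)](expr1n _ L.+1).
  have q21 : 1 - ratio g (eff t g k) ^+ 2 != 0.
    by rewrite gt_eqF// subr_gt0 expr_lt1.
  apply: (canRL (mulfK q21)); rewrite mulrC subrXX; congr (_ * _).
  by apply: eq_bigr => i _; rewrite expr1n mul1r.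
rewrite -e in q1 q0 *.
have q21 : ratio g (eff t g k) ^+ 2 < 1 by rewrite expr_lt1.
apply: cvgV.
  rewrite subr0 mulr1 mulf_neq0 ?invr_eq0//; rewrite gt_eqF ?subr_gt0//.
  by rewrite ltr_wpDr// divr_ge0 ?sqr_ge0.
apply: cvgMr; apply: cvgMr; apply: cvgB; first exact: cvg_cst.
rewrite -[X in _ --> X](mulr0 (ratio g (eff t g k) ^+ 2)); apply: cvgMr.
by apply: cvg_expr; rewrite ger0_norm ?sqr_ge0.
Qed.

Lemma cvg_left_weight k : (k < r)%N -> Num.sqrt g < t k ->
  (fun L => left_weight t g k L 0) @ \oo -->
    Num.sqrt ((1 - g ^+ 2 / t k ^+ 4) / (1 + g ^+ 2 / t k ^+ 2)).
Proof.
move=> kr gt; rewrite (_ : left_weight t g k ^~ 0%N = fun L => Num.sqrt (mass t g k L)^-1).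
  by apply: (@cvg_comp _ _ _ _ Num.sqrt _ _ _ (cvg_mass kr gt)); exact: sqrt_continuous.
apply/funext => L; rewrite /left_weight /alpha /= expr0 !mul1r sqrtrV//.
by rewrite (le_trans _ (mass_ge1 t g k L)).
Qed.

Lemma cvg_right_weight k : (k < r)%N -> Num.sqrt g < t k ->
  (fun L => right_weight t g k L 0) @ \oo -->
    Num.sqrt ((1 - g ^+ 2 / t k ^+ 4) / (1 + 1 / t k ^+ 2)).
Proof.
move=> kr gt; have tk := t_gt0 kr.
have e : eff t g k = t k by rewrite /eff max_l// ltW.
have tn : t k != 0 by rewrite gt_eqF.
have t20 : 0 < t k ^+ 2 by rewrite exprn_gt0.
have dn : 1 + t k ^+ 2 != 0 by rewrite gt_eqF// addr_gt0.
have qn : 1 + g ^+ 2 / t k ^+ 2 != 0.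
  by rewrite gt_eqF// ltr_wpDr// divr_ge0 ?sqr_ge0.
pose c := (slope g (t k) * t k) ^+ 2.
have cE : c = (1 + g ^+ 2 / t k ^+ 2) * t k ^+ 2 / (1 + t k ^+ 2).
  apply: (canRL (mulfK dn)); rewrite -(slope_edge g tk) -(slopeE g tk) /c; ring.
rewrite (_ : right_weight t g k ^~ 0%N = fun L => Num.sqrt (c * (mass t g k L)^-1)).
  rewrite (_ : (1 - g ^+ 2 / t k ^+ 4) / (1 + 1 / t k ^+ 2) = c * ((1 - g ^+ 2 / t k ^+ 4) / (1 + g ^+ 2 / t k ^+ 2))); last first.
    rewrite cE; field; rewrite tn/=.
    have -> : t k * t k + g * g = (1 + g ^+ 2 / t k ^+ 2) * t k ^+ 2 by field.
    by rewrite mulf_neq0 ?expf_neq0//= !andbT ?addrC.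
  have H : (fun L => c * (mass t g k L)^-1) @ \oo -->
      c * ((1 - g ^+ 2 / t k ^+ 4) / (1 + g ^+ 2 / t k ^+ 2)).
    by apply: cvgMr; exact: cvg_mass.
  apply: (@cvg_comp _ _ _ _ Num.sqrt _ _ _ H); exact: sqrt_continuous.
apply/funext => L; rewrite /right_weight /beta /= expr0 mulr1 e sqrtrM ?sqr_ge0// sqrtr_sqr.
rewrite ger0_norm; last by rewrite mulr_ge0// ltW// slope_gt0.
by rewrite sqrtrV// (le_trans _ (mass_ge1 t g k L)).
Qed.

(** Above the threshold the head term vanishes and the end term decays geometrically. At or below it
    [ratio] is 1: the boundary terms do not depend on [L], but the mass is at least [L + 1]. *)
Lemma near_defect k delta : (k < r)%N -> 0 < delta -> \forall L \near \oo, defect t g k L <= delta.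
Proof.
move=> kr d0; have ek := eff_gt0 g t_gt0 kr; have sl := slope_gt0 g ek.
have [gt|tg] := ltP (Num.sqrt g) (t k).
  have q1 := ratio_lt1 kr gt; set q := ratio g (eff t g k) in q1.
  have q0 : 0 <= q by rewrite /q /ratio divr_ge0// sqr_ge0.
  have q21 : `|q ^+ 2| < 1 by rewrite ger0_norm ?sqr_ge0// expr_lt1.
  pose C := slope g (eff t g k) * (q * eff t g k) ^+ 2.
  have : (fun L => C * (q ^+ 2) ^+ L) @ \oo --> 0.
    by rewrite -[X in _ --> X](mulr0 C); apply: cvgMr; exact: cvg_expr.
  move=> /cvgr0Pnorm_le /(_ _ d0); apply: filterS => L; apply: le_trans.
  apply: le_trans (ler_norm _).
  have e : eff t g k = t k by rewrite /eff max_l// ltW.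
  rewrite /defect -e subrr mulr0 add0r ler_pdivrMr; last first.
    exact: lt_le_trans (mass_ge1 t g k L).
  rewrite /alpha /= odd_double uphalf_double /= -/q.
  have -> : slope g (eff t g k) * (q ^+ L * (q * eff t g k)) ^+ 2 = C * (q ^+ 2) ^+ L.
    by rewrite /C exprAC; ring.
  rewrite ler_peMr ?mass_ge1// mulr_ge0 ?exprn_ge0 ?sqr_ge0//.
  by rewrite mulr_ge0 ?sqr_ge0// ltW.
have q1 := ratio_eq1 kr tg.
pose C := slope g (eff t g k) * eff t g k * (eff t g k - t k) + slope g (eff t g k) * eff t g k ^+ 2.
have C0 : 0 <= C.
  have te : t k <= eff t g k by rewrite le_max lexx.
  have [sl' ek'] := (ltW sl, ltW ek).
  apply: addr_ge0; last by apply: mulr_ge0 => //; exact: sqr_ge0.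
  by apply: mulr_ge0; [exact: mulr_ge0|rewrite subr_ge0].
near=> L; rewrite /defect /alpha /= odd_double uphalf_double /= q1 expr1n !mul1r -/C.
rewrite ler_pdivrMr; last exact: lt_le_trans (mass_ge1 t g k L).
apply: (@le_trans _ _ (delta * L.+1%:R)).
  rewrite -ler_pdivrMl// mulrC; near: L.
  have := nbhs_infty_ger (C / delta); apply: filterS => L h.
  by rewrite (le_trans h)// ler_nat.
rewrite ler_pM2l// (massE g t_gt0)//.
rewrite q1 expr1n; under eq_bigr do rewrite expr1n.
rewrite sumr_const card_ord ler_peMl// lerDl divr_ge0 ?sqr_ge0//.
Unshelve. all: by end_near.
Qed.

End trial_limits.

Section singular_value_lower.
Context (R : realType) (r : nat) (t : nat -> R) (g : R).
Hypotheses (r0 : (0 < r)%N) (g0 : 0 <= g).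
Hypothesis t_ge_r : forall i, (r <= i)%N -> t i = 0.
Hypothesis t_gt0 : forall i, (i < r)%N -> 0 < t i.
Hypothesis t_decr : forall i j, (i < j)%N -> (j < r)%N -> t j < t i.

Local Notation eventually Q := (@eventually_banded R r g Q).

Lemma near_defects delta : 0 < delta ->
  \forall L \near \oo, forall k, (k < r)%N -> defect t g k L <= delta.
Proof.
move=> d0; have : \forall L \near \oo, forall k : 'I_r, defect t g k L <= delta.
  by apply: filter_forall => k; apply: (near_defect g0 t_gt0 _ d0).
by apply: filterS => L h k kr; exact: (h (Ordinal kr)).
Qed.

Lemma trial_gram n K L (f : nat -> nat -> R) :
  (K <= r)%N -> (L * r <= n)%N -> (forall k, (k < r)%N -> \sum_(l < L) f k l ^+ 2 = 1) ->
  let X : 'M[R]_(n, K) := \matrix_(i, j) chain r n j L (f j) i 0 in X^T *m X = 1%:M.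
Proof.
move=> Kr Ln f1 X; apply/matrixP => i j; rewrite mxE [RHS]mxE.
have ir := leq_trans (ltn_ord i) Kr; have jr := leq_trans (ltn_ord j) Kr.
transitivity (dot (chain r n i L (f i)) (chain r n j L (f j))).
  by apply: eq_bigr => l _; rewrite !mxE.
rewrite (chain_dot r0)//; have [/eqP|] := eqVneq i j; rewrite -val_eqE /=.
  by move=> /eqP ->; rewrite eqxx mul1r -[RHS](f1 j jr); apply: eq_bigr => l _; rewrite expr2.
by move=> /negbTE ->; rewrite mul0r.
Qed.

(** On the span of the first [k + 1] trial pairs the form is almost diagonal, and by [edge_mono] its
    smallest diagonal entry belongs, up to the defects, to index [k]. *)
Lemma eventually_sv_lower eta : 0 < eta ->
  eventually (fun m n B => forall U s V, is_svd (spiked t B) U s V ->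
     forall k, (k < r)%N -> edge g (eff t g k) - eta <= sv m n s k).
Proof.
(* One [d] pays for the defect and [k + 1 <= r] more for the errors in a row of the form. *)
move=> eta0; pose d := eta / (r.+1)%:R.
have d0 : 0 < d by rewrite divr_gt0.
have [L _ /(_ L (leqnn L)) HL] := near_defects d0.
apply: eventually_banded_imp (eventually_trial_form g r0 t_ge_r t_gt0 L d0).
move=> m n B [Lm Ln h] U s V svd k kr.
have [a0|a0] := leP (edge g (eff t g k) - eta) 0; first by rewrite (le_trans a0)// (sv_ge0 svd).
pose M := L.*2.+2.
pose X : 'M[R]_(m, k.+1) := \matrix_(i, j) chain r m j M (left_weight t g j L) i 0.
pose Z : 'M[R]_(n, k.+1) := \matrix_(i, j) chain r n j M (right_weight t g j L) i 0.
have XX : X^T *m X = 1%:M.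
  by apply: (trial_gram (f := fun k => left_weight t g k L)) => // *; exact: sum_left_weight.
have ZZ : Z^T *m Z = 1%:M.
  apply: (trial_gram (f := fun k => right_weight t g k L)) => // *.
  exact: (sum_right_weight g t_gt0).
apply: (sv_lower svd XX ZZ (ltW a0)) => c.
have Xc : X *m c = \sum_j c j 0 *: left_trial r t g m j L.
  apply/matrixP => i z; rewrite (ord1 z) mxE summxE; apply: eq_bigr => j _.
  by rewrite !mxE mulrC.
have Zc : Z *m c = \sum_j c j 0 *: right_trial r t g n j L.
  apply/matrixP => i z; rewrite (ord1 z) mxE summxE; apply: eq_bigr => j _.
  by rewrite !mxE mulrC.
rewrite Xc Zc dot_suml mulmx_sumr.
set e := edge _ _.
have term (i j : 'I_k.+1) : (i == j)%:R * (e - d) * c i 0 ^+ 2 - d * ((c i 0 ^+ 2 + c j 0 ^+ 2) / 2) <=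
   dot (c i 0 *: left_trial r t g m i L) (spiked t B *m (c j 0 *: right_trial r t g n j L)).
  have ir : (i < r)%N by rewrite (leq_trans (ltn_ord i)).
  have jr : (j < r)%N by rewrite (leq_trans (ltn_ord j)).
  rewrite -scalemxAr dotZl dotZr mulrA; set W := dot _ _.
  have hW := h i j ir jr; rewrite -/W in hW.
  set D := edge g (eff t g i) - defect t g i L in hW.
  have De : e - d <= D.
    apply: lerB; last exact: HL.
    apply: edge_mono => //; [exact: eff_gt0 t_gt0 _ kr|exact: eff_sqr|].
    by apply: (eff_le _ t_ge_r t_gt0 t_decr); rewrite -ltnS.
  have h1 : (i == j)%:R * (e - d) * c i 0 ^+ 2 <= c i 0 * c j 0 * ((i == j)%:R * D).
    have [->|_] := eqVneq i j; last by rewrite !mul0r mulr0.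
    by rewrite !mul1r -expr2 mulrC ler_wpM2l ?sqr_ge0.
  have h2 : - (d * ((c i 0 ^+ 2 + c j 0 ^+ 2) / 2)) <= c i 0 * c j 0 * (W - (i == j)%:R * D).
    rewrite lerNl -mulrN; apply: le_trans (ler_norm _) _; rewrite normrM mulrC.
    rewrite normrN; apply: ler_pM => //.
    have := @weighted_amgm R 1 1 1 (c i 0) (c j 0) ler01 ler01.
    by rewrite !mul1r expr1n; apply.
  move: h1 h2; rewrite mulrBr; lra.
apply: (@le_trans _ _ (\sum_i \sum_j ((i == j)%:R * (e - d) * c i 0 ^+ 2 - d * ((c i 0 ^+ 2 + c j 0 ^+ 2) / 2)))); last first.
  by apply: ler_sum => i _; rewrite dot_sumr; apply: ler_sum => j _; exact: term.
under eq_bigr do rewrite big_split/=.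
rewrite big_split/=.
rewrite (eq_bigr (fun i => (e - d) * c i 0 ^+ 2)); last first.
  move=> i _; rewrite (bigD1 i)//= eqxx mul1r big1 ?addr0// => j; rewrite eq_sym => /negbTE ->.
  by rewrite !mul0r.
have -> : \sum_i \sum_j (- (d * ((c i 0 ^+ 2 + c j 0 ^+ 2) / 2))) = - (d * (k.+1%:R * dot c c)).
  under eq_bigr do rewrite sumrN -mulr_sumr -mulr_suml big_split/= sumr_const card_ord.
  rewrite sumrN -mulr_sumr -mulr_suml big_split/= sumr_const card_ord.
  congr (- (d * _)); rewrite sumrMnl.
  have -> : \sum_i c i 0 ^+ 2 = dot c c by apply: eq_bigr => i _; rewrite expr2.
  by rewrite -mulr_natl; field.
rewrite -mulr_sumr.
have -> : \sum_i c i 0 ^+ 2 = dot c c by apply: eq_bigr => i _; rewrite expr2.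
rewrite mulrA -mulrBl ler_wpM2r ?dot_ge0// -addrA -opprD lerD2l lerN2.
have dE : d * r.+1%:R = eta by rewrite divfK// pnatr_eq0.
have : k.+1%:R <= r%:R :> R by rewrite ler_nat.
move: dE; rewrite -[r.+1%:R]natr1; move: d0 (k.+1%:R : R) (r%:R : R) => *; nra.
Qed.

End singular_value_lower.

(** * Overlaps of the singular vectors *)

Section overlap.
Context (R : realType) (m n : nat) (Y : 'M[R]_(m, n)) (U : 'M[R]_m) (s : nat -> R) (V : 'M[R]_n).
Hypothesis svd : is_svd Y U s V.

Lemma dot_sub_sq p (x y : 'cV[R]_p) :
  dot (x - y) (x - y) = dot x x - 2 * dot x y + dot y y.
Proof. rewrite dotDl !dotDr !dotNl !dotNr (dotC y x); ring. Qed.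

(* Expanding in the singular bases, [(s - a) (P + Q)] and [(s + a) (P - Q)] are the
   sum and the difference of the two residuals [s P - a Q] and [s Q - a P]. *)
Lemma approximate_singular_pair (phi : 'cV[R]_m) (psi : 'cV[R]_n) (a d : R) :
  dot phi phi = 1 -> dot psi psi = 1 -> 0 <= a -> 0 <= d ->
  dot (Y *m psi) (Y *m psi) <= (a + d) ^+ 2 ->
  dot (Y^T *m phi) (Y^T *m phi) <= (a + d) ^+ 2 ->
  a - d <= dot phi (Y *m psi) ->
  forall (P : 'cV[R]_n) (Q : 'cV[R]_m), P = V^T *m psi -> Q = U^T *m phi ->
  \sum_(0 <= i < m + n)
    ((sv m n s i - a) ^+ 2 * (ext P i + ext Q i) ^+ 2 + (sv m n s i + a) ^+ 2 * (ext P i - ext Q i) ^+ 2)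
  <= 4 * (4 * a * d + d ^+ 2).
Proof.
move=> p1 q1 a0 d0 h1 h2 h3 P Q PE QE.
have [UU VV _ _ _] := svd.
pose S : 'M[R]_(m, n) := \matrix_(i < m, j < n) (s i *+ (i == j :> nat)).
have e1 : dot (S *m P - a *: Q) (S *m P - a *: Q) <= 4 * a * d + d ^+ 2.
  rewrite PE QE -(svd_mulmx svd) dot_sub_sq !dotZr !dotZl !(dot_left svd) (dotC _ phi) p1.
  have : a * (a - d) <= a * dot phi (Y *m psi) by rewrite ler_wpM2l.
  by move: h1; nra.
have e2 : dot (S^T *m Q - a *: P) (S^T *m Q - a *: P) <= 4 * a * d + d ^+ 2.
  rewrite PE QE -(svd_mulmx_tr svd) dot_sub_sq !dotZr !dotZl !(dot_right svd) q1 -(dot_tr Y phi psi).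
  have : a * (a - d) <= a * dot phi (Y *m psi) by rewrite ler_wpM2l.
  by move: h2; nra.
apply: (@le_trans _ _ (2 * (dot (S *m P - a *: Q) (S *m P - a *: Q) + dot (S^T *m Q - a *: P) (S^T *m Q - a *: P)))); last by lra.
rewrite (dot_ext _ _ (leq_addr n m)) (dot_ext _ _ (leq_addl m n)) -big_split mulr_sumr.
apply: ler_sum => i _; rewrite !extD !extN !extZ ext_singular ext_singular_tr /=.
by rewrite le_eqVlt; apply/orP; left; apply/eqP; ring.
Qed.

(** Small residuals and the isolation of the k-th singular value leave almost no energy of [P] and
    [Q] off index [k]. The terms with [sv + a], bounded below thanks to [gap <= a], force [P] and
    [Q] together, so the left and the right vector share one sign [e]. *)
Lemma isolated_singular_pair (k : nat) (phi : 'cV[R]_m) (psi : 'cV[R]_n) (a d gap eta : R) :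
  dot phi phi = 1 -> dot psi psi = 1 -> 0 < gap -> gap <= a -> 0 <= d -> 0 < eta <= 1 ->
  dot (Y *m psi) (Y *m psi) <= (a + d) ^+ 2 ->
  dot (Y^T *m phi) (Y^T *m phi) <= (a + d) ^+ 2 ->
  a - d <= dot phi (Y *m psi) ->
  (forall i, i != k -> gap <= `|sv m n s i - a|) ->
  2 * (4 * a * d + d ^+ 2) <= gap ^+ 2 * eta ^+ 2 / 2 ->
  exists2 e : R, e = 1 \/ e = -1 &
    (forall i k' : 'I_m, k' = k :> nat -> `|U i k' - e * phi i 0| <= 4 * eta) /\
    (forall i k' : 'I_n, k' = k :> nat -> `|V i k' - e * psi i 0| <= 4 * eta).
Proof.
move=> p1 q1 gap0 gapa d0 /andP[eta0 eta1] h1 h2 h3 hgap small.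
have a0 : 0 <= a by exact: le_trans (ltW gap0) gapa.
pose P := V^T *m psi; pose Q := U^T *m phi.
have tot := approximate_singular_pair p1 q1 a0 d0 h1 h2 h3 (erefl P) (erefl Q).
have [UU VV _ _ _] := svd; have [UU' VV'] := svd_orthogonal svd.
have PP : dot P P = 1 by rewrite (dot_right svd).
have QQ : dot Q Q = 1 by rewrite (dot_left svd).
have g2 : 0 < gap ^+ 2 by rewrite exprn_gt0.
pose T i := (sv m n s i - a) ^+ 2 * (ext P i + ext Q i) ^+ 2 + (sv m n s i + a) ^+ 2 * (ext P i - ext Q i) ^+ 2.
have T0 i : 0 <= T i by rewrite addr_ge0// mulr_ge0// sqr_ge0.
have sa i : gap ^+ 2 <= (sv m n s i + a) ^+ 2.
  have s0 := sv_ge0 svd i.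
  by rewrite ler_pXn2r ?nnegrE ?(ltW gap0) ?addr_ge0// ler_wpDl.
have Toff i : i != k -> gap ^+ 2 * (2 * (ext P i ^+ 2 + ext Q i ^+ 2)) <= T i.
  move=> ik; have s1 : gap ^+ 2 <= (sv m n s i - a) ^+ 2.
    by rewrite -[X in _ <= X]real_normK ?num_real// ler_pXn2r ?nnegrE ?hgap// ltW.
  have b1 : gap ^+ 2 * (ext P i + ext Q i) ^+ 2 <= (sv m n s i - a) ^+ 2 * (ext P i + ext Q i) ^+ 2.
    by rewrite ler_wpM2r// sqr_ge0.
  have b2 : gap ^+ 2 * (ext P i - ext Q i) ^+ 2 <= (sv m n s i + a) ^+ 2 * (ext P i - ext Q i) ^+ 2.
    by rewrite ler_wpM2r// sqr_ge0.
  by rewrite /T; apply: le_trans (lerD b1 b2); rewrite le_eqVlt; apply/orP; left; apply/eqP; ring.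
have tot' : \sum_(0 <= i < m + n) T i <= gap ^+ 2 * eta ^+ 2.
  by apply: le_trans tot _; lra.
have diffk : (k < m + n)%N -> `|ext P k - ext Q k| <= eta.
  move=> kmn; apply: ler_norm_sqr; first exact: ltW.
  rewrite -(ler_pM2l g2); apply: le_trans tot'.
  rewrite (big_rem k)/= ?mem_index_iota//.
  apply: (@le_trans _ _ (T k)); last by rewrite lerDl sumr_ge0.
  apply: (@le_trans _ _ ((sv m n s k + a) ^+ 2 * (ext P k - ext Q k) ^+ 2)).
    by rewrite ler_wpM2r// sqr_ge0.
  by rewrite lerDr mulr_ge0// sqr_ge0.
have offPQ : (k < m + n)%N -> (1 - ext P k ^+ 2) + (1 - ext Q k ^+ 2) <= eta ^+ 2 / 2.
  move=> kmn; rewrite -(ler_pM2l g2).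
  have -> : 1 - ext P k ^+ 2 + (1 - ext Q k ^+ 2) =
      \sum_(0 <= i < m + n | i != k) (ext P i ^+ 2 + ext Q i ^+ 2).
    rewrite -{1}PP -QQ (dot_ext _ _ (leq_addl m n)) (dot_ext _ _ (leq_addr n m)).
    rewrite (bigD1_seq k)/= ?mem_index_iota ?iota_uniq//.
    rewrite [X in _ + (X - _)](bigD1_seq k)/= ?mem_index_iota ?iota_uniq//.
    rewrite -!expr2 big_split/=; under eq_bigr do rewrite -expr2.
    under [X in _ + (_ + X - _)]eq_bigr do rewrite -expr2.
    ring.
  rewrite mulr_sumr; apply: (@le_trans _ _ (2^-1 * \sum_(0 <= i < m + n | i != k) T i)).
    rewrite mulr_sumr; apply: ler_sum => i ik; rewrite ler_pdivlMl// mulrCA; exact: Toff.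
  rewrite [leRHS]mulrA [leRHS]mulrC ler_pM2l ?invr_gt0//; apply: le_trans tot'.
  rewrite [leRHS](bigID (fun i => i != k))/= lerDl; exact: sumr_ge0.
(* Read off [Q] only; at index [k], [P] is within [eta] of [Q], which gives [P] the larger error
   [2 * eta]. *)
pose e : R := if 0 <= ext Q k then 1 else -1.
have e1 : e = 1 \/ e = -1 by rewrite /e; case: ifP; [left|right].
have ee : e * e = 1 by case: e1 => ->; ring.
have eQ : (k < m + n)%N -> `|ext Q k - e| <= eta.
  move=> kmn; have h := offPQ kmn.
  have p0 : ext P k ^+ 2 <= 1 by rewrite -PP sqr_ext_le_dot.
  have q0 : ext Q k ^+ 2 <= 1 by rewrite -QQ sqr_ext_le_dot.
  have qn : `|ext Q k| <= 1 by apply: ler_norm_sqr => //; rewrite expr1n.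
  have q2 : 1 - ext Q k ^+ 2 <= eta by move: eta0 eta1 h; nra.
  rewrite ler_norml; move: qn; rewrite ler_norml => /andP[qa qb].
  by rewrite /e; case: ifPn => [qk|]; [|rewrite -ltNge => qk]; apply/andP; split; nra.
have col_near p (W : 'M[R]_p) (x : 'cV[R]_p) (c : R) : W^T *m W = 1%:M -> W *m W^T = 1%:M ->
    dot x x = 1 -> (k < p)%N -> `|ext (W^T *m x) k - e| <= c -> 1 - ext (W^T *m x) k ^+ 2 <= eta ^+ 2 ->
    forall i k' : 'I_p, k' = k :> nat -> `|W i k' - e * x i 0| <= eta + c.
  move=> WW WW' x1 kp hc hb i k' kk; rewrite -kk ext_ord in hc hb.
  set q := (W^T *m x) k' 0 in hc hb; pose rho := x - q *: col k' W.
  have wk : dot (col k' W) (col k' W) = 1 by rewrite dot_col WW mxE eqxx.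
  have xq : dot x (col k' W) = q.
    by rewrite /q mxE; apply: eq_bigr => l _; rewrite !mxE mulrC.
  have rr : dot rho rho = 1 - q ^+ 2.
    by rewrite dot_sub_sq !dotZr dotZl wk xq x1; ring.
  have rhoi : `|rho i 0| <= eta.
    apply: ler_norm_sqr; first exact: ltW.
    by apply: le_trans (sqr_coord_le_dot rho i) _; rewrite rr.
  have Wi : `|W i k'| <= 1.
    apply: ler_norm_sqr => //; rewrite expr1n -wk.
    by apply: le_trans (sqr_coord_le_dot (col k' W) i); rewrite mxE.
  have -> : W i k' - e * x i 0 = - (e * rho i 0) + e * (e - q) * W i k'.
    by transitivity (e * e * W i k' - e * x i 0); [rewrite ee mul1r|rewrite !mxE; ring].
  have ne : `|e| = 1 by case: e1 => ->; rewrite ?normrN normr1.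
  apply: le_trans (ler_normD _ _) _; rewrite normrN !normrM ne !mul1r; apply: lerD => //.
  by rewrite -[c]mulr1; apply: ler_pM => //; rewrite distrC.
exists e => //; split=> i k' kk.
  have km : (k < m)%N by rewrite -kk.
  have kmn : (k < m + n)%N by rewrite (leq_trans km)// leq_addr.
  have p0 : ext P k ^+ 2 <= 1 by rewrite -PP sqr_ext_le_dot.
  apply: le_trans (col_near _ U phi eta UU UU' p1 km (eQ kmn) _ _ _ kk) _; last by lra.
  by have := offPQ kmn; rewrite -/Q; have := sqr_ge0 eta; lra.
have kn : (k < n)%N by rewrite -kk.
have kmn : (k < m + n)%N by rewrite (leq_trans kn)// leq_addl.
have q0 : ext Q k ^+ 2 <= 1 by rewrite -QQ sqr_ext_le_dot.
apply: le_trans (col_near _ V psi (2 * eta) VV VV' q1 kn _ _ _ _ kk) _; last by lra.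
  rewrite -/P (_ : _ - e = (ext P k - ext Q k) + (ext Q k - e)); last by ring.
  by apply: le_trans (ler_normD _ _) _; rewrite mulr_natl mulr2n lerD// ?diffk ?eQ.
by have := offPQ kmn; rewrite -/P; have := sqr_ge0 eta; lra.
Qed.
End overlap.

Section supercritical.
Context (R : realType) (r : nat) (t : nat -> R) (g : R).
Hypotheses (r0 : (0 < r)%N) (g0 : 0 <= g).
Hypothesis t_ge_r : forall i, (r <= i)%N -> t i = 0.
Hypothesis t_gt0 : forall i, (i < r)%N -> 0 < t i.
Hypothesis t_decr : forall i j, (i < j)%N -> (j < r)%N -> t j < t i.

Local Notation eventually Q := (@eventually_banded R r g Q).

Definition left_overlap k : R :=
  if Num.sqrt g < t k then Num.sqrt ((1 - g ^+ 2 / t k ^+ 4) / (1 + g ^+ 2 / t k ^+ 2)) else 0.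
Definition right_overlap k : R :=
  if Num.sqrt g < t k then Num.sqrt ((1 - g ^+ 2 / t k ^+ 4) / (1 + 1 / t k ^+ 2)) else 0.

(** From below, the next singular value is bounded through a [tau] halfway between [t k] and the
    larger of [t k.+1] and sqrt g. From above, the previous one is near the edge of a larger spike;
    for [k = 0] the value 1 of [ga] is a placeholder. The last term of the minimum secures
    [gap <= edge]. *)
Lemma eventually_gap k : (k < r)%N -> Num.sqrt g < t k ->
  exists gap, 0 < gap <= edge g (eff t g k) /\
  eventually (fun m n B => forall U s V, is_svd (spiked t B) U s V ->
    forall i, i != k -> gap <= `|sv m n s i - edge g (eff t g k)|).
Proof.
move=> kr gt; have ek := eff_gt0 g t_gt0 kr; have sg := eff_sqr t g0 k.
have eE : eff t g k = t k by rewrite /eff max_l// ltW.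
pose mx := Num.max (t k.+1) (Num.sqrt g).
have mx0 : 0 <= mx by rewrite le_max sqrtr_ge0 orbT.
have mxt : mx < t k.
  rewrite gt_max gt andbT; have [h|h] := ltnP k.+1 r; first exact: t_decr.
  by rewrite t_ge_r// t_gt0.
pose tau := (mx + t k) / 2.
have tk := t_gt0 kr.
have tau0 : 0 < tau by rewrite /tau; lra.
have mxtau : mx <= tau by rewrite /tau; lra.
have taut : tau < t k by rewrite /tau; lra.
have gtau : g <= tau ^+ 2.
  rewrite -[g in X in X <= _]sqr_sqrtr// ler_pXn2r ?nnegrE ?sqrtr_ge0 ?(ltW tau0)//.
  by apply: le_trans mxtau; rewrite le_max lexx orbT.
have tktau : t k.+1 <= tau by apply: le_trans mxtau; rewrite le_max lexx.
pose gb := edge g (eff t g k) - edge g tau.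
have gb0 : 0 < gb by rewrite subr_gt0 eE; exact: edge_lt.
pose ga := if (0 < k)%N then edge g (eff t g k.-1) - edge g (eff t g k) else 1.
have ga0 : 0 < ga.
  rewrite /ga; case: ifPn => // k0.
  rewrite subr_gt0; apply: edge_lt => //; rewrite eE.
  by rewrite lt_max t_decr// prednK.
exists (Num.min (ga / 2) (Num.min (gb / 2) (edge g (eff t g k)))); split.
  by rewrite !lt_min !divr_gt0// edge_gt0//= !ge_min lexx !orbT.
have h1 := eventually_sv_upper r0 t_ge_r t_gt0 t_decr (k := k.+1) (divr_gt0 gb0 (ltr0Sn R 1)) tau0 gtau tktau.
have h2 := eventually_sv_lower r0 g0 t_ge_r t_gt0 t_decr (divr_gt0 ga0 (ltr0Sn R 1)).
apply: eventually_banded_imp (eventually_banded_and h1 h2) => m n B [{}h1 {}h2] U s V svd i ik.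
have [lt_ik|] := ltnP i k.
  rewrite ge_min; apply/orP; left; apply: le_trans (ler_norm _).
  have k0 : (0 < k)%N by exact: leq_ltn_trans lt_ik.
  have := h2 _ _ _ svd k.-1 (leq_ltn_trans (leq_pred k) kr); rewrite /ga k0.
  have := sv_le svd (i := i) (j := k.-1); rewrite -ltnS prednK// => /(_ lt_ik); lra.
rewrite leq_eqVlt eq_sym (negbTE ik) /= => ki.
rewrite !ge_min; apply/orP; right; apply/orP; left; rewrite distrC; apply: le_trans (ler_norm _).
have := h1 _ _ _ svd; have := sv_le svd ki; rewrite /gb; lra.
Qed.

(** Trial vectors of chain [k] vanish before index [k], so [eventually_tail_norm] bounds the matrix
    on them by [a + d] even when larger singular values exist. With a form of at least [a - d] this
    makes the residuals small. Among the first [r] coordinates of a trial vector only the k-th is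
    nonzero, and it tends to the overlap. *)
Lemma eventually_overlap_super k eta : (k < r)%N -> Num.sqrt g < t k -> 0 < eta ->
  eventually (fun m n B => forall U s V, is_svd (spiked t B) U s V ->
    exists2 e : R, e = 1 \/ e = -1 &
    (forall i k' : 'I_m, k' = k :> nat -> (i < r)%N ->
       `|U i k' - e * left_overlap k * (i == k :> nat)%:R| <= eta) /\
    (forall i k' : 'I_n, k' = k :> nat -> (i < r)%N ->
       `|V i k' - e * right_overlap k * (i == k :> nat)%:R| <= eta)).
Proof.
move=> kr gt eta0; have ek := eff_gt0 g t_gt0 kr; have sg := eff_sqr t g0 k.
have [gap [/andP[gap0 gapa] hgap]] := eventually_gap kr gt.
set a := edge g (eff t g k) in gapa hgap.
have a0 : 0 < a by exact: lt_le_trans gapa.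
pose eta' := Num.min 1 (eta / 8).
have eta'0 : 0 < eta' by rewrite lt_min ltr01 divr_gt0.
have eta'1 : eta' <= 1 by rewrite ge_min lexx.
have eta'e : 4 * eta' <= eta / 2.
  have : eta' <= eta / 8 by rewrite ge_min lexx orbT.
  lra.
pose w := gap ^+ 2 * eta' ^+ 2.
have w0 : 0 < w by rewrite mulr_gt0 ?exprn_gt0.
(* As [d <= 1], 2 (4 a d + d^2) <= 2 d (4 a + 1) <= w / 2. *)
pose d := Num.min 1 (w / (4 * (4 * a + 1))).
have a4 : 0 < 4 * (4 * a + 1) by lra.
have d0 : 0 < d by rewrite lt_min ltr01 divr_gt0.
have d1 : d <= 1 by rewrite ge_min lexx.
have dw : d * (4 * (4 * a + 1)) <= w by rewrite -ler_pdivlMr// ge_min lexx orbT.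
have small : 2 * (4 * a * d + d ^+ 2) <= gap ^+ 2 * eta' ^+ 2 / 2.
  rewrite -/w; move: dw d1 d0 w0; nra.
have d20 : 0 < d / 2 by rewrite divr_gt0.
have eta20 : 0 < eta / 2 by rewrite divr_gt0.
have [L [hL1 hL2 hL3]] : exists L, [/\ defect t g k L <= d / 2,
   `|left_weight t g k L 0 - left_overlap k| <= eta / 2 &
   `|right_weight t g k L 0 - right_overlap k| <= eta / 2].
  rewrite /left_overlap /right_overlap gt.
  have := cvg_left_weight g0 t_gt0 kr gt => /cvgrPdist_le /(_ _ eta20) l1.
  have := cvg_right_weight g0 t_gt0 kr gt => /cvgrPdist_le /(_ _ eta20) l2.
  have l3 := near_defect g0 t_gt0 kr d20.
  have [L _ /(_ L (leqnn L)) [[q1 q2] q3]] := filterI (filterI l1 l2) l3.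
  by exists L; split => //; rewrite distrC.
have h1 := eventually_tail_norm r0 t_ge_r t_gt0 t_decr (k := k) d0 ek sg.
have {}h1 := h1 (_ : t k <= eff t g k); have te : t k <= eff t g k by rewrite le_max lexx.
have {}h1 := h1 te.
have h2 := eventually_trial_form g r0 t_ge_r t_gt0 L d20.
apply: eventually_banded_imp (eventually_banded_and hgap (eventually_banded_and h1 h2)).
move=> m n B [{}hgap [[h3 h4] [Lm Ln h5]]] U s V svd.
have unitl : dot (left_trial r t g m k L) (left_trial r t g m k L) = 1.
  exact: (left_trial_dot _ _ r0).
have unitr : dot (right_trial r t g n k L) (right_trial r t g n k L) = 1.
  by rewrite (chain_dot r0)// eqxx mul1r -[RHS](sum_right_weight g t_gt0 L kr); apply: eq_bigr => l _; rewrite expr2.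
have vanish p (f : nat -> R) (j : 'I_p) : (j < k)%N -> chain r p k L.*2.+2 f j 0 = 0.
  by move=> jk; rewrite -[LHS]ext_ord ext_chain_lt.
have head p (f : nat -> R) (j : 'I_p) : (j < r)%N -> chain r p k L.*2.+2 f j 0 = f 0%N * (j == k :> nat)%:R.
  by move=> jr; rewrite -[LHS]ext_ord (ext_chain_head r0).
have b1 := h3 (right_trial r t g n k L) (vanish _ _).
have b2 := h4 (left_trial r t g m k L) (vanish _ _).
rewrite unitr mulr1 in b1; rewrite unitl mulr1 in b2.
have b3 : a - d <= dot (left_trial r t g m k L) (spiked t B *m right_trial r t g n k L).
  have := h5 k k kr kr; rewrite eqxx mul1r ler_norml => /andP[z _]; move: z hL1; rewrite -/a; lra.
have [e e1 [q1 q2]] := isolated_singular_pair svd unitl unitr gap0 gapa (ltW d0)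
  (introT andP (conj eta'0 eta'1)) b1 b2 b3 (hgap _ _ _ svd) small.
have ne : `|e| = 1 by case: e1 => ->; rewrite ?normrN normr1.
have fin (x y w1 w2 b : R) : `|x - e * y| <= 4 * eta' -> y = w1 * b -> `|w1 - w2| <= eta / 2 -> `|b| <= 1 ->
    `|x - e * w2 * b| <= eta.
  move=> z1 yE z2 z3; rewrite {}yE in z1.
  rewrite (_ : x - _ = (x - e * (w1 * b)) + e * ((w1 - w2) * b)); last by ring.
  apply: le_trans (ler_normD _ _) _; rewrite [X in _ + X]normrM ne mul1r normrM.
  have : `|w1 - w2| * `|b| <= eta / 2 * 1 by apply: ler_pM.
  by rewrite mulr1; move: z1 eta'e; rewrite ?mulrA; lra.
have bb (b : bool) : `|b%:R : R| <= 1 by case: b; rewrite ?normr1 ?normr0.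
exists e => //; split=> i k' kk ir.
  by apply: fin (q1 i k' kk) _ hL2 (bb _); exact: head.
by apply: fin (q2 i k' kk) _ hL3 (bb _); exact: head.
Qed.

End supercritical.

Section second_differences.
Context (R : realType).

Lemma second_difference_drift (x : nat -> R) (J : nat) (e : R) : 0 <= e ->
  (forall j, (0 < j < J)%N -> `|x j.+1 - 2 * x j + x j.-1| <= e) ->
  forall j, (j <= J)%N -> `|x j - x 0%N - j%:R * (x 1%N - x 0%N)| <= j%:R ^+ 2 * e.
Proof.
move=> e0 h; have step j : (j < J)%N -> `|x j.+1 - x j - (x 1%N - x 0%N)| <= j%:R * e.
  elim: j => [|j IH] jJ; first by rewrite subrr normr0 mul0r.
  rewrite (_ : _ - (x 1%N - x 0%N) = (x j.+1 - x j - (x 1%N - x 0%N)) + (x j.+2 - 2 * x j.+1 + x j)); last by ring.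
  apply: le_trans (ler_normD _ _) _; rewrite -[j.+1%:R]natr1 [(_ + 1) * e]mulrDl mul1r.
  by apply: lerD; [exact: IH (ltnW jJ)|exact: h].
elim=> [|j IH] jJ; first by rewrite subrr mul0r subr0 normr0 expr0n mul0r.
rewrite (_ : _ - _ = (x j.+1 - x j - (x 1%N - x 0%N)) + (x j - x 0%N - j%:R * (x 1%N - x 0%N))); last first.
  by rewrite -[j.+1%:R]natr1; ring.
apply: le_trans (ler_normD _ _) _; apply: le_trans (lerD (step _ jJ) (IH (ltnW jJ))) _.
rewrite -mulrDl ler_wpM2r// -[j.+1%:R]natr1; have : 0 <= j%:R :> R by []; nra.
Qed.

(** The deviation from a straight line is at most J^2 e <= 1 up to [J], so a sequence bounded by 1
    has initial slope at most 3 / J. *)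
Lemma second_difference_flat (x : nat -> R) (J : nat) (e : R) : (0 < J)%N -> 0 <= e ->
  J%:R ^+ 2 * e <= 1 -> (forall j, (j <= J)%N -> `|x j| <= 1) ->
  (forall j, (0 < j < J)%N -> `|x j.+1 - 2 * x j + x j.-1| <= e) ->
  forall j, (j <= J)%N -> `|x j - x 0%N| <= 4 * j%:R / J%:R.
Proof.
move=> J0 e0 eJ x1 h j jJ; have drift := second_difference_drift e0 h.
have Jp : 0 < J%:R :> R by rewrite ltr0n.
set D := x 1%N - x 0%N in drift.
have hD : J%:R * `|D| <= 3.
  rewrite (_ : J%:R * `|D| = `|J%:R * D|); last by rewrite normrM ger0_norm// ltW.
  rewrite (_ : J%:R * D = (x J - x 0%N) - (x J - x 0%N - J%:R * D)); last by ring.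
  apply: le_trans (ler_normB _ _) _; have := drift J (leqnn J).
  have := ler_normB (x J) (x 0%N); have := x1 J (leqnn J); have := x1 0%N (leq0n J); lra.
have jR : j%:R <= J%:R :> R by rewrite ler_nat.
have j0 : 0 <= j%:R :> R by [].
rewrite ler_pdivlMr//.
rewrite (_ : x j - x 0%N = (x j - x 0%N - j%:R * D) + j%:R * D); last by ring.
apply: le_trans (ler_wpM2r (ltW Jp) (ler_normD _ _)) _.
rewrite normrM [`|j%:R|]ger0_norm//.
have h1 := drift j jJ.
have h2 : j%:R ^+ 2 * e * J%:R <= j%:R.
  rewrite (_ : _ * J%:R = j%:R * (j%:R * J%:R * e)); last by ring.
  rewrite -[leRHS]mulr1 ler_wpM2l//; apply: le_trans eJ.
  by rewrite ler_wpM2r// expr2 ler_wpM2r// ltW.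
have h3 : j%:R * `|D| * J%:R <= j%:R * 3 by rewrite -mulrA ler_wpM2l// mulrC.
have h4 := ler_wpM2r (ltW Jp) h1.
rewrite mulrDl; lra.
Qed.

(* A bounded sequence with tiny second differences is nearly constant, and a nearly
   constant sequence of bounded energy starts near zero. *)
Lemma second_difference_start (eta : R) : 0 < eta ->
  exists ell J e, [/\ (ell <= J)%N, 0 < e & forall x : nat -> R,
    (forall j, (j <= J)%N -> `|x j| <= 1) -> \sum_(j < ell) x j ^+ 2 <= 1 ->
    (forall j, (0 < j < J)%N -> `|x j.+1 - 2 * x j + x j.-1| <= e) -> `|x 0%N| <= eta].
Proof.
(* More than 4 / eta^2 values of total energy at most 1 include one of size at most eta / 2; with J
   > 8 ell / eta the sequence moves by at most eta / 2 over the first [ell] indices. *)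
move=> eta0; pose ell := (Num.truncn (4 / eta ^+ 2)).+1.
have ell_big : 4 / eta ^+ 2 < ell%:R by rewrite truncnS_gt.
pose J := maxn ell (Num.truncn (8 * ell%:R / eta)).+1.
have J_big : 8 * ell%:R / eta < J%:R.
  by apply: lt_le_trans (truncnS_gt _) _; rewrite ler_nat leq_maxr.
have J0 : (0 < J)%N by rewrite leq_max ltnS leq0n.
have Jp : 0 < J%:R :> R by rewrite ltr0n.
have lp : 0 < ell%:R :> R by rewrite ltr0n.
exists ell, J, (J%:R ^- 2); split; [exact: leq_maxl|by rewrite invr_gt0 exprn_gt0|].
move=> x x1 xs xd.
have flat := @second_difference_flat x J (J%:R ^- 2) J0 _ _ x1 xd.
have {}flat j : (j < ell)%N -> `|x j - x 0%N| <= eta / 2.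
  move=> jl; have jJ : (j <= J)%N by rewrite (leq_trans (ltnW jl))// leq_maxl.
  apply: le_trans (flat _ _ j jJ) _; first by rewrite invr_ge0 sqr_ge0.
    by rewrite mulfV// expf_neq0// gt_eqF.
  rewrite ler_pdivrMr// mulrAC ler_pdivlMr//.
  have : j%:R <= ell%:R :> R by rewrite ler_nat ltnW.
  by move: J_big; rewrite ltr_pdivrMr//; lra.
have [j jl xj] : exists2 j, (j < ell)%N & `|x j| <= eta / 2.
  apply: contrapT => no.
  have big (j : 'I_ell) : eta ^+ 2 / 4 < x j ^+ 2.
    rewrite ltNge; apply/negP => h; apply: no; exists j => //.
    apply: ler_norm_sqr; first by rewrite divr_ge0// ltW.
    by apply: le_trans h _; rewrite expr_div_n; lra.
  have : ell%:R * (eta ^+ 2 / 4) <= 1.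
    apply: le_trans xs; rewrite mulr_natl -[ell in X in X <= _]card_ord -sumr_const.
    by apply: ler_sum => j _; exact: ltW.
  have e2 : 0 < eta ^+ 2 by rewrite exprn_gt0.
  by move: ell_big; rewrite ltr_pdivrMr//; lra.
rewrite (_ : x 0%N = x j - (x j - x 0%N)); last by ring.
by apply: le_trans (ler_normB _ _) _; have := flat j jl; lra.
Qed.

End second_differences.

(** * Delocalization at the bulk edge *)

Section subcritical.
Context (R : realType) (r : nat) (t : nat -> R) (g : R).
Hypotheses (r0 : (0 < r)%N) (g0 : 0 <= g).
Hypothesis t_ge_r : forall i, (r <= i)%N -> t i = 0.
Hypothesis t_gt0 : forall i, (i < r)%N -> 0 < t i.
Hypothesis t_decr : forall i j, (i < j)%N -> (j < r)%N -> t j < t i.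

Local Notation eventually Q := (@eventually_banded R r g Q).

Lemma ext_norm_le1 n (y : 'cV[R]_n) i : dot y y = 1 -> `|ext y i| <= 1.
Proof. by move=> y1; apply: ler_norm_sqr => //; rewrite expr1n -y1 sqr_ext_le_dot. Qed.

Lemma ext_mulmx_near m n N (A : 'M[R]_(m, n)) (y : 'cV[R]_n) (a : nat) (M : nat -> R) eps :
  dot y y = 1 -> (N <= n)%N -> (a < m)%N ->
  (forall (a' : 'I_m) (j : 'I_n), a' = a :> nat -> `|A a' j - M j| <= eps *+ (j < N)%N) ->
  `|ext (A *m y) a - \sum_(j < n) ext y j * M j| <= N%:R * eps.
Proof.
move=> y1 Nn am hA; rewrite -[a in ext _ a]/(val (Ordinal am)) ext_ord mxE -sumrB.
apply: le_trans (ler_norm_sum _ _ _) _.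
have -> : N%:R * eps = \sum_(j < n) (if (j < N)%N then eps else 0).
  by rewrite -big_mkcond -(big_ord_widen n (fun=> eps) Nn) sumr_const card_ord mulr_natl.
apply: ler_sum => j _; rewrite ext_ord [y j 0 * _]mulrC -mulrBl normrM.
have := hA (Ordinal am) j erefl; case: ifP => _ h; last first.
  by rewrite mulr0n in h; rewrite (le_anti (introT andP (conj h (normr_ge0 _)))) mul0r.
rewrite -[eps]mulr1; apply: ler_pM => //.
by rewrite -ext_ord ext_norm_le1.
Qed.

Lemma sum_shift_pick n (y : 'cV[R]_n) a : \sum_(j < n) ext y j * (j == a :> nat)%:R = ext y a.
Proof.
by rewrite -dot_basis; apply: eq_bigr => j _; rewrite ext_ord mxE.
Qed.

(** A row [a >= r] carries no spike, and for [a + r < N] its nonzero entries all lie in the corner,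
    where they are near the model. *)
Lemma spiked_row m n (B : 'M[R]_(m, n)) (y : 'cV[R]_n) N eps a :
  0 <= eps -> dot y y = 1 -> band_near r g eps N B -> (r <= a)%N -> (a + r < N)%N ->
  `|ext (spiked t B *m y) a - (ext y (a + r)%N + g * ext y (a - r)%N)| <= N%:R * eps.
Proof.
move=> e0 y1 hB ra aN; have [Nm Nn hB'] := hB.
have aN' : (a < N)%N by exact: leq_ltn_trans (leq_addr r a) aN.
have -> : ext y (a + r)%N + g * ext y (a - r)%N = \sum_(j < n) ext y j * model r t g a j.
  rewrite -!sum_shift_pick mulr_sumr -big_split; apply: eq_bigr => j _ /=.
  rewrite /model t_ge_r// mul0rn add0r.
  have -> : (j == (a - r)%N :> nat) = (a == (j + r)%N).
    by rewrite -(eqn_add2r r) subnK// eq_sym.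
  by case: (a == _); rewrite ?mulr1n ?mulr0n /=; ring.
apply: ext_mulmx_near => //; first exact: leq_trans Nm.
move=> a' j aa; rewrite -aa; have [jN|Nj] := ltnP j N.
  by rewrite mulr1n; apply: (spiked_near_model t r0 e0 hB) => //; rewrite aa.
have aj : (a' + r < j)%N by rewrite aa (leq_trans aN).
have [z _ _ _] := hB' a' j.
rewrite !mxE z ?aj// mulr0n addr0 /model.
have n1 : (a' == j :> nat) = false by rewrite ltn_eqF// (leq_ltn_trans _ aj)// leq_addr.
have n2 : (j == (a' + r)%N :> nat) = false by rewrite gtn_eqF.
have n3 : (a' == (j + r)%N :> nat) = false.
  by rewrite ltn_eqF// ltn_addr// (leq_ltn_trans _ aj)// leq_addr.
by rewrite n1 n2 n3 !mulr0n !addr0 subrr normr0.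
Qed.

Lemma spiked_col m n (B : 'M[R]_(m, n)) (x : 'cV[R]_m) N eps a :
  0 <= eps -> dot x x = 1 -> band_near r g eps N B -> (r <= a)%N -> (a + r < N)%N ->
  `|ext ((spiked t B)^T *m x) a - (ext x (a - r)%N + g * ext x (a + r)%N)| <= N%:R * eps.
Proof.
move=> e0 x1 hB ra aN; have [Nm Nn hB'] := hB.
have aN' : (a < N)%N by exact: leq_ltn_trans (leq_addr r a) aN.
have -> : ext x (a - r)%N + g * ext x (a + r)%N = \sum_(j < m) ext x j * model r t g j a.
  rewrite -!sum_shift_pick mulr_sumr -big_split; apply: eq_bigr => j _ /=.
  have -> : (j == (a - r)%N :> nat) = (a == (j + r)%N).
    by rewrite -(eqn_add2r r) subnK// eq_sym.
  rewrite /model (_ : t j *+ _ = 0); last first.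
    have [->|_] := eqVneq (j : nat) a; last exact: mulr0n.
    by rewrite t_ge_r// mul0rn.
  by case: (j == _ :> nat); rewrite ?mulr1n ?mulr0n /=; ring.
apply: (ext_mulmx_near (M := fun j => model r t g j a) x1 Nm); first exact: leq_trans Nn.
move=> a' j aa; rewrite -aa mxE; have [jN|Nj] := ltnP j N.
  by rewrite mulr1n; apply: (spiked_near_model t r0 e0 hB) => //; rewrite aa.
have aj : (a' + r < j)%N by rewrite aa (leq_trans aN).
have [z _ _ _] := hB' j a'.
rewrite !mxE z ?aj ?orbT// mulr0n addr0 /model.
have n1 : (j == a' :> nat) = false by rewrite gtn_eqF// (leq_ltn_trans _ aj)// leq_addr.
have n2 : (j == (a' + r)%N :> nat) = false by rewrite gtn_eqF.
have n3 : (a' == (j + r)%N :> nat) = false.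
  by rewrite ltn_eqF// ltn_addr// (leq_ltn_trans _ aj)// leq_addr.
by rewrite n1 n2 n3 !mulr0n !addr0 subrr normr0.
Qed.

(** Bessel's inequality for the unit vectors at stride [2 r]. *)
Lemma stride_energy n (x : 'cV[R]_n) i ell : (i < r)%N -> (ell * r.*2 <= n)%N ->
  \sum_(l < ell) ext x (i + l * r.*2) ^+ 2 <= dot x x.
Proof.
move=> ir ln; pose f l := ext x (i + l * r.*2)%N.
have i2 : (i < r.*2)%N by rewrite (leq_trans ir)// -addnn leq_addr.
have r20 : (0 < r.*2)%N by rewrite double_gt0.
have zz : dot (chain r.*2 n i ell f) (chain r.*2 n i ell f) = \sum_(l < ell) f l ^+ 2.
  by rewrite (chain_dot r20)// eqxx mul1r; apply: eq_bigr => l _; rewrite expr2.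
have xz : dot x (chain r.*2 n i ell f) = \sum_(l < ell) f l ^+ 2.
  by rewrite dot_sumr; apply: eq_bigr => l _; rewrite dotZr dot_basis expr2.
have := cauchy_schwarz x (chain r.*2 n i ell f); rewrite xz zz expr2.
set S := \sum_(l < ell) _; have S0 : 0 <= S by apply: sumr_ge0 => l _; exact: sqr_ge0.
have [->|Sn] := eqVneq S 0; first by rewrite dot_ge0.
by rewrite ler_pM2r// lt_neqAle eq_sym Sn.
Qed.

(* At the edge [1 + g] the characteristic roots of the band recurrence collapse to a
   double root, so along every second chain index the singular vectors are almost
   affine. *)
Lemma eventually_delocalized eta : 0 < g -> 0 < eta ->
  exists2 d, 0 < d & eventually (fun m n B => forall (x : 'cV[R]_m) (y : 'cV[R]_n) s,
    dot x x = 1 -> dot y y = 1 -> spiked t B *m y = s *: x -> (spiked t B)^T *m x = s *: y ->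
    `|s - (1 + g)| <= d -> forall i, (i < r)%N -> `|ext x i| <= eta /\ `|ext y i| <= eta).
Proof.
(* The column relation at l + 3, plus [g] times the one at l + 1, plus [1 + g] times the row
   relation at l + 2, is [g] times the second difference u(l+4) - 2 u(l+2) + u(l). The coefficients
   add up to [2 + 2 * g], which fixes [e1]. For [v] rows and columns change places. *)
move=> gp eta0; have [ell [J [e [lJ e0 H]]]] := second_difference_start eta0.
pose e1 := e * g / (2 + 2 * g).
have gg : 0 < 2 + 2 * g by lra.
have e10 : 0 < e1 by rewrite divr_gt0// mulr_gt0.
pose N := (J.*2.+1 * r)%N.
have N0 : (0 < N)%N by rewrite muln_gt0.
pose eps := e1 / 2 / N%:R.
have eps0 : 0 < eps by apply: divr_gt0; [exact: divr_gt0|rewrite ltr0n].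
have NE : N%:R * eps = e1 / 2 by rewrite mulrC divfK// pnatr_eq0 -lt0n.
exists (e1 / 2); first by rewrite divr_gt0.
exists eps, N; split => // m n B hB x y s x1 y1 Yy Yx sd i ir.
have [Nm Nn _] := hB.
pose u l := ext x (i + l * r)%N; pose v l := ext y (i + l * r)%N.
have near_s z : `|z| <= 1 -> `|s * z - (1 + g) * z| <= e1 / 2.
  move=> z1; rewrite -mulrBl normrM -[leRHS]mulr1; exact: ler_pM.
have idx l : (0 < l < J.*2)%N -> [/\ (r <= i + l * r)%N, (i + l * r + r < N)%N,
    (i + l * r - r = i + l.-1 * r)%N & (i + l * r + r = i + l.+1 * r)%N].
  move=> /andP[l0 lJ2]; split.
  - by rewrite (leq_trans _ (leq_addl _ _))// leq_pmull.
  - rewrite -addnA -mulSnr /N; apply: (@leq_trans (l.+2 * r)%N).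
      by rewrite mulSn ltn_add2r.
    by rewrite leq_mul2r ltnS lJ2 orbT.
  - by case: l l0 {lJ2} => // l _; rewrite mulSnr addnA addnK.
  - by rewrite -addnA -mulSnr.
have rowE l : (0 < l < J.*2)%N -> `|v l.+1 + g * v l.-1 - (1 + g) * u l| <= e1.
  move=> hl; have [h1 h2 h3 h4] := idx l hl.
  have := spiked_row (ltW eps0) y1 hB h1 h2; rewrite Yy extZ NE h3 h4 -/(u l) -/(v l.+1) -/(v l.-1) => q1.
  have q2 := near_s (u l) (ext_norm_le1 _ x1).
  rewrite (_ : _ - _ = (s * u l - (1 + g) * u l) - (s * u l - (v l.+1 + g * v l.-1))); last by ring.
  by apply: le_trans (ler_normB _ _) _; lra.
have colE l : (0 < l < J.*2)%N -> `|u l.-1 + g * u l.+1 - (1 + g) * v l| <= e1.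
  move=> hl; have [h1 h2 h3 h4] := idx l hl.
  have := spiked_col (ltW eps0) x1 hB h1 h2; rewrite Yx extZ NE h3 h4 -/(v l) -/(u l.+1) -/(u l.-1) => q1.
  have q2 := near_s (v l) (ext_norm_le1 _ y1).
  rewrite (_ : _ - _ = (s * v l - (1 + g) * v l) - (s * v l - (u l.-1 + g * u l.+1))); last by ring.
  by apply: le_trans (ler_normB _ _) _; lra.
have e1E : e1 * (2 + 2 * g) = e * g by rewrite divfK// gt_eqF.
have comb (a b c d : R) : g * d = a + g * b + (1 + g) * c -> `|a| <= e1 -> `|b| <= e1 -> `|c| <= e1 -> `|d| <= e.
  move=> dE a1 b1 c1; rewrite -(ler_pM2r gp) -e1E -[g in X in X <= _](ger0_norm g0) -normrM mulrC dE.
  apply: le_trans (ler_normD _ _) _; apply: le_trans (lerD (ler_normD _ _) (lexx _)) _.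
  rewrite !normrM [`|g|]ger0_norm// [`|1 + g|]ger0_norm ?addr_ge0//.
  have : g * `|b| <= g * e1 by rewrite ler_pM2l.
  have : (1 + g) * `|c| <= (1 + g) * e1 by rewrite ler_pM2l// addr_gt0.
  lra.
have idx2 j : (0 < j < J)%N -> exists l, [/\ j.*2 = l.+2, j.+1.*2 = l.+4, j.-1.*2 = l &
     [/\ (0 < l.+1 < J.*2)%N, (0 < l.+2 < J.*2)%N & (0 < l.+3 < J.*2)%N]].
  case: j => // j jJ; exists j.*2; split => //; rewrite !ltnS !leq0n /=.
  have : (j.+2.*2 <= J.*2)%N by rewrite leq_double.
  rewrite !doubleS => h; split => //; [exact: ltnW (ltnW h)|exact: ltnW].
have stride j : (i + j * r.*2 = i + j.*2 * r)%N by rewrite -!muln2 -mulnA (mulnC r).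
have lN p : (N <= p)%N -> (ell * r.*2 <= p)%N.
  move=> Np; apply: leq_trans Np; rewrite -doubleMr doubleMl /N leq_mul2r; apply/orP; right.
  by rewrite ltnW// ltnS leq_double.
have start (z : nat -> R) : (forall l, `|z l| <= 1) -> \sum_(j < ell) z j.*2 ^+ 2 <= 1 ->
   (forall l, (0 < l.+1 < J.*2)%N -> (0 < l.+2 < J.*2)%N -> (0 < l.+3 < J.*2)%N ->
      `|z l.+4 - 2 * z l.+2 + z l| <= e) -> `|z 0%N| <= eta.
  move=> z1 zs zd; apply: (H (fun j => z j.*2)) => // j /idx2 [l [-> -> -> [? ? ?]]].
  exact: zd.
have i0 : (i + 0 * r = i)%N by rewrite mul0n addn0.
split.
  rewrite -i0; apply: (start u) => [l||l l1 l2 l3]; first exact: ext_norm_le1.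
    rewrite -[leRHS]x1; apply: le_trans (stride_energy x ir (lN m Nm)).
    by apply: ler_sum => j _; rewrite stride.
  apply: (comb _ _ _ _ _ (colE _ l3) (colE _ l1) (rowE _ l2)) => /=; ring.
rewrite -i0; apply: (start v) => [l||l l1 l2 l3]; first exact: ext_norm_le1.
  rewrite -[leRHS]y1; apply: le_trans (stride_energy y ir (lN n Nn)).
  by apply: ler_sum => j _; rewrite stride.
apply: (comb _ _ _ _ _ (rowE _ l1) (rowE _ l3) (colE _ l2)) => /=; ring.
Qed.

Lemma singular_pair m n (Y : 'M[R]_(m, n)) U s V (k : nat) (i : 'I_m) (j : 'I_n) :
  is_svd Y U s V -> i = k :> nat -> j = k :> nat ->
  Y *m col j V = sv m n s k *: col i U /\ Y^T *m col i U = sv m n s k *: col j V.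
Proof.
move=> svd ik jk; have [UU VV _ _ _] := svd.
have sk : sv m n s k = s k by rewrite /sv ltn_min -{1}ik -jk !ltn_ord.
have vals a b : (\matrix_(i < m, j < n) (s i *+ (i == j :> nat))) a b = s a *+ (a == b :> nat) by rewrite mxE.
have := svdE svd; move: (\matrix_(i, j) _) vals => S SE YE; rewrite sk.
split; apply/matrixP => b z; rewrite (ord1 z) [RHS]mxE [in RHS]mxE.
  transitivity ((Y *m V) b j); first by rewrite !mxE; apply: eq_bigr => l _; rewrite mxE.
  rewrite YE -mulmxA VV mulmx1 mxE (bigD1 i)//= SE ik jk eqxx mulr1n mulrC big1 ?addr0// => l.
  by rewrite -val_eqE /= SE jk ik => /negbTE ->; rewrite mulr0n mulr0.
transitivity ((Y^T *m U) b i); first by rewrite !mxE; apply: eq_bigr => l _; rewrite !mxE.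
rewrite YE !trmx_mul trmxK -!mulmxA UU mulmx1 mxE (bigD1 j)//= mxE SE ik jk eqxx mulr1n mulrC.
rewrite big1 ?addr0// => l; rewrite -val_eqE /= mxE SE jk ik eq_sym => /negbTE ->.
by rewrite mulr0n mulr0.
Qed.

(** Here [eff] is sqrt g, so the upper and lower bounds pin the k-th singular value to 1 + g, and
    delocalization applies to the exact singular vectors. The spike forces [0 < g], by which the
    recurrence is divided. *)
Lemma eventually_overlap_sub k eta : (k < r)%N -> t k <= Num.sqrt g -> 0 < eta ->
  eventually (fun m n B => forall U s V, is_svd (spiked t B) U s V ->
    (forall i k' : 'I_m, k' = k :> nat -> (i < r)%N -> `|U i k'| <= eta) /\
    (forall i k' : 'I_n, k' = k :> nat -> (i < r)%N -> `|V i k'| <= eta)).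
Proof.
move=> kr tg eta0; have ek := eff_gt0 g t_gt0 kr; have sg := eff_sqr t g0 k.
have gp : 0 < g by rewrite -sqrtr_gt0; exact: lt_le_trans (t_gt0 kr) tg.
have eE : edge g (eff t g k) = 1 + g.
  rewrite /edge /eff max_r// sqr_sqrtr// -[RHS]ger0_norm ?addr_ge0// -sqrtr_sqr.
  by congr Num.sqrt; field; rewrite gt_eqF.
have [d d0 hd] := eventually_delocalized gp eta0.
have te : t k <= eff t g k by rewrite le_max lexx.
have h1 := eventually_sv_upper r0 t_ge_r t_gt0 t_decr d0 ek sg te.
have h2 := eventually_sv_lower r0 g0 t_ge_r t_gt0 t_decr d0.
have h3 := eventually_band_near r g r ltr01.
apply: eventually_banded_imp (eventually_banded_and hd (eventually_banded_and h1 (eventually_banded_and h2 h3))).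
move=> m n B [{}hd [{}h1 [{}h2 [rm rn _]]]] U s V svd.
pose i0 := Ordinal (leq_trans kr rm); pose j0 := Ordinal (leq_trans kr rn).
have [e1 e2] := singular_pair (i := i0) (j := j0) svd (erefl k) (erefl k).
have sd : `|sv m n s k - (1 + g)| <= d.
  have := h1 _ _ _ svd; have := h2 _ _ _ svd k kr; rewrite eE ler_norml => a b.
  by apply/andP; split; lra.
have unit p (W : 'M[R]_p) l : W^T *m W = 1%:M -> dot (col l W) (col l W) = 1.
  by move=> WW; rewrite dot_col WW mxE eqxx.
have [UU VV _ _ _] := svd.
have h := hd _ _ _ (unit _ U i0 UU) (unit _ V j0 VV) e1 e2 sd.
split=> i k' kk ir; have [q1 q2] := h i ir.
  by move: q1; rewrite ext_ord mxE; congr (`|U i _| <= _); apply: val_inj.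
by move: q2; rewrite ext_ord mxE; congr (`|V i _| <= _); apply: val_inj.
Qed.

Lemma eventually_overlap eta : 0 < eta ->
  eventually (fun m n B => forall U s V, is_svd (spiked t B) U s V ->
    forall k, (k < r)%N -> exists2 e : R, e = 1 \/ e = -1 &
    (forall i k' : 'I_m, k' = k :> nat -> (i < r)%N ->
       `|U i k' - e * left_overlap t g k * (i == k :> nat)%:R| <= eta) /\
    (forall i k' : 'I_n, k' = k :> nat -> (i < r)%N ->
       `|V i k' - e * right_overlap t g k * (i == k :> nat)%:R| <= eta)).
Proof.
move=> eta0; pose Q k m n (B : 'M[R]_(m, n)) := forall U s V, is_svd (spiked t B) U s V ->
    exists2 e : R, e = 1 \/ e = -1 &
    (forall i k' : 'I_m, k' = k :> nat -> (i < r)%N ->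
       `|U i k' - e * left_overlap t g k * (i == k :> nat)%:R| <= eta) /\
    (forall i k' : 'I_n, k' = k :> nat -> (i < r)%N ->
       `|V i k' - e * right_overlap t g k * (i == k :> nat)%:R| <= eta).
have H k : (k < r)%N -> eventually (Q k).
  move=> kr; have [tg|tg] := ltP (Num.sqrt g) (t k).
    exact: eventually_overlap_super.
  apply: eventually_banded_imp (eventually_overlap_sub kr tg eta0) => m n B h U s V svd.
  have [h1 h2] := h U s V svd; exists 1; first by left.
  have tgF : (Num.sqrt g < t k) = false by rewrite ltNge tg.
  by rewrite /left_overlap /right_overlap tgF; split=> i k' kk ir;
    rewrite mulr0 mul0r subr0; [exact: h1|exact: h2].
apply: eventually_banded_imp (eventually_banded_forall H) => m n B h U s V svd k kr.
exact: h k kr U s V svd.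
Qed.

End subcritical.

(** * Continuity of the operator norm loss *)

Section operator_norm.
Context (R : realType).

Lemma l2norm_ge0 n (x : 'cV[R]_n) : 0 <= l2norm x.
Proof. exact: sqrtr_ge0. Qed.

Lemma sqr_l2norm n (x : 'cV[R]_n) : l2norm x ^+ 2 = dot x x.
Proof. by rewrite l2normE sqr_sqrtr// dot_ge0. Qed.

Lemma l2norm0 n : l2norm (0 : 'cV[R]_n) = 0.
Proof. by rewrite /l2norm big1 ?sqrtr0// => i _; rewrite mxE expr0n. Qed.

Lemma l2normZ n a (x : 'cV[R]_n) : l2norm (a *: x) = `|a| * l2norm x.
Proof. by rewrite !l2normE dotZl dotZr mulrA -expr2 sqrtrM ?sqr_ge0// sqrtr_sqr. Qed.

Lemma l2normD n (x y : 'cV[R]_n) : l2norm (x + y) <= l2norm x + l2norm y.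
Proof.
rewrite -(ler_pXn2r (_ : 0 < 2)%N) ?nnegrE ?addr_ge0 ?l2norm_ge0//.
rewrite sqrrD !sqr_l2norm dotDl !dotDr (dotC y x).
suff : dot x y <= l2norm x * l2norm y by rewrite mulr2n; lra.
apply: le_trans (ler_norm _) _; apply: ler_norm_sqr; first by rewrite mulr_ge0 ?l2norm_ge0.
by rewrite exprMn !sqr_l2norm cauchy_schwarz.
Qed.

Lemma coord_le_l2norm n (x : 'cV[R]_n) i : `|x i 0| <= l2norm x.
Proof. by apply: ler_norm_sqr; rewrite ?l2norm_ge0// sqr_l2norm sqr_coord_le_dot. Qed.

Lemma l2norm_le_sum n (x : 'cV[R]_n) : l2norm x <= \sum_i `|x i 0|.
Proof.
rewrite -(ler_pXn2r (_ : 0 < 2)%N) ?nnegrE ?l2norm_ge0 ?sumr_ge0//.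
rewrite sqr_l2norm expr2 mulr_suml; apply: ler_sum => i _.
rewrite -expr2 -real_normK ?num_real// expr2 ler_wpM2l// (bigD1 i)//= lerDl.
exact: sumr_ge0.
Qed.

Lemma mulmx_l2norm_bound m n (A : 'M[R]_(m, n)) (x : 'cV[R]_n) :
  l2norm (A *m x) <= (\sum_i \sum_j `|A i j|) * l2norm x.
Proof.
apply: le_trans (l2norm_le_sum _) _; rewrite mulr_suml; apply: ler_sum => i _.
rewrite mxE; apply: le_trans (ler_norm_sum _ _ _) _; rewrite mulr_suml; apply: ler_sum => j _.
by rewrite normrM ler_wpM2l// coord_le_l2norm.
Qed.

Let ball_image m n (A : 'M[R]_(m, n)) := [set l2norm (A *m x) | x in [set x : 'cV[R]_n | l2norm x <= 1]].

Let ball_image_neq0 m n (A : 'M[R]_(m, n)) : ball_image A !=set0.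
Proof. by exists (l2norm (A *m 0)), 0 => //=; rewrite l2norm0. Qed.

Let ball_image_ub m n (A : 'M[R]_(m, n)) : has_ubound (ball_image A).
Proof.
exists (\sum_i \sum_j `|A i j|) => _ [y /= y1 <-].
apply: le_trans (mulmx_l2norm_bound _ _) _; rewrite -[leRHS]mulr1 ler_wpM2l//.
by apply: sumr_ge0 => i _; exact: sumr_ge0.
Qed.

Lemma mulmx_opnorm m n (A : 'M[R]_(m, n)) (x : 'cV[R]_n) : l2norm (A *m x) <= opnorm A * l2norm x.
Proof.
have [x0|x0] := eqVneq (l2norm x) 0.
  by have := mulmx_l2norm_bound A x; rewrite x0 !mulr0.
have xp : 0 < l2norm x by rewrite lt_neqAle eq_sym x0 l2norm_ge0.
rewrite -ler_pdivrMr// mulrC; apply: ub_le_sup; first exact: ball_image_ub.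
exists ((l2norm x)^-1 *: x) => /=.
  by rewrite l2normZ ger0_norm ?invr_ge0 ?l2norm_ge0// mulVf.
by rewrite -scalemxAr l2normZ ger0_norm ?invr_ge0 ?l2norm_ge0.
Qed.

Lemma opnorm_le m n (A : 'M[R]_(m, n)) a : 0 <= a ->
  (forall x, l2norm (A *m x) <= a * l2norm x) -> opnorm A <= a.
Proof.
move=> a0 h; apply: ge_sup; first exact: ball_image_neq0.
move=> _ [x /= x1 <-]; apply: le_trans (h x) _.
by rewrite -[leRHS]mulr1 ler_wpM2l.
Qed.

Lemma opnorm_ge0 m n (A : 'M[R]_(m, n)) : 0 <= opnorm A.
Proof.
apply: (@le_trans _ _ (l2norm (A *m 0))); first exact: l2norm_ge0.
apply: ub_le_sup; first exact: ball_image_ub.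
by exists 0 => //=; rewrite l2norm0.
Qed.

Lemma opnormD m n (A B : 'M[R]_(m, n)) : opnorm (A + B) <= opnorm A + opnorm B.
Proof.
apply: opnorm_le => [|x]; first by rewrite addr_ge0 ?opnorm_ge0.
rewrite mulmxDl mulrDl; apply: le_trans (l2normD _ _) _.
by apply: lerD; exact: mulmx_opnorm.
Qed.

Lemma opnormM m n p (A : 'M[R]_(m, n)) (B : 'M[R]_(n, p)) :
  opnorm (A *m B) <= opnorm A * opnorm B.
Proof.
apply: opnorm_le => [|x]; first by rewrite mulr_ge0 ?opnorm_ge0.
rewrite -mulmxA -mulrA; apply: le_trans (mulmx_opnorm _ _) _.
by rewrite ler_wpM2l ?opnorm_ge0// mulmx_opnorm.
Qed.

Lemma opnormN m n (A : 'M[R]_(m, n)) : opnorm (- A) = opnorm A.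
Proof.
suff le B : opnorm (- B) <= opnorm (B : 'M[R]_(m, n)).
  by apply/le_anti; rewrite le -{1}[A]opprK le.
apply: opnorm_le => [|x]; first exact: opnorm_ge0.
by rewrite mulNmx -scaleN1r l2normZ normrN1 mul1r mulmx_opnorm.
Qed.

Lemma opnorm_tr m n (A : 'M[R]_(m, n)) : opnorm A^T = opnorm A.
Proof.
suff le p q (B : 'M[R]_(p, q)) : opnorm B^T <= opnorm B.
  by apply/le_anti; rewrite le -{1}[A]trmxK le.
apply: opnorm_le => [|x]; first exact: opnorm_ge0.
have [z0|z0] := eqVneq (l2norm (B^T *m x)) 0.
  by rewrite z0 mulr_ge0 ?opnorm_ge0 ?l2norm_ge0.
have zp : 0 < l2norm (B^T *m x) by rewrite lt_neqAle eq_sym z0 l2norm_ge0.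
rewrite -(ler_pM2r zp) -expr2 sqr_l2norm -dot_tr.
apply: le_trans (_ : l2norm x * l2norm (B *m (B^T *m x)) <= _).
  apply: le_trans (ler_norm _) _; apply: ler_norm_sqr; first by rewrite mulr_ge0 ?l2norm_ge0.
  by rewrite exprMn !sqr_l2norm cauchy_schwarz.
by rewrite [_ * l2norm x]mulrC -mulrA ler_wpM2l ?l2norm_ge0// mulmx_opnorm.
Qed.

Lemma opnorm_entries m n (A : 'M[R]_(m, n)) h : 0 <= h -> (forall i j, `|A i j| <= h) ->
  opnorm A <= (m * n)%:R * h.
Proof.
move=> h0 Ah; apply: opnorm_le => [|x]; first by rewrite mulr_ge0.
apply: le_trans (mulmx_l2norm_bound _ _) _; rewrite ler_wpM2r ?l2norm_ge0//.
apply: (@le_trans _ _ (\sum_(i < m) \sum_(j < n) h)).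
  by apply: ler_sum => i _; apply: ler_sum => j _.
by rewrite sumr_const sumr_const !card_ord -mulrnA mulr_natl mulnC.
Qed.

Lemma opnorm_cols p K (A : 'M[R]_(p, K)) h : 0 <= h ->
  (forall k, dot (col k A) (col k A) <= h ^+ 2) -> opnorm A <= K%:R * h.
Proof.
move=> h0 Ah; apply: opnorm_le => [|x]; first by rewrite mulr_ge0.
have -> : A *m x = \sum_k x k 0 *: col k A.
  apply/matrixP => i z; rewrite (ord1 z) mxE summxE; apply: eq_bigr => k _.
  by rewrite !mxE mulrC.
have -> : K%:R * h * l2norm x = \sum_(k < K) h * l2norm x.
  by rewrite sumr_const card_ord -[RHS]mulr_natl mulrA.
elim/big_ind2: _ => [|y a z b hy hz|k _].
- by rewrite l2norm0.
- by apply: le_trans (l2normD _ _) _; exact: lerD.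
rewrite l2normZ mulrC; apply: ler_pM; rewrite ?l2norm_ge0 ?coord_le_l2norm//.
by rewrite -(ler_pXn2r (_ : 0 < 2)%N) ?nnegrE ?l2norm_ge0// sqr_l2norm.
Qed.

Lemma opnorm_gram p K (A : 'M[R]_(p, K)) a : 0 <= a ->
  (forall x : 'cV[R]_K, dot x (A^T *m A *m x) <= a ^+ 2 * dot x x) -> opnorm A <= a.
Proof.
move=> a0 h; apply: opnorm_le => // x.
rewrite -(ler_pXn2r (_ : 0 < 2)%N) ?nnegrE ?mulr_ge0 ?l2norm_ge0//.
by have := h x; rewrite exprMn !sqr_l2norm -mulmxA [dot x _]dot_tr trmxK.
Qed.

Lemma dist_opnorm m n (A B : 'M[R]_(m, n)) : `|opnorm A - opnorm B| <= opnorm (A - B).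
Proof.
have h1 := opnormD (A - B) B; have h2 := opnormD (B - A) A.
rewrite !subrK in h1 h2; rewrite ler_norml.
have : opnorm (B - A) = opnorm (A - B) by rewrite -opnormN opprB.
by move=> e; rewrite e in h2; apply/andP; split; lra.
Qed.

End operator_norm.

Section approximate_frame.
Context (R : realType) (r : nat).

Definition cosine (c : 'I_r -> R) : 'M[R]_r := diag_mx (\row_k c k).
Definition complement (c : 'I_r -> R) (k : 'I_r) : R := Num.sqrt (1 - c k ^+ 2).
Definition first_frame : 'M[R]_(r + r, r) := col_mx 1%:M 0.
Definition tilted_frame (c : 'I_r -> R) : 'M[R]_(r + r, r) :=
  col_mx (cosine c) (cosine (complement c)).
(* When [c k = 1] (as for gamma = 0) there is no residual direction: the frame vector
   of index [r + k] is zero, because 0^-1 = 0. *)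
Definition frame_gram (c : 'I_r -> R) : 'M[R]_(r + r) :=
  block_mx 1%:M 0 0 (cosine (fun k => (complement c k != 0)%:R)).
(** In the index pairs (k, r + k) it is a direct sum of blocks q (c, s)^T (c', s') - t (1, 0)^T (1,
    0), where s and s' are the complements of c and c'. *)
Definition loss_model (q t c c' : 'I_r -> R) : 'M[R]_(r + r) :=
  tilted_frame c *m cosine q *m (tilted_frame c')^T - first_frame *m cosine t *m first_frame^T.

Lemma cosineE c (i j : 'I_r) : cosine c i j = c i *+ (i == j).
Proof. by rewrite !mxE; case: eqP => // ->. Qed.

Lemma cosineM a b : cosine a *m cosine b = cosine (fun k => a k * b k).
Proof.
apply/matrixP => i j; rewrite mul_diag_mx mxE !cosineE mxE.
by case: eqP => // _; rewrite ?mulr0n ?mulr0.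
Qed.

Lemma cosine_mulr p (A : 'M[R]_(p, r)) c i j : (A *m cosine c) i j = A i j * c j.
Proof. by rewrite mul_mx_diag !mxE. Qed.

Lemma cosine_mull p (A : 'M[R]_(r, p)) c i j : (cosine c *m A) i j = c i * A i j.
Proof. by rewrite mul_diag_mx !mxE. Qed.

Lemma tr_cosine c : (cosine c)^T = cosine c.
Proof. exact: tr_diag_mx. Qed.

Lemma gram_first_frame c : frame_gram c *m first_frame = first_frame.
Proof. by rewrite mul_block_col !mul0mx mulmx0 mulmx1 !addr0. Qed.

Lemma gram_tilted_frame c : frame_gram c *m tilted_frame c = tilted_frame c.
Proof.
rewrite mul_block_col mul1mx !mul0mx addr0 add0r cosineM; congr (col_mx _ (cosine _)).
apply/funext => k; have [->|_] := eqVneq (complement c k) 0; first by rewrite mulr0.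
by rewrite mul1r.
Qed.

Lemma tr_frame_gram c : (frame_gram c)^T = frame_gram c.
Proof. by rewrite tr_block_mx trmx1 !trmx0 tr_cosine. Qed.

Lemma gram_loss_model q t c c' : frame_gram c *m loss_model q t c c' = loss_model q t c c'.
Proof. by rewrite mulmxBr !mulmxA gram_tilted_frame gram_first_frame. Qed.

Lemma tr_loss_model q t c c' : (loss_model q t c c')^T = loss_model q t c' c.
Proof. by rewrite linearB /= !trmx_mul !trmxK !tr_cosine !mulmxA. Qed.

Lemma loss_model_gram q t c c' : loss_model q t c c' *m frame_gram c' = loss_model q t c c'.
Proof. by rewrite -[LHS]trmxK trmx_mul tr_frame_gram tr_loss_model gram_loss_model tr_loss_model. Qed.

(** [frame_gram] is a projection, so the squared norm is at most 1 + h, hence at most (1 + h)^2. *)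
Lemma opnorm_frame_gram_le c p (A : 'M[R]_(p, r + r)) h : 0 <= h ->
  opnorm (A^T *m A - frame_gram c) <= h -> opnorm A <= 1 + h.
Proof.
move=> h0 Ah; apply: opnorm_gram => [|x]; first by rewrite addr_ge0.
rewrite -[A^T *m A](subrK (frame_gram c)) mulmxDl dotDr.
have dx := dot_ge0 x.
have le1 : dot x (frame_gram c *m x) <= dot x x.
  rewrite -[x]vsubmxK mul_block_col mul1mx !mul0mx addr0 add0r.
  rewrite /dot !big_split_ord /=; apply: lerD; apply: ler_sum => i _; rewrite ?col_mxEu ?col_mxEd//.
  rewrite cosine_mull; case: (_ == 0) => /=; last by rewrite mul1r.
  by rewrite mul0r mulr0 -expr2 sqr_ge0.
have le2 : dot x ((A^T *m A - frame_gram c) *m x) <= h * dot x x.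
  apply: (@le_trans _ _ (l2norm x * l2norm ((A^T *m A - frame_gram c) *m x))).
    apply: le_trans (ler_norm _) _; apply: ler_norm_sqr; first by rewrite mulr_ge0 ?l2norm_ge0.
    by rewrite exprMn !sqr_l2norm cauchy_schwarz.
  rewrite -sqr_l2norm expr2 mulrCA ler_wpM2l ?l2norm_ge0//.
  by apply: le_trans (mulmx_opnorm _ _) _; rewrite ler_wpM2r ?l2norm_ge0.
have : 0 <= h ^+ 2 * dot x x by rewrite mulr_ge0 ?sqr_ge0.
have := mulr_ge0 h0 dx; move: le1 le2 dx; rewrite sqrrD expr1n mul1r mulr2n; lra.
Qed.

(** [W] puts next to [X] the residuals of [Xh] against [X], divided by their limiting lengths [s k].
    Since [X^T *m Xh] is almost diagonal, the Gram matrix of [W] is almost [frame_gram]. Where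
    [s k = 0] the residual column is 0, and the k-th columns of [Xh] and [X] are close instead. *)
Lemma approximate_frame (c : 'I_r -> R) (h : R) : (forall k, 0 <= c k <= 1) -> 0 < h ->
  exists2 eta, 0 < eta & forall p (X Xh : 'M[R]_(p, r)), X^T *m X = 1%:M -> Xh^T *m Xh = 1%:M ->
    (forall i j, `|(X^T *m Xh) i j - c j *+ (i == j)| <= eta) ->
    exists W : 'M[R]_(p, r + r),
      [/\ opnorm (W^T *m W - frame_gram c) <= h, W *m first_frame = X &
          opnorm (Xh - W *m tilted_frame c) <= h].
Proof.
move=> c01 h0; pose s := complement c.
have s2 k : s k ^+ 2 = 1 - c k ^+ 2.
  rewrite sqr_sqrtr// subr_ge0; have /andP[a b] := c01 k.
  by rewrite expr_le1.
(* [sig] dominates every inverse length. In [eta], the first bound serves the entries of the Gram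
   matrix; the second is quadratic in [h2] because for [s k = 0] only the squared distance, at most
   [2 * eta], is controlled. *)
pose sig := 1 + \sum_k `|(s k)^-1|.
have sum0 : 0 <= \sum_k `|(s k)^-1| by apply: sumr_ge0.
have sig1 : 1 <= sig by rewrite lerDl.
have sigk k : `|(s k)^-1| <= sig.
  by rewrite /sig (bigD1 k)//= addrCA lerDl addr_ge0//; apply: sumr_ge0.
have sig0 : 0 < sig by exact: lt_le_trans sig1.
pose K : R := ((r + r) * (r + r)).+1%:R.
have K0 : 0 < K by rewrite ltr0n.
pose h1 := h / K; have h10 : 0 < h1 by rewrite divr_gt0.
pose h2 := h / r.+1%:R; have h20 : 0 < h2 by rewrite divr_gt0.
pose eta := Num.min (h1 / (2 * sig ^+ 2)) (h2 ^+ 2 / 2).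
have ss : 0 < 2 * sig ^+ 2 by rewrite mulr_gt0 ?exprn_gt0.
have eta0 : 0 < eta by rewrite lt_min !divr_gt0 ?exprn_gt0.
have eta1 : 2 * sig ^+ 2 * eta <= h1 by rewrite mulrC -ler_pdivlMr// ge_min lexx.
have eta2 : 2 * eta <= h2 ^+ 2 by rewrite mulrC -ler_pdivlMr// ge_min lexx orbT.
exists eta => // p X Xh XX XhXh hE.
pose C := cosine c; pose D := cosine (fun k => (s k)^-1).
pose E := X^T *m Xh - C.
have Eb i j : `|E i j| <= eta.
  rewrite /E mxE [(- C) i j]mxE cosineE (_ : c i *+ _ = c j *+ (i == j)) ?hE//.
  by case: eqP => // ->.
have XhE : X^T *m Xh = C + E by rewrite addrC subrK.
have XhE' : Xh^T *m X = C + E^T by rewrite -[LHS]trmxK trmx_mul trmxK XhE linearD /= tr_cosine.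
pose V := (Xh - X *m C) *m D.
have V1 : X^T *m V = E *m D by rewrite mulmxA mulmxBr mulmxA XX mul1mx XhE addrAC subrr add0r.
have V2 : V^T *m V = D *m (1%:M - C *m C - E^T *m C - C *m E) *m D.
  rewrite trmx_mul tr_cosine !mulmxA; congr (_ *m _); rewrite -mulmxA; congr (_ *m _).
  have -> : (Xh - X *m C)^T = Xh^T - C *m X^T.
    by rewrite -[C in RHS]tr_cosine -trmx_mul; apply/matrixP => i j; rewrite !mxE.
  rewrite mulmxBl !mulmxBr -!mulmxA XhXh.
  rewrite [X^T *m (X *m C)]mulmxA XX mul1mx XhE [Xh^T *m (_ *m _)]mulmxA XhE' mulmxDl mulmxDr.
  move: (C *m C) (E^T *m C) (C *m E) (1%:M : 'M[R]_r) => a1 a2 a3 a4.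
  by apply/matrixP => i j; rewrite !mxE; ring.
exists (row_mx X V); split.
- apply: (@le_trans _ _ (((r + r) * (r + r))%:R * h1)); last first.
    have hK : h1 * K = h by rewrite divfK// gt_eqF.
    rewrite -hK mulrC ler_pM2l//.
    by rewrite ler_nat.
  apply: opnorm_entries => [|i j]; first exact: ltW.
  rewrite tr_row_mx mul_col_row XX V1.
  have -> : V^T *m X = (E *m D)^T by rewrite -[LHS]trmxK trmx_mul trmxK V1.
  rewrite V2 opp_block_mx add_block_mx !subr0 subrr.
  have sm : eta * sig <= h1.
    apply: le_trans eta1; rewrite mulrC; apply: ler_wpM2r; first exact: ltW.
    by rewrite expr2 mulrA -[leLHS]mul1r ler_pM2r//; lra.
  have ED a b : `|(E *m D) a b| <= h1.
    by rewrite cosine_mulr normrM; apply: le_trans sm; apply: ler_pM.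
  rewrite -(splitK i) -(splitK j); case: (fintype.split i) => a; case: (fintype.split j) => b /=.
  + by rewrite block_mxEul mxE normr0 ltW.
  + by rewrite block_mxEur.
  + by rewrite block_mxEdl mxE.
  have subE (A B : 'M[R]_r) : (A - B) a b = A a b - B a b by rewrite !mxE.
  rewrite block_mxEdr subE !cosineE cosine_mulr cosine_mull cosineM.
  set Z := (1%:M - cosine _ - E^T *m C - C *m E) a b.
  have ZE : Z = (1 - c a ^+ 2) *+ (a == b) - (E b a * c b + c a * E a b).
    have trE : E^T a b = E b a by rewrite mxE.
    rewrite /Z ![in LHS]subE.
    rewrite cosine_mulr cosine_mull cosineE [1%:M _ _]mxE trE.
    case: (_ == b); rewrite ?mulr1n ?mulr0n /=; ring.
  have -> : (s a)^-1 * Z * (s b)^-1 - (s a != 0)%:R *+ (a == b) =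
      - ((s a)^-1 * (E b a * c b + c a * E a b) * (s b)^-1).
    rewrite ZE; have [<-|_] := eqVneq a b; last by rewrite !mulr0n; ring.
    rewrite !mulr1n -s2; have [s0|s0] := eqVneq (s a) 0; last by rewrite /=; field.
    by rewrite s0 invr0 /=; ring.
  rewrite normrN !normrM; apply: le_trans eta1.
  have Z2 : `|E b a * c b + c a * E a b| <= 2 * eta.
    apply: le_trans (ler_normD _ _) _; rewrite !normrM mulr_natl mulr2n.
    have [/andP[a0 a1] /andP[b0 b1]] := (c01 a, c01 b).
    rewrite !(ger0_norm (a0)) !(ger0_norm b0); apply: lerD.
      by rewrite -[leRHS]mulr1; apply: ler_pM.
    by rewrite -[leRHS]mul1r; apply: ler_pM.
  rewrite (_ : 2 * sig ^+ 2 * eta = sig * (2 * eta) * sig); last by ring.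
  by apply: ler_pM => //; apply: ler_pM.
- by rewrite mul_row_col mulmx1 mulmx0 addr0.
apply: (@le_trans _ _ (r%:R * h2)); last first.
  have hK : h2 * r.+1%:R = h by rewrite divfK// pnatr_eq0.
  rewrite -hK mulrC ler_pM2l//.
  by rewrite ler_nat.
apply: opnorm_cols => [|k]; first exact: ltW.
have colE : col k (Xh - row_mx X V *m tilted_frame c) = (1 - (s k)^-1 * s k) *: (col k Xh - c k *: col k X).
  have subE (A B : 'M[R]_(p, r)) a b : (A - B) a b = A a b - B a b by rewrite !mxE.
  have addE (A B : 'M[R]_(p, r)) a b : (A + B) a b = A a b + B a b by rewrite !mxE.
  apply/matrixP => i z; rewrite (ord1 z) mul_row_col.
  transitivity ((1 - (s k)^-1 * s k) * (Xh i k - c k * X i k)); last by rewrite !mxE.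
  rewrite mxE subE addE !cosine_mulr subE cosine_mulr -/(s k); ring.
rewrite colE dotZl dotZr.
have [s0|s0] := eqVneq (s k) 0; last by rewrite mulVf// subrr !mul0r sqr_ge0.
rewrite s0 mulr0 subr0 !mul1r dot_sub_sq !dotZr !dotZl.
have ck : c k = 1.
  have /andP[a b] := c01 k; have := s2 k; rewrite s0 expr0n /= => /eqP.
  by rewrite eq_sym subr_eq0 eq_sym sqrf_eq1 => /orP[/eqP->//|/eqP cE]; move: a; rewrite cE; lra.
have colk (Z : 'M[R]_(p, r)) : Z^T *m Z = 1%:M -> dot (col k Z) (col k Z) = 1.
  by move=> ZZ; rewrite dot_col ZZ mxE eqxx.
have xx : dot (col k Xh) (col k X) = (X^T *m Xh) k k by rewrite dotC dot_col.
rewrite !colk// ck xx !mul1r ?mulr1; apply: le_trans eta2.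
have := hE k k; rewrite eqxx mulr1n ck ler_norml => /andP[z _]; lra.
Qed.

End approximate_frame.

Section loss_continuity.
Context (R : realType) (r : nat).

Lemma opnorm_isometry p K (A : 'M[R]_(p, K)) : A^T *m A = 1%:M -> opnorm A <= 1.
Proof. by move=> AA; apply: opnorm_gram => // x; rewrite AA mul1mx expr1n mul1r. Qed.

Lemma opnorm_sandwich_le p n K L (W : 'M[R]_(p, K)) (W' : 'M[R]_(n, L)) (N : 'M[R]_(K, L)) a b :
  0 <= a -> opnorm W <= a -> opnorm W' <= b -> opnorm (W *m N *m W'^T) <= a * opnorm N * b.
Proof.
move=> a0 Wa Wb; apply: le_trans (opnormM _ _) _; rewrite opnorm_tr.
apply: ler_pM; rewrite ?opnorm_ge0//.
by apply: le_trans (opnormM _ _) _; apply: ler_pM; rewrite ?opnorm_ge0.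
Qed.

(** The upper bound is (1 + h)^2 <= 1 + 3 h. For the lower one, multiplying back by [W^T] and [W']
    recovers [N] up to terms of total size 3 h times its norm; replacing [h * mu] by at most four
    times [h * opnorm N] gives 3 * 4 + 3 = 15. *)
Lemma opnorm_sandwich p n (c c' : 'I_r -> R) (W : 'M[R]_(p, r + r)) (W' : 'M[R]_(n, r + r))
    (N : 'M[R]_(r + r)) h : 0 <= h <= 1 ->
  frame_gram c *m N = N -> N *m frame_gram c' = N ->
  opnorm (W^T *m W - frame_gram c) <= h -> opnorm (W'^T *m W' - frame_gram c') <= h ->
  `|opnorm (W *m N *m W'^T) - opnorm N| <= 15 * h * opnorm N.
Proof.
move=> /andP[h0 h1] JN NJ hW hW'.
have hsq : (1 + h) * (1 + h) <= 1 + 3 * h.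
  by clear -h0 h1; have : h * h <= h; [rewrite ler_piMr|lra].
 set mu := opnorm (W *m N *m W'^T).
have W1 := opnorm_frame_gram_le h0 hW; have W1' := opnorm_frame_gram_le h0 hW'.
have h10 : 0 <= 1 + h by rewrite addr_ge0.
have nu0 := opnorm_ge0 N; have mu0 : 0 <= mu by exact: opnorm_ge0.
have up : mu <= (1 + 3 * h) * opnorm N.
  apply: le_trans (opnorm_sandwich_le N h10 W1 W1') _.
  by rewrite mulrAC ler_wpM2r.
have [E EE] : exists E, E = W^T *m W - frame_gram c by eexists.
have [E' EE'] : exists E', E' = W'^T *m W' - frame_gram c' by eexists.
rewrite -EE in hW; rewrite -EE' in hW'.
have NE : N = W^T *m (W *m N *m W'^T) *m W' - (E *m N + N *m E' + E *m N *m E').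
  have -> : W^T *m (W *m N *m W'^T) *m W' = (E + frame_gram c) *m N *m (E' + frame_gram c').
    by rewrite EE EE' !subrK !mulmxA.
  rewrite mulmxDl JN mulmxDr !mulmxDl -[E *m N *m frame_gram c']mulmxA NJ.
  clear; move: (E *m N *m E') (N *m E') (E *m N) => x y z.
  by apply/matrixP => i j; rewrite !mxE; ring.
have low : opnorm N <= (1 + 3 * h) * mu + 3 * h * opnorm N.
  rewrite {1}NE; apply: le_trans (opnormD _ _) _; rewrite opnormN; apply: lerD.
    have := @opnorm_sandwich_le _ _ _ _ W^T W'^T (W *m N *m W'^T) (1 + h) (1 + h) h10.
    rewrite !opnorm_tr trmxK => /(_ W1 W1') le; apply: le_trans le _.
    by rewrite mulrAC ler_wpM2r.
  have e1 : opnorm (E *m N) <= h * opnorm N.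
    by apply: le_trans (opnormM _ _) _; rewrite ler_wpM2r.
  have e2 : opnorm (N *m E') <= opnorm N * h.
    by apply: le_trans (opnormM _ _) _; rewrite ler_wpM2l.
  have e3 : opnorm (E *m N *m E') <= h * opnorm N * h.
    by apply: le_trans (opnormM _ _) _; apply: ler_pM; rewrite ?opnorm_ge0.
  apply: le_trans (opnormD _ _) _; apply: le_trans (lerD (opnormD _ _) (lexx _)) _.
  apply: le_trans (lerD (lerD e1 e2) e3) _.
  have : h * opnorm N * h <= h * opnorm N by rewrite -[leRHS]mulr1 ler_wpM2l// mulr_ge0.
  by clear; move: (opnorm N) => nu; lra.
have hm : h * mu <= 4 * (h * opnorm N).
  rewrite mulrCA ler_wpM2l//; apply: le_trans up _; rewrite ler_wpM2r//.
  by clear -h1; lra.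
have hn : 0 <= h * opnorm N by rewrite mulr_ge0.
move: mu (opnorm N) up low hm hn {mu0 nu0} => mu nu up low hm hn; clear -up low hm hn.
by rewrite ler_norml; apply/andP; split; lra.
Qed.

(** In approximate frames [W] and [V] the loss matrix is close to [W *m N *m V^T] with a fixed [N]
    of size 2 r, so [eta] does not depend on the dimensions [p] and [n]. *)
Lemma loss_continuity (q t c c' : 'I_r -> R) (eps : R) :
  (forall k, 0 <= c k <= 1) -> (forall k, 0 <= c' k <= 1) -> 0 < eps ->
  exists2 eta, 0 < eta & forall p n (X Xh : 'M[R]_(p, r)) (Y Yh : 'M[R]_(n, r)),
    X^T *m X = 1%:M -> Xh^T *m Xh = 1%:M -> Y^T *m Y = 1%:M -> Yh^T *m Yh = 1%:M ->
    (forall i j, `|(X^T *m Xh) i j - c j *+ (i == j)| <= eta) ->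
    (forall i j, `|(Y^T *m Yh) i j - c' j *+ (i == j)| <= eta) ->
    `|opnorm (Xh *m cosine q *m Yh^T - X *m cosine t *m Y^T) - opnorm (loss_model q t c c')| <= eps.
Proof.
move=> c01 c01' eps0; set N := loss_model q t c c'.
(* Replacing [Xh] costs one multiple of the norm of [cosine q] and replacing [Yh] two; the sandwich
   costs 15 times that of [N]; the 1 keeps [K] positive. *)
pose K := 3 * opnorm (cosine q) + 15 * opnorm N + 1.
have q0 := opnorm_ge0 (cosine q); have n0 := opnorm_ge0 N.
have K0 : 0 < K.
  by rewrite /K; move: (opnorm _) (opnorm _) q0 n0 => x y x0 y0; clear -x0 y0; lra.
pose h := Num.min 1 (eps / K).
have h0 : 0 < h by rewrite lt_min ltr01 divr_gt0.
have h1 : h <= 1 by rewrite ge_min lexx.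
have hK : h * K <= eps by rewrite -ler_pdivlMr// ge_min lexx orbT.
have [e1 e10 H1] := approximate_frame c01 h0; have [e2 e20 H2] := approximate_frame c01' h0.
exists (Num.min e1 e2); first by rewrite lt_min e10.
move=> p n X Xh Y Yh XX XhXh YY YhYh hX hY.
have [W [W1 W2 W3]] : exists W : 'M[R]_(p, r + r),
      [/\ opnorm (W^T *m W - frame_gram c) <= h, W *m first_frame R r = X &
          opnorm (Xh - W *m tilted_frame c) <= h].
  by apply: H1 => // i j; apply: le_trans (hX i j) _; rewrite ge_min lexx.
have [V [V1 V2 V3]] : exists W : 'M[R]_(n, r + r),
      [/\ opnorm (W^T *m W - frame_gram c') <= h, W *m first_frame R r = Y &
          opnorm (Yh - W *m tilted_frame c') <= h].
  by apply: H2 => // i j; apply: le_trans (hY i j) _; rewrite ge_min lexx orbT.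
have hh : 0 <= h <= 1 by rewrite ltW.
have := opnorm_sandwich hh (gram_loss_model q t c c') (loss_model_gram q t c c') W1 V1.
rewrite -/N; set M := W *m N *m V^T => hM.
set D := Xh *m _ *m _ - _.
have DM : D - M = (Xh - W *m tilted_frame c) *m cosine q *m Yh^T +
     W *m tilted_frame c *m cosine q *m (Yh - V *m tilted_frame c')^T.
  have -> : M = W *m tilted_frame c *m cosine q *m (V *m tilted_frame c')^T - X *m cosine t *m Y^T.
    by rewrite -W2 -V2 /M /N /loss_model mulmxBr mulmxBl !trmx_mul !mulmxA.
  have -> : (Yh - V *m tilted_frame c')^T = Yh^T - (V *m tilted_frame c')^T by exact: linearB.
  rewrite /D !mulmxBl mulmxBr.
  by rewrite opprB !addrA !subrK.
have Yh1 := opnorm_isometry YhYh; have Xh1 := opnorm_isometry XhXh.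
have A2 : opnorm (W *m tilted_frame c) <= 2.
  rewrite (_ : W *m _ = Xh - (Xh - W *m tilted_frame c)); last by rewrite subKr.
  apply: le_trans (opnormD _ _) _; rewrite opnormN; apply: le_trans (lerD Xh1 W3) _.
  by clear -h1; lra.
have d1 : opnorm (D - M) <= 3 * h * opnorm (cosine q).
  rewrite DM; apply: le_trans (opnormD _ _) _.
  have x1 := opnorm_sandwich_le (cosine q) (ltW h0) W3 Yh1.
  have x2 := opnorm_sandwich_le (cosine q) (ler0n R 2) A2 V3.
  apply: le_trans (lerD x1 x2) _.
  by clear; move: (opnorm _) => x; lra.
have d2 := dist_opnorm D M.
rewrite (_ : _ - _ = (opnorm D - opnorm M) + (opnorm M - opnorm N)); last by ring.
apply: le_trans (ler_normD _ _) _; apply: le_trans (lerD (le_trans d2 d1) hM) _.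
apply: le_trans hK; rewrite /K; clear -h0.
by move: (opnorm _) (opnorm _) => x y; lra.
Qed.

End loss_continuity.

(** * The optimal shrinkage *)

Section loss_model_bounds.
Context (R : realType) (r : nat).

Lemma loss_model_mulmx (q t c c' : 'I_r -> R) (b1 b2 : 'cV[R]_r) :
  loss_model q t c c' *m col_mx b1 b2 =
  let z := cosine q *m (cosine c' *m b1 + cosine (complement c') *m b2) in
  col_mx (cosine c *m z - cosine t *m b1) (cosine (complement c) *m z).
Proof.
rewrite /= /loss_model mulmxBl -!mulmxA /tilted_frame /first_frame !tr_col_mx !mul_row_col.
rewrite !tr_cosine trmx1 trmx0 mul1mx mul0mx addr0 !mul_col_mx mul1mx mul0mx.
by rewrite opp_col_mx add_col_mx oppr0 addr0.
Qed.

Lemma dot_col_mx m n (x1 y1 : 'cV[R]_m) (x2 y2 : 'cV[R]_n) :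
  dot (col_mx x1 x2) (col_mx y1 y2) = dot x1 y1 + dot x2 y2.
Proof.
by rewrite /dot big_split_ord /=; congr (_ + _); apply: eq_bigr => i _;
  rewrite ?col_mxEu ?col_mxEd.
Qed.

(** The relation [q k * c k = t k * c' k] makes the rows of each block orthogonal: they are
    multiples of (s', - c') and (c', s') by - t s' and by s q. The norm of a block is then the
    larger of its two row norms. *)
Lemma opnorm_loss_model_le (q t c c' : 'I_r -> R) (L : R) : 0 <= L ->
  (forall k, c' k ^+ 2 <= 1) -> (forall k, q k * c k = t k * c' k) ->
  (forall k, (t k * complement c' k) ^+ 2 <= L ^+ 2) ->
  (forall k, (complement c k * q k) ^+ 2 <= L ^+ 2) ->
  opnorm (loss_model q t c c') <= L.
Proof.
move=> L0 c1 qc ts sq; apply: opnorm_le => // b.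
rewrite -(ler_pXn2r (_ : 0 < 2)%N) ?nnegrE ?mulr_ge0 ?l2norm_ge0// exprMn !sqr_l2norm.
rewrite -[b]vsubmxK loss_model_mulmx /= !dot_col_mx.
move: (usubmx b) (dsubmx b) => x y; rewrite /dot -!big_split mulr_sumr; apply: ler_sum => k _ /=.
have s1 : complement c' k ^+ 2 = 1 - c' k ^+ 2 by rewrite sqr_sqrtr// subr_ge0.
have subE (A B : 'cV[R]_r) i j : (A - B) i j = A i j - B i j by rewrite !mxE.
have addE (A B : 'cV[R]_r) i j : (A + B) i j = A i j + B i j by rewrite !mxE.
rewrite subE !cosine_mull addE !cosine_mull.
move: (qc k) (ts k) (sq k) s1; move: (x k 0) (y k 0) => a b'.
move: (c k) (c' k) (complement c k) (complement c' k) (q k) (t k) => u v w s p z puzv h1 h2 sv.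
have -> : u * (p * (v * a + s * b')) - z * a = - (z * s) * (s * a - v * b').
  transitivity (p * u * (v * a + s * b') - z * a); first by ring.
  rewrite puzv (_ : z * a = z * (v ^+ 2 + s ^+ 2) * a); last by rewrite sv; ring.
  by ring.
have -> : L ^+ 2 * (a * a + b' * b') = L ^+ 2 * (s * a - v * b') ^+ 2 + L ^+ 2 * (v * a + s * b') ^+ 2.
  transitivity (L ^+ 2 * ((v ^+ 2 + s ^+ 2) * (a * a + b' * b'))); last by ring.
  by rewrite sv; ring.
apply: lerD.
  rewrite (_ : _ * _ = (z * s) ^+ 2 * (s * a - v * b') ^+ 2); last by ring.
  by rewrite ler_wpM2r// sqr_ge0.
rewrite (_ : _ * _ = (w * p) ^+ 2 * (v * a + s * b') ^+ 2); last by ring.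
by rewrite ler_wpM2r// sqr_ge0.
Qed.

(* The test vector is orthogonal to the tilted frame vector of its block, so the
   value of [q] plays no role. *)
Lemma opnorm_loss_model_ge (q t c c' : 'I_r -> R) k : 0 <= t k -> c' k ^+ 2 <= 1 ->
  t k * complement c' k <= opnorm (loss_model q t c c').
Proof.
move=> t0 c1; set s := complement c' k.
have s1 : s ^+ 2 = 1 - c' k ^+ 2 by rewrite sqr_sqrtr// subr_ge0.
pose e : 'cV[R]_r := delta_mx k 0.
pose b := col_mx (s *: e) (- c' k *: e).
have ee : dot e e = 1.
  rewrite /dot (bigD1 k)//= big1 => [|i ik]; rewrite !mxE ?eqxx ?(negbTE ik) /=; ring.
have b1 : l2norm b = 1.
  by rewrite l2normE dot_col_mx !dotZl !dotZr ee mulr1 mulr1 -!expr2 sqrrN s1 subrK sqrtr1.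
have := mulmx_opnorm (loss_model q t c c') b; rewrite b1 mulr1; apply: le_trans.
have z0 : cosine c' *m (s *: e) + cosine (complement c') *m (- c' k *: e) = 0.
  apply/matrixP => i j; rewrite mxE [in RHS]mxE !cosine_mull !mxE.
  by case: (eqVneq i k) => [->|_] /=; rewrite -/s; ring.
rewrite loss_model_mulmx /= z0 !mulmx0 sub0r.
apply: (@le_trans _ _ `|col_mx (- (cosine t *m (s *: e))) (0 : 'cV[R]_r) (lshift r k) 0|).
  by rewrite col_mxEu mxE normrN cosine_mull !mxE !eqxx /= mulr1 ler_norm.
exact: coord_le_l2norm.
Qed.

End loss_model_bounds.

(** * Explicit overlaps, thresholds and losses *)

Section limiting_overlaps.
Context (R : realType) (gamma : R).
Hypothesis gamma_ge0 : 0 <= gamma.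

Lemma fourth_root_sqr : (gamma `^ (1 / 4)) ^+ 2 = Num.sqrt gamma.
Proof.
rewrite -powR_mulrn ?powR_ge0// -powRrM (_ : 1 / 4 * 2%:R = 2^-1); last by field.
by rewrite powR12_sqrt.
Qed.

Lemma sqrt_sqrt_fourth_root : Num.sqrt (Num.sqrt gamma) = gamma `^ (1 / 4).
Proof. by rewrite -fourth_root_sqr sqrtr_sqr ger0_norm// powR_ge0. Qed.

Lemma fourth_root_lt t : 0 < t -> (gamma `^ (1 / 4) < t) = (gamma < (t ^+ 2) ^+ 2).
Proof.
move=> t0; have t20 : 0 <= t ^+ 2 by rewrite exprn_ge0// ltW.
rewrite -(ltr_pXn2r (_ : 0 < 2)%N) ?nnegrE ?powR_ge0 ?(ltW t0)// fourth_root_sqr.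
by rewrite -(ltr_pXn2r (_ : 0 < 2)%N) ?nnegrE ?sqrtr_ge0// sqr_sqrtr.
Qed.

Lemma fourth_root_le t : 0 < t -> t <= gamma `^ (1 / 4) -> t ^+ 2 <= Num.sqrt gamma.
Proof.
by move=> t0 h; rewrite -fourth_root_sqr ler_pXn2r ?nnegrE ?powR_ge0 ?(ltW t0).
Qed.

Lemma sqr_c_left t : 0 < t -> gamma `^ (1 / 4) < t ->
  c_left gamma t ^+ 2 = ((t ^+ 2) ^+ 2 - gamma) / (t ^+ 2 * (t ^+ 2 + gamma)).
Proof.
move=> t0 h; rewrite /c_left h; rewrite fourth_root_lt// in h.
have x0 : 0 < t ^+ 2 by rewrite exprn_gt0.
have d0 : 0 < t ^+ 2 + gamma by rewrite ltr_wpDr.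
have -> : (1 - gamma / t ^+ 4) / (1 + gamma / t ^+ 2) =
    ((t ^+ 2) ^+ 2 - gamma) / (t ^+ 2 * (t ^+ 2 + gamma)).
  rewrite (_ : t ^+ 4 = (t ^+ 2) ^+ 2); last by rewrite -exprM.
  have dn : t ^+ 2 + gamma != 0 by rewrite gt_eqF.
  by move: (t ^+ 2) x0 dn => x x0 dn; field; rewrite dn gt_eqF.
have num0 : 0 <= (t ^+ 2) ^+ 2 - gamma by rewrite subr_ge0 ltW.
by rewrite sqr_sqrtr// divr_ge0// ltW// mulr_gt0.
Qed.

Lemma sqr_c_right t : 0 < t -> gamma `^ (1 / 4) < t ->
  c_right gamma t ^+ 2 = ((t ^+ 2) ^+ 2 - gamma) / (t ^+ 2 * (t ^+ 2 + 1)).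
Proof.
move=> t0 h; rewrite /c_right h; rewrite fourth_root_lt// in h.
have x0 : 0 < t ^+ 2 by rewrite exprn_gt0.
have d0 : 0 < t ^+ 2 + 1 by rewrite addr_gt0.
have -> : (1 - gamma / t ^+ 4) / (1 + 1 / t ^+ 2) =
    ((t ^+ 2) ^+ 2 - gamma) / (t ^+ 2 * (t ^+ 2 + 1)).
  rewrite (_ : t ^+ 4 = (t ^+ 2) ^+ 2); last by rewrite -exprM.
  have dn : t ^+ 2 + 1 != 0 by rewrite gt_eqF.
  by move: (t ^+ 2) x0 dn => x x0 dn; field; rewrite dn gt_eqF.
have num0 : 0 <= (t ^+ 2) ^+ 2 - gamma by rewrite subr_ge0 ltW.
by rewrite sqr_sqrtr// divr_ge0// ltW// mulr_gt0.
Qed.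

Lemma c_left_ge0 t : 0 <= c_left gamma t.
Proof. by rewrite /c_left; case: ifP => // _; exact: sqrtr_ge0. Qed.

Lemma c_right_ge0 t : 0 <= c_right gamma t.
Proof. by rewrite /c_right; case: ifP => // _; exact: sqrtr_ge0. Qed.

Lemma one_minus_c_left t : 0 < t -> gamma `^ (1 / 4) < t ->
  1 - c_left gamma t ^+ 2 = gamma * (t ^+ 2 + 1) / (t ^+ 2 * (t ^+ 2 + gamma)).
Proof.
move=> t0 h; rewrite sqr_c_left//; have x0 : 0 < t ^+ 2 by rewrite exprn_gt0.
have : t ^+ 2 + gamma != 0 by rewrite gt_eqF// ltr_wpDr.
by move: (t ^+ 2) x0 => x x0 x1; field; rewrite x1 gt_eqF.
Qed.

Lemma one_minus_c_right t : 0 < t -> gamma `^ (1 / 4) < t ->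
  1 - c_right gamma t ^+ 2 = (t ^+ 2 + gamma) / (t ^+ 2 * (t ^+ 2 + 1)).
Proof.
move=> t0 h; rewrite sqr_c_right//; have x0 : 0 < t ^+ 2 by rewrite exprn_gt0.
have : t ^+ 2 + 1 != 0 by rewrite gt_eqF// addr_gt0.
by move: (t ^+ 2) x0 => x x0 x1; field; rewrite x1 gt_eqF.
Qed.

Lemma sqr_c_left_le1 t : 0 < t -> c_left gamma t ^+ 2 <= 1.
Proof.
move=> t0; have x0 : 0 < t ^+ 2 by rewrite exprn_gt0.
have [h|h] := ltP (gamma `^ (1 / 4)) t; last by rewrite /c_left ltNge h expr0n.
by rewrite -subr_ge0 one_minus_c_left// divr_ge0// mulr_ge0// ?addr_ge0// ltW.
Qed.

Lemma sqr_c_right_le1 t : 0 < t -> c_right gamma t ^+ 2 <= 1.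
Proof.
move=> t0; have x0 : 0 < t ^+ 2 by rewrite exprn_gt0.
have [h|h] := ltP (gamma `^ (1 / 4)) t; last by rewrite /c_right ltNge h expr0n.
by rewrite -subr_ge0 one_minus_c_right// divr_ge0 ?mulr_ge0 ?addr_ge0// ltW.
Qed.

Lemma c_right_le_left t : 0 < t -> gamma <= 1 -> c_right gamma t ^+ 2 <= c_left gamma t ^+ 2.
Proof.
move=> t0 g1; have x0 : 0 < t ^+ 2 by rewrite exprn_gt0.
have [h|h] := ltP (gamma `^ (1 / 4)) t; last by rewrite /c_right /c_left ltNge h.
rewrite sqr_c_left// sqr_c_right// ler_wpM2l//.
  by rewrite subr_ge0 ltW// -fourth_root_lt.
by rewrite lef_pV2 ?posrE ?mulr_gt0 ?ltr_wpDr ?addr_gt0// ler_pM2l// lerD2l.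
Qed.

Lemma c_left_le_right t : 0 < t -> 1 <= gamma -> c_left gamma t ^+ 2 <= c_right gamma t ^+ 2.
Proof.
move=> t0 g1; have x0 : 0 < t ^+ 2 by rewrite exprn_gt0.
have [h|h] := ltP (gamma `^ (1 / 4)) t; last by rewrite /c_right /c_left ltNge h.
rewrite sqr_c_left// sqr_c_right// ler_wpM2l//.
  by rewrite subr_ge0 ltW// -fourth_root_lt.
by rewrite lef_pV2 ?posrE ?mulr_gt0 ?ltr_wpDr ?addr_gt0// ler_pM2l// lerD2l.
Qed.

(** Above the threshold the two squares differ by (t^2 - sqrt gamma)^2 / t^2, which is positive;
    otherwise the two sides of the inequality coincide. *)
Lemma sigma_lim_gt t : 0 < t -> (1 + Num.sqrt gamma < sigma_lim gamma t) = (gamma `^ (1 / 4) < t).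
Proof.
move=> t0; have x0 : 0 < t ^+ 2 by rewrite exprn_gt0.
have w0 : 0 <= 1 + Num.sqrt gamma by rewrite addr_ge0 ?sqrtr_ge0.
rewrite /sigma_lim; case: ifPn => h; last by rewrite sqrtr_sqr ger0_norm// ltxx.
rewrite -[X in X < _]ger0_norm// -sqrtr_sqr ltr_sqrt.
  have hx : Num.sqrt gamma < t ^+ 2.
    by rewrite -fourth_root_sqr ltr_pXn2r ?nnegrE ?powR_ge0 ?(ltW t0).
  have gE : gamma = Num.sqrt gamma ^+ 2 by rewrite sqr_sqrtr.
  rewrite {2}gE -subr_gt0; move: (Num.sqrt gamma) (t ^+ 2) hx x0 => g x gx x0.
  have -> : (x + 1) * (1 + g ^+ 2 / x) - (1 + g) ^+ 2 = (x - g) ^+ 2 / x by field; rewrite gt_eqF.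
  by rewrite divr_gt0// exprn_gt0// subr_gt0.
by apply: mulr_gt0; [rewrite addr_gt0|rewrite ltr_wpDr// divr_ge0// ltW].
Qed.

Lemma component_loss_ge0 t : 0 <= t -> 0 <= component_loss gamma t.
Proof. by move=> t0; rewrite mulr_ge0// sqrtr_ge0. Qed.

Lemma sqr_component_loss t : 0 < t ->
  component_loss gamma t ^+ 2 = t ^+ 2 * (1 - Num.min (c_left gamma t ^+ 2) (c_right gamma t ^+ 2)).
Proof. by move=> t0; rewrite exprMn sqr_sqrtr// subr_ge0 ge_min sqr_c_left_le1. Qed.

Lemma component_loss_sub t : t <= gamma `^ (1 / 4) -> component_loss gamma t = t.
Proof.
move=> h; rewrite /component_loss /c_left /c_right ltNge h /= expr0n /= minxx subr0 sqrtr1.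
exact: mulr1.
Qed.

Lemma sqr_component_loss_tall t : 0 < t -> gamma `^ (1 / 4) < t -> gamma <= 1 ->
  component_loss gamma t ^+ 2 = (t ^+ 2 + gamma) / (t ^+ 2 + 1).
Proof.
move=> t0 h g1; rewrite sqr_component_loss// min_r ?c_right_le_left// one_minus_c_right//.
have x0 : 0 < t ^+ 2 by rewrite exprn_gt0.
have : t ^+ 2 + 1 != 0 by rewrite gt_eqF// addr_gt0.
by move: (t ^+ 2) x0 => x x0 x1; field; rewrite x1 gt_eqF.
Qed.

Lemma sqr_component_loss_wide t : 0 < t -> gamma `^ (1 / 4) < t -> 1 <= gamma ->
  component_loss gamma t ^+ 2 = gamma * (t ^+ 2 + 1) / (t ^+ 2 + gamma).
Proof.
move=> t0 h g1; rewrite sqr_component_loss// min_l ?c_left_le_right// one_minus_c_left//.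
have x0 : 0 < t ^+ 2 by rewrite exprn_gt0.
have : t ^+ 2 + gamma != 0 by rewrite gt_eqF// ltr_wpDr.
by move: (t ^+ 2) x0 => x x0 x1; field; rewrite x1 gt_eqF.
Qed.

(** With x = t^2 the squared loss is x up to the threshold, then (x + gamma) / (x + 1) for gamma <=
    1 and gamma (x + 1) / (x + gamma) for gamma >= 1. The pieces are monotone and meet at x = sqrt
    gamma with value sqrt gamma; the mixed case compares both sides with it. *)
Lemma component_loss_mono a b : 0 < a -> a <= b -> component_loss gamma a <= component_loss gamma b.
Proof.
move=> a0 ab; have b0 : 0 < b by exact: lt_le_trans ab.
have [hb|hb] := leP b (gamma `^ (1 / 4)).
  by rewrite !component_loss_sub// (le_trans ab).
rewrite -(ler_pXn2r (_ : 0 < 2)%N) ?nnegrE ?component_loss_ge0 ?(ltW a0) ?(ltW b0)//.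
have y0 : 0 < b ^+ 2 by rewrite exprn_gt0.
have x0 : 0 < a ^+ 2 by rewrite exprn_gt0.
have ab2 : a ^+ 2 <= b ^+ 2 by rewrite ler_pXn2r ?nnegrE ?(ltW a0) ?(ltW b0).
have gb : Num.sqrt gamma <= b ^+ 2.
  by rewrite -fourth_root_sqr ler_pXn2r ?nnegrE ?powR_ge0 ?(ltW b0)// ltW.
have sg := sqrtr_ge0 gamma; have gE := sqr_sqrtr gamma_ge0.
have [ha|ha] := leP a (gamma `^ (1 / 4)).
  rewrite component_loss_sub//; apply: le_trans (fourth_root_le a0 ha) _.
  have [g1|g1] := leP gamma 1.
    rewrite sqr_component_loss_tall// ler_pdivlMr ?addr_gt0//.
    have s1 : Num.sqrt gamma <= 1 by rewrite -sqrtr1 ler_sqrt.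
    rewrite -subr_ge0 -{1}gE; move: (Num.sqrt gamma) (b ^+ 2) gb sg s1 => g y gb sg s1.
    by rewrite (_ : _ - _ = (1 - g) * (y - g)); [rewrite mulr_ge0// subr_ge0|ring].
  rewrite sqr_component_loss_wide// ?(ltW g1)// ler_pdivlMr ?ltr_wpDr//.
  have s1 : 1 <= Num.sqrt gamma by rewrite -[X in X <= _]sqrtr1 ler_sqrt// ltW.
  rewrite -subr_ge0 -{1 3}gE; move: (Num.sqrt gamma) (b ^+ 2) gb sg s1 => g y gb sg s1.
  rewrite (_ : _ - _ = g * (g - 1) * (y - g)); last by ring.
  by rewrite mulr_ge0 ?subr_ge0// mulr_ge0 ?subr_ge0.
move: (a ^+ 2) (b ^+ 2) (@sqr_component_loss_tall a a0 ha) (@sqr_component_loss_tall b b0 hb)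
  (@sqr_component_loss_wide a a0 ha) (@sqr_component_loss_wide b b0 hb) ab2 x0 y0 => x y Ta Tb Wa Wb ab2 x0 y0.
have [g1|g1] := leP gamma 1.
  rewrite Ta// Tb// ler_pdivrMr ?addr_gt0// mulrAC ler_pdivlMr ?addr_gt0// -subr_ge0.
  by rewrite (_ : _ - _ = (1 - gamma) * (y - x)); [rewrite mulr_ge0 ?subr_ge0|ring].
have g1' := ltW g1.
rewrite Wa// Wb// ler_pdivrMr ?ltr_wpDr// mulrAC ler_pdivlMr ?ltr_wpDr// -subr_ge0.
rewrite (_ : _ - _ = gamma * (gamma - 1) * (y - x)); last by ring.
by rewrite mulr_ge0 ?subr_ge0// mulr_ge0 ?subr_ge0.
Qed.

End limiting_overlaps.

Section optimal_shrinkage.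
Context (R : realType) (gamma : R) (r : nat) (t : 'I_r -> R).
Hypotheses (gamma_ge0 : 0 <= gamma) (t_gt0 : forall k, 0 < t k).

Local Notation c := (fun k => c_left gamma (t k)).
Local Notation c' := (fun k => c_right gamma (t k)).

Lemma sqr_qstar k : gamma `^ (1 / 4) < t k ->
  qstar gamma t k ^+ 2 =
    t k ^+ 2 * ((t k ^+ 2 + Num.min 1 gamma) / (t k ^+ 2 + Num.max 1 gamma)).
Proof.
move=> h; rewrite /qstar sigma_lim_gt// h exprMn sqr_sqrtr//.
have x0 : 0 < t k ^+ 2 by rewrite exprn_gt0.
by rewrite divr_ge0// addr_ge0 ?(ltW x0)// ?le_min ?le_max ?ler01.
Qed.

Lemma qstar_ge0 k : 0 <= qstar gamma t k.
Proof. by rewrite /qstar; case: ifP => // _; rewrite mulr_ge0 ?sqrtr_ge0// ltW. Qed.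

Lemma qstar_sub k : t k <= gamma `^ (1 / 4) -> qstar gamma t k = 0.
Proof. by move=> h; rewrite /qstar sigma_lim_gt// ltNge h. Qed.

Lemma eq_sqr (x y : R) : 0 <= x -> 0 <= y -> x ^+ 2 = y ^+ 2 -> x = y.
Proof. by move=> x0 y0 /eqP; rewrite eqrXn2// => /eqP. Qed.

(** This is the origin of the shrinkage formula: it is the orthogonality condition of
    [opnorm_loss_model_le]. For gamma >= 1 the condition for the transposed block holds instead. *)
Lemma qstar_tall k : gamma <= 1 -> qstar gamma t k * c k = t k * c' k.
Proof.
move=> g1; have [h|h] := leP (t k) (gamma `^ (1 / 4)).
  by rewrite qstar_sub// mul0r /c_right ltNge h mulr0.
apply: eq_sqr; first by rewrite mulr_ge0 ?qstar_ge0 ?c_left_ge0.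
  by rewrite mulr_ge0 ?c_right_ge0// ltW.
rewrite !exprMn sqr_qstar// sqr_c_left// sqr_c_right// min_r// max_l//.
have x0 : 0 < t k ^+ 2 by rewrite exprn_gt0.
have x1 : t k ^+ 2 + 1 != 0 by rewrite gt_eqF// addr_gt0.
have xg : t k ^+ 2 + gamma != 0 by rewrite gt_eqF// ltr_wpDr.
by move: (t k ^+ 2) x0 x1 xg => x x0 x1 xg; field; rewrite x1 xg gt_eqF.
Qed.

Lemma qstar_wide k : 1 <= gamma -> qstar gamma t k * c' k = t k * c k.
Proof.
move=> g1; have [h|h] := leP (t k) (gamma `^ (1 / 4)).
  by rewrite qstar_sub// mul0r /c_left ltNge h mulr0.
apply: eq_sqr; first by rewrite mulr_ge0 ?qstar_ge0 ?c_right_ge0.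
  by rewrite mulr_ge0 ?c_left_ge0// ltW.
rewrite !exprMn sqr_qstar// sqr_c_left// sqr_c_right// min_l// max_r//.
have x0 : 0 < t k ^+ 2 by rewrite exprn_gt0.
have x1 : t k ^+ 2 + 1 != 0 by rewrite gt_eqF// addr_gt0.
have xg : t k ^+ 2 + gamma != 0 by rewrite gt_eqF// ltr_wpDr.
by move: (t k ^+ 2) x0 x1 xg => x x0 x1 xg; field; rewrite x1 xg gt_eqF.
Qed.

Lemma residual_left k : (t k * complement c k) ^+ 2 <= component_loss gamma (t k) ^+ 2.
Proof.
rewrite sqr_component_loss// exprMn sqr_sqrtr ?subr_ge0 ?sqr_c_left_le1//.
by rewrite ler_wpM2l ?sqr_ge0// lerD2l lerN2 ge_min lexx.
Qed.

Lemma residual_right k : (t k * complement c' k) ^+ 2 <= component_loss gamma (t k) ^+ 2.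
Proof.
rewrite sqr_component_loss// exprMn sqr_sqrtr ?subr_ge0 ?sqr_c_right_le1//.
by rewrite ler_wpM2l ?sqr_ge0// lerD2l lerN2 ge_min lexx orbT.
Qed.

(** Above the threshold the left side is exactly gamma; in the wide case the corresponding quantity
    is exactly 1. *)
Lemma qstar_residual_tall k : gamma <= 1 ->
  (complement c k * qstar gamma t k) ^+ 2 <= component_loss gamma (t k) ^+ 2.
Proof.
move=> g1; have [h|h] := leP (t k) (gamma `^ (1 / 4)).
  by rewrite qstar_sub// mulr0 expr0n sqr_ge0.
rewrite sqr_component_loss_tall// exprMn sqr_sqrtr ?subr_ge0 ?sqr_c_left_le1//.
rewrite one_minus_c_left// sqr_qstar// min_r// max_l//.
have x0 : 0 < t k ^+ 2 by rewrite exprn_gt0.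
have x1 : 0 < t k ^+ 2 + 1 by rewrite addr_gt0.
have xg : t k ^+ 2 + gamma != 0 by rewrite gt_eqF// ltr_wpDr.
move: (t k ^+ 2) x0 x1 xg => x x0 x1 xg.
have -> : gamma * (x + 1) / (x * (x + gamma)) * (x * ((x + gamma) / (x + 1))) = gamma.
  by field; rewrite xg !gt_eqF.
rewrite ler_pdivlMr// mulrDr mulr1 lerD2r.
by rewrite -[leRHS]mul1r ler_wpM2r// ltW.
Qed.

Lemma qstar_residual_wide k : 1 <= gamma ->
  (complement c' k * qstar gamma t k) ^+ 2 <= component_loss gamma (t k) ^+ 2.
Proof.
move=> g1; have [h|h] := leP (t k) (gamma `^ (1 / 4)).
  by rewrite qstar_sub// mulr0 expr0n sqr_ge0.
rewrite sqr_component_loss_wide// exprMn sqr_sqrtr ?subr_ge0 ?sqr_c_right_le1//.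
rewrite one_minus_c_right// sqr_qstar// min_l// max_r//.
have x0 : 0 < t k ^+ 2 by rewrite exprn_gt0.
have x1 : t k ^+ 2 + 1 != 0 by rewrite gt_eqF// addr_gt0.
have xg : 0 < t k ^+ 2 + gamma by rewrite ltr_wpDr.
move: (t k ^+ 2) x0 x1 xg => x x0 x1 xg.
have -> : (x + gamma) / (x * (x + 1)) * (x * ((x + 1) / (x + gamma))) = 1.
  by field; rewrite x1 !gt_eqF.
rewrite ler_pdivlMr// mul1r mulrDr mulr1 lerD2r.
by rewrite -[leLHS]mul1r ler_wpM2r// ltW.
Qed.

Lemma opnorm_qstar_le L : 0 <= L -> (forall k, component_loss gamma (t k) <= L) ->
  opnorm (loss_model (qstar gamma t) t c c') <= L.
Proof.
move=> L0 hL; have sqL k : component_loss gamma (t k) ^+ 2 <= L ^+ 2.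
  by rewrite ler_pXn2r ?nnegrE ?component_loss_ge0// ltW.
have [g1|g1] := leP gamma 1.
  apply: opnorm_loss_model_le => // k.
  - exact: sqr_c_right_le1.
  - exact: qstar_tall.
  - exact: le_trans (residual_right k) (sqL k).
  - exact: le_trans (qstar_residual_tall k g1) (sqL k).
have {}g1 := ltW g1; rewrite -opnorm_tr tr_loss_model; apply: opnorm_loss_model_le => // k.
- exact: sqr_c_left_le1.
- exact: qstar_wide.
- exact: le_trans (residual_left k) (sqL k).
- exact: le_trans (qstar_residual_wide k g1) (sqL k).
Qed.

(** The lower bound applies to the model and to its transpose, which exchanges the overlaps; the
    minimum in [component_loss] selects the larger of the two bounds. *)
Lemma component_loss_le_opnorm (q : 'I_r -> R) k :
  component_loss gamma (t k) <= opnorm (loss_model q t c c').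
Proof.
have hr := opnorm_loss_model_ge q c (c' := c') (ltW (t_gt0 k)) (sqr_c_right_le1 gamma_ge0 (t_gt0 k)).
have := opnorm_loss_model_ge q c' (c' := c) (ltW (t_gt0 k)) (sqr_c_left_le1 gamma_ge0 (t_gt0 k)).
rewrite -tr_loss_model opnorm_tr => hl.
by rewrite /component_loss minEle; case: ifP.
Qed.

End optimal_shrinkage.

Lemma bigmax_first (R : realType) (r : nat) (r0 : (0 < r)%N) (f : 'I_r -> R) :
  (forall k, 0 <= f k) -> (forall k, f k <= f (Ordinal r0)) ->
  \big[Num.max/0]_(k < r) f k = f (Ordinal r0).
Proof.
move=> f0 fle; apply/le_anti/andP; split; first exact: bigmax_le.
exact: le_bigmax.
Qed.

(** * From the band form to the loss *)

Section deterministic_loss.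
Context (R : realType) (r : nat) (t : 'I_r -> R) (gamma : R).
Hypotheses (r0 : (0 < r)%N) (t_gt0 : forall k, 0 < t k) (gamma_ge0 : 0 <= gamma).
Hypothesis t_decr : forall i j : 'I_r, (i < j)%N -> t j < t i.

Local Notation c := (fun k => c_left gamma (t k)).
Local Notation c' := (fun k => c_right gamma (t k)).

Definition spike (i : nat) : R := if insub i is Some k then t k else 0.

Lemma spike_ord (k : 'I_r) : spike k = t k.
Proof. by rewrite /spike valK. Qed.

Lemma spike_ge_r i : (r <= i)%N -> spike i = 0.
Proof. by move=> ri; rewrite /spike insubN// -leqNgt. Qed.

Lemma spike_gt0 i : (i < r)%N -> 0 < spike i.
Proof. by move=> ir; rewrite -[i]/(val (Ordinal ir)) spike_ord. Qed.

Lemma spike_decr i j : (i < j)%N -> (j < r)%N -> spike j < spike i.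
Proof.
move=> ij jr; have ir := ltn_trans ij jr.
rewrite -[i]/(val (Ordinal ir)) -[j]/(val (Ordinal jr)) !spike_ord; exact: t_decr.
Qed.

Lemma left_overlap_spike (k : 'I_r) : left_overlap spike (Num.sqrt gamma) k = c k.
Proof. by rewrite /left_overlap /c_left sqrt_sqrt_fourth_root// spike_ord sqr_sqrtr. Qed.

Lemma right_overlap_spike (k : 'I_r) : right_overlap spike (Num.sqrt gamma) k = c' k.
Proof. by rewrite /right_overlap /c_right sqrt_sqrt_fourth_root// spike_ord sqr_sqrtr. Qed.

Lemma svd_rotate m n (Y : 'M[R]_(m, n)) U s V Q1 Q2 : Q1^T *m Q1 = 1%:M -> Q2^T *m Q2 = 1%:M ->
  is_svd Y U s V -> is_svd (Q1^T *m Y *m Q2) (Q1^T *m U) s (Q2^T *m V).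
Proof.
move=> q1 q2 [UU VV s0 sle YE]; split => //.
- by rewrite trmx_mul trmxK -mulmxA [Q1 *m _]mulmxA (mulmx1C q1) mul1mx.
- by rewrite trmx_mul trmxK -mulmxA [Q2 *m _]mulmxA (mulmx1C q2) mul1mx.
- by rewrite YE trmx_mul trmxK !mulmxA.
Qed.

Lemma low_rank_rotate m n (u : 'I_r -> 'cV[R]_m) (v : 'I_r -> 'cV[R]_n) Q1 Q2 :
  (forall (i : 'I_r) (j : 'I_m), ((u i)^T *m Q1) 0 j = (i == j :> nat)%:R) ->
  (forall (i : 'I_r) (j : 'I_n), ((v i)^T *m Q2) 0 j = (i == j :> nat)%:R) ->
  Q1^T *m low_rank t u v *m Q2 = \matrix_(i, j) (spike i *+ (i == j :> nat)).
Proof.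
move=> hu hv; rewrite /low_rank mulmx_sumr mulmx_suml; apply/matrixP => i j.
rewrite summxE [RHS]mxE.
have term k : (Q1^T *m (t k *: (u k *m (v k)^T)) *m Q2) i j = t k * ((k == i :> nat)%:R * (k == j :> nat)%:R).
  have -> : Q1^T *m (t k *: (u k *m (v k)^T)) *m Q2 = t k *: (((u k)^T *m Q1)^T *m ((v k)^T *m Q2)).
    by rewrite -scalemxAr -scalemxAl trmx_mul trmxK !mulmxA.
  by rewrite mxE [in LHS]mxE big_ord1 hv mxE hu.
under eq_bigr do rewrite term.
have [ri|ir] := leqP r i.
  rewrite spike_ge_r// mul0rn big1// => k _.
  by rewrite ltn_eqF ?mul0r ?mulr0// (leq_trans (ltn_ord k)).
rewrite (bigD1 (Ordinal ir))//= eqxx mul1r big1 ?addr0 => [|k]; last first.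
  by rewrite -val_eqE /= => /negbTE ->; rewrite mul0r mulr0.
by rewrite (spike_ord (Ordinal ir) : spike i = _); case: (_ == _); rewrite ?mulr1 ?mulr0.
Qed.

(** Rotation by [Q1] and [Q2] turns the data into a spiked band matrix and carries the singular
    value decomposition along. The first [r] coordinates of the rotated singular vectors are their
    inner products with the signal vectors, so [eventually_overlap] supplies what [loss_continuity]
    asks for. *)
Lemma loss_near_model (q : 'I_r -> R) (eps : R) : 0 < eps ->
  exists eta N, 0 < eta /\ forall m n (u : 'I_r -> 'cV[R]_m) (v : 'I_r -> 'cV[R]_n)
    (Z : 'M[R]_(m, n)) (uh : 'I_r -> 'cV[R]_m) (vh : 'I_r -> 'cV[R]_n) Q1 Q2,
  (r <= m)%N -> (r <= n)%N -> orthonormal_family u -> orthonormal_family v ->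
  Q1^T *m Q1 = 1%:M -> Q2^T *m Q2 = 1%:M ->
  (forall (i : 'I_r) (j : 'I_m), ((u i)^T *m Q1) 0 j = (i == j :> nat)%:R) ->
  (forall (i : 'I_r) (j : 'I_n), ((v i)^T *m Q2) 0 j = (i == j :> nat)%:R) ->
  band_near r (Num.sqrt gamma) eta N (Q1^T *m Z *m Q2) ->
  top_singular_vectors (low_rank t u v + Z) uh vh ->
  `|opnorm (low_rank q uh vh - low_rank t u v) - opnorm (loss_model q t c c')| <= eps.
Proof.
move=> eps0.
have c01 k : 0 <= c k <= 1.
  by rewrite c_left_ge0 -[c k]ger0_norm ?c_left_ge0//= ler_norm_sqr// expr1n sqr_c_left_le1.
have c01' k : 0 <= c' k <= 1.
  by rewrite c_right_ge0 -[c' k]ger0_norm ?c_right_ge0//= ler_norm_sqr// expr1n sqr_c_right_le1.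
have [e e0 He] := loss_continuity q t c01 c01' eps0.
have [eta [N [eta0 Hov]]] := eventually_overlap r0 (sqrtr_ge0 gamma) spike_ge_r spike_gt0 spike_decr e0.
exists eta, N; split => // m n u v Z uh vh Q1 Q2 rm rn ou ov q1 q2 hu hv hB [U [s [V [svd huv]]]].
have := svd_rotate q1 q2 svd.
rewrite mulmxDr mulmxDl (low_rank_rotate hu hv) => svd'.
have hov := Hov _ _ _ hB _ _ _ svd'.
pose i0 (k : 'I_r) : 'I_m := widen_ord rm k; pose j0 (k : 'I_r) : 'I_n := widen_ord rn k.
have uhE k : uh k = col (i0 k) U by have [] := huv k (i0 k) (j0 k) erefl erefl.
have vhE k : vh k = col (j0 k) V by have [] := huv k (i0 k) (j0 k) erefl erefl.
have proj p (x : 'cV[R]_p) (Q W : 'M[R]_p) (i l : 'I_p) : Q *m Q^T = 1%:M ->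
    (forall j : 'I_p, (x^T *m Q) 0 j = (i == j)%:R) -> (Q^T *m W) i l = dot x (col l W).
  move=> QQ hx; have -> : dot x (col l W) = (x^T *m Q *m (Q^T *m W)) 0 l.
    rewrite mulmxA -[x^T *m Q *m _]mulmxA QQ mulmx1 [RHS]mxE.
    by apply: eq_bigr => a _; rewrite !mxE.
  rewrite [RHS]mxE (bigD1 i)//= hx eqxx mul1r big1 ?addr0// => a.
  by rewrite hx eq_sym => /negbTE ->; rewrite mul0r.
have ov1 (k i : 'I_r) : (Q1^T *m U) (i0 i) (i0 k) = dot (u i) (uh k).
  by rewrite uhE; apply: proj => [|j]; [exact: mulmx1C|rewrite hu].
have ov2 (k i : 'I_r) : (Q2^T *m V) (j0 i) (j0 k) = dot (v i) (vh k).
  by rewrite vhE; apply: proj => [|j]; [exact: mulmx1C|rewrite hv].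
(* The undetermined sign of a singular pair is common to both sides; it is absorbed into [Xh] and
   [Yh] and cancels in their products. *)
have /choice [sg hsg] : forall k : 'I_r, exists e1 : R, [/\ e1 = 1 \/ e1 = -1,
    forall i, `|dot (u i) (uh k) - e1 * c k * (i == k)%:R| <= e &
    forall i, `|dot (v i) (vh k) - e1 * c' k * (i == k)%:R| <= e].
  move=> k; have [e1 e11 [h1 h2]] := hov k (ltn_ord k); exists e1; split => // i.
    by rewrite -ov1 -left_overlap_spike; exact: (h1 (i0 i) (i0 k) erefl (ltn_ord i)).
  by rewrite -ov2 -right_overlap_spike; exact: (h2 (j0 i) (j0 k) erefl (ltn_ord i)).
have sg2 k : sg k * sg k = 1 by have [[->|->] _ _] := hsg k; ring.
have nsg k : `|sg k| = 1 by have [[->|->] _ _] := hsg k; rewrite ?normrN normr1.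
pose X : 'M[R]_(m, r) := \matrix_(a, k) u k a 0.
pose Xh : 'M[R]_(m, r) := \matrix_(a, k) (sg k * uh k a 0).
pose Y : 'M[R]_(n, r) := \matrix_(a, k) v k a 0.
pose Yh : 'M[R]_(n, r) := \matrix_(a, k) (sg k * vh k a 0).
have gram p (f h : 'I_r -> 'cV[R]_p) (a b : 'I_r -> R) i j :
    ((\matrix_(l, k) (a k * f k l 0))^T *m (\matrix_(l, k) (b k * h k l 0)) : 'M[R]_r) i j =
    a i * b j * dot (f i) (h j).
  by rewrite mxE /dot mulr_sumr; apply: eq_bigr => l _; rewrite !mxE; ring.
have orth p (f : 'I_r -> 'cV[R]_p) i j : orthonormal_family f -> dot (f i) (f j) = (i == j)%:R.
  by move=> of_; rewrite dotE of_ mxE eqxx mulr1n.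
have orthcol p (W : 'M[R]_p) (l : 'I_r -> 'I_p) i j : injective l -> W^T *m W = 1%:M ->
    dot (col (l i) W) (col (l j) W) = (i == j)%:R.
  by move=> li WW; rewrite dot_col WW mxE (inj_eq li).
have X1 : X = \matrix_(l, k) (1 * u k l 0) by apply/matrixP => a b; rewrite !mxE mul1r.
have Y1 : Y = \matrix_(l, k) (1 * v k l 0) by apply/matrixP => a b; rewrite !mxE mul1r.
have [UU VV _ _ _] := svd.
have i0_inj : injective i0 by move=> a b /(congr1 val) /= h; apply: val_inj.
have j0_inj : injective j0 by move=> a b /(congr1 val) /= h; apply: val_inj.
have XX : X^T *m X = 1%:M.
  by apply/matrixP => i j; rewrite X1 gram !mul1r orth// mxE.
have YY : Y^T *m Y = 1%:M.
  by apply/matrixP => i j; rewrite Y1 gram !mul1r orth// mxE.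
have XhXh : Xh^T *m Xh = 1%:M.
  apply/matrixP => i j; rewrite gram !uhE orthcol// mxE.
  by have [->|_] := eqVneq i j; rewrite ?mulr0// sg2 mulr1.
have YhYh : Yh^T *m Yh = 1%:M.
  apply/matrixP => i j; rewrite gram !vhE orthcol// mxE.
  by have [->|_] := eqVneq i j; rewrite ?mulr0// sg2 mulr1.
have near_sg (x y : R) (b : bool) k : `|x - sg k * y * b%:R| <= e -> `|sg k * x - y *+ b| <= e.
  move=> h; rewrite (_ : sg k * x - _ = sg k * (x - sg k * y * b%:R)); first by rewrite normrM nsg mul1r.
  transitivity (sg k * x - sg k * sg k * y * b%:R); last by ring.
  by rewrite sg2 mul1r; case: b h => _; rewrite ?mulr1 ?mulr0.
have hX i j : `|(X^T *m Xh) i j - c j *+ (i == j)| <= e.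
  by rewrite X1 gram mul1r; apply: near_sg; have [_ h _] := hsg j.
have hY i j : `|(Y^T *m Yh) i j - c' j *+ (i == j)| <= e.
  by rewrite Y1 gram mul1r; apply: near_sg; have [_ _ h] := hsg j.
have DE : low_rank q uh vh - low_rank t u v = Xh *m cosine q *m Yh^T - X *m cosine t *m Y^T.
  congr (_ - _); rewrite /low_rank; apply/matrixP => a b; rewrite summxE [RHS]mxE;
    apply: eq_bigr => k _; rewrite cosine_mulr !mxE big_ord1 !mxE; last by ring.
  by rewrite -[LHS]mul1r -(sg2 k); ring.
by rewrite DE; apply: He.
Qed.

End deterministic_loss.

Theorem theorem3p1 (R : realType) (d : measure_display) (T : measurableType d)
    (P : probability T R)
    (r : nat) (r_gt0 : (0 < r)%N)
    (t : 'I_r -> R)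
    (t_gt0 : forall k, 0 < t k)
    (t_decr : forall i j : 'I_r, (i < j)%N -> t j < t i)
    (gamma : R) (gamma_ge0 : 0 <= gamma)
    (p : nat -> nat)
    (p_infty : p @ \oo --> \oo)
    (p_ratio : ((p n)%:R / n%:R : R) @[n --> \oo] --> gamma)
    (u : forall n, 'I_r -> 'cV[R]_(p n))
    (v : forall n, 'I_r -> 'cV[R]_n)
    (* r orthonormal vectors exist only in dimension at least r *)
    (uv_orthonormal : forall n, (r <= p n)%N -> (r <= n)%N ->
       orthonormal_family (u n) /\ orthonormal_family (v n))
    (G : forall n, 'I_(p n) * 'I_n -> {RV P >-> R})
    (G_gaussian : forall n, gaussian_noise (@G n))
    (uh : forall n, T -> 'I_r -> 'cV[R]_(p n))
    (vh : forall n, T -> 'I_r -> 'cV[R]_n)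
    (uvh_singular : forall n w,
       top_singular_vectors (low_rank t (u n) (v n) + noise_mx (@G n) w)
         (uh n w) (vh n w)) :
  exists Linf : ('I_r -> R) -> R,
    [/\ (* Linf q is the almost sure limit of the loss of the estimator q *)
        forall q : 'I_r -> R,
          {ae P, forall w,
            opnorm (low_rank q (uh n w) (vh n w) - low_rank t (u n) (v n))
              @[n --> \oo] --> Linf q},
        forall q : 'I_r -> R, Linf (qstar gamma t) <= Linf q,
        (* the terms are nonnegative and r > 0, so the unit 0 is harmless *)
        Linf (qstar gamma t) =
          \big[Num.max/0]_(k < r) component_loss gamma (t k)
      & \big[Num.max/0]_(k < r) component_loss gamma (t k) =
          component_loss gamma (t (Ordinal r_gt0))].
Proof.
pose c k := c_left gamma (t k); pose c' k := c_right gamma (t k).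
have first_max k : component_loss gamma (t k) <= component_loss gamma (t (Ordinal r_gt0)).
  apply: component_loss_mono => //; have [k0|k0] := posnP (k : nat).
    by rewrite le_eqVlt; apply/orP; left; apply/eqP; congr (t _); exact: val_inj.
  exact/ltW/t_decr.
have loss_ge0 k : 0 <= component_loss gamma (t k) by rewrite component_loss_ge0// ltW.
have maxE := bigmax_first loss_ge0 first_max.
have opt : opnorm (loss_model (qstar gamma t) t c c') = component_loss gamma (t (Ordinal r_gt0)).
  apply/le_anti/andP; split; first exact: opnorm_qstar_le.
  exact: component_loss_le_opnorm.
exists (fun q => opnorm (loss_model q t c c')); split; first last.
- exact: maxE.
- by rewrite maxE opt.
- by move=> q; rewrite opt; exact: component_loss_le_opnorm.
move=> q.
(* Tolerance 1 / (k + 1) and corner size [k] run through a countable family, so one null set serves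
   every [eps]. *)
have ae_band : {ae P, forall w, forall k : nat, \forall n \near \oo,
    has_band_form gamma u v G k.+1%:R^-1 k n w}.
  apply/ae_foralln => k; apply: (ae_band_form_eps gamma_ge0 r_gt0 p_infty p_ratio uv_orthonormal G_gaussian).
  by rewrite invr_gt0 ltr0n /= invf_le1 ?ler1n ?ltr0n.
apply: filterS ae_band => w band.
apply/cvgrPdist_le => eps eps0.
have [eta [N [eta0 H]]] := loss_near_model r_gt0 t_gt0 gamma_ge0 t_decr q eps0.
(* A single index has to give a corner of size at least [N] and a tolerance of at most [eta]. *)
pose k := maxn N (Num.truncn eta^-1).
have keta : k.+1%:R^-1 <= eta.
  rewrite invf_ple ?posrE// ltW//; apply: lt_le_trans (truncnS_gt _) _.
  by rewrite ler_nat ltnS leq_maxr.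
have band_k := band k.
have rp_near : \forall n \near \oo, (r <= p n)%N.
  by have := p_infty; move=> /(_ [set l | (r <= l)%N]); apply; exists r.
near=> n.
have [Q1 [Q2 [q1 q2 hu hv hB]]] : has_band_form gamma u v G k.+1%:R^-1 k n w by near: n.
have rn : (r <= n)%N by near: n; exists r.
have rp : (r <= p n)%N by near: n.
have [ou ov] := uv_orthonormal n rp rn.
rewrite distrC; apply: (H _ _ _ _ _ _ _ _ _ rp rn ou ov q1 q2 hu hv _ (uvh_singular n w)).
exact: band_near_le keta (leq_maxl _ _) hB.
Unshelve. all: by end_near.
Qed.
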